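(* For $\theta\in\mathbb{R}$ consider the Mallows model on $S_n$ with Kendall's tau, $$M_{n,\theta}(\pi)=e^{\frac{\theta}{n}Inv(\pi)-C_n(\theta)},\qquad Inv(\pi):=\sum_{i<j}1_{\pi(i)>\pi(j)},$$ where $C_n(\theta)$ is the log normalizing constant. Let $h:[0,1]^4\to\mathbb{R}$ be $$h((x_1,y_1),(x_2,y_2)):=1_{(x_1-x_2)(y_1-y_2)<0}.$$ (a) One has $$\lim_{n\to\infty}\frac{C_n(\theta)-C_n(0)}{n}=C(\theta):=\sup_{\mu\in\mathcal{M}}\Big\{\frac{\theta}{2}(\mu\times\mu)(h)-D(\mu\|u)\Big\}.$$ Further, the supremum is attained at a unique measure on the unit square, given by the density $$\rho_\theta(x,y):=\frac{\frac{\theta}{2}\sinh\frac{\theta}{2}}{\Big[e^{-\frac{\theta}{4}}\cosh\big(\frac{\theta(x-y)}{2}\big)-e^{\frac{\theta}{4}}\cosh\big(\frac{\theta(x+y-1)}{2}\big)\Big]^2},$$ and consequently $$C(\theta)=\int_0^1\log\frac{e^{\theta x}-1}{\theta x}\,dx.$$ (For $\theta=0$ the last two expressions are understood as their limits as $\theta\to0$.) (b) If $\pi$ is a sample from $M_{n,\theta_0}$, $\theta_0\in\mathbb{R}$, then each of the expressions (as functions of $\theta\in\mathbb{R}$) $$\widetilde{ML}_n(\pi,\theta):=\frac{1}{n^2}Inv(\pi)-\frac1n C_n'(\theta),\qquad \widetilde{LD}_n(\pi,\theta):=\frac{1}{n^2}Inv(\pi)-C'(\theta)$$ has, with probability tending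 to $1$ as $n\to\infty$, a unique root, denoted $\widetilde\theta_{ML}$ and $\widetilde\theta_{LD}$ respectively, and these are consistent, i.e. they converge in probability to $\theta_0$.
   Context: $S_n$ is the set of permutations of $\{1,\dots,n\}$; $C_n(\theta)=\log\sum_{\pi\in S_n}e^{\frac{\theta}{n}Inv(\pi)}$, so $C_n(0)=\log n!$. $\mathcal{M}$ is the set of all Borel probability measures on $[0,1]^2$ with both marginals uniform on $[0,1]$; $u$ is the uniform distribution on $[0,1]^2$; $D(\mu\|u)$ is the Kullback-Leibler divergence ($+\infty$ if $\mu$ is not absolutely continuous with respect to $u$). $(\mu\times\mu)(h)=\int h\,d(\mu\times\mu)$. Densities are with respect to Lebesgue measure on $[0,1]^2$; primes denote derivatives with respect to $\theta$. On the event of vanishing probability where a unique root does not exist, the estimator is defined arbitrarily. *)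

(* Defs.v *)
From mathcomp Require Import all_boot all_order all_algebra perm.
From mathcomp Require Import all_classical all_reals all_analysis.

Set Implicit Arguments.
Unset Strict Implicit.
Unset Printing Implicit Defensive.

Import Order.TTheory GRing.Theory Num.Theory.
Import numFieldNormedType.Exports.

Local Open Scope classical_set_scope.
Local Open Scope ring_scope.

Section Mallows.
Context {R : realType}.
Implicit Types (n : nat) (theta : R).

(* Permutations of {1, ..., n} are represented as permutations of {0, ..., n - 1}. *)
Definition Inv n (s : 'S_n) : nat :=
  (\sum_(i < n) \sum_(j < n | (i < j)%N) (s j < s i)%N)%N.

Definition Cn n theta : R :=
  ln (\sum_(s : 'S_n) expR (theta / n%:R * (Inv s)%:R)).

Definition mallows n theta (s : 'S_n) : R :=
  expR (theta / n%:R * (Inv s)%:R - Cn n theta).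

Definition Pr_mallows n theta (E : set 'S_n) : R :=
  \sum_(s : 'S_n | `[< E s >]) mallows theta s.
Arguments Pr_mallows : clear implicits.

Definition unique_root (f : R -> R) : Prop := exists! t, f t = 0.

(* No constraint on [est n s] when [F n s] does not have a unique root. *)
Definition root_estimator (F : forall n, 'S_n -> R -> R)
    (est : forall n, 'S_n -> R) : Prop :=
  forall n (s : 'S_n), unique_root (F n s) -> F n s (est n s) = 0.

Definition consistent_at theta (est : forall n, 'S_n -> R) : Prop :=
  forall e : R, 0 < e ->
    Pr_mallows n theta [set s : 'S_n | e < `|est n s - theta|] @[n --> \oo] --> 0.

End Mallows.
Arguments Pr_mallows {R} n theta E.

Section Variational.
Local Open Scope charge_scope.
Context {R : realType}.
Local Notation mR := (measurableTypeR R).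
Local Notation plane := (mR * mR)%type.
Implicit Types (theta : R) (mu : probability plane R).
Local Open Scope ereal_scope.

Definition unit_square : set plane := [set` `[0%R, 1%R]] `*` [set` `[0%R, 1%R]].

Definition uniform01 : probability mR R := uniform_prob (@ltr01 R).

Definition uniform_square : probability plane R := uniform01 \x uniform01.

(* A Borel probability measure on [0,1]^2 is represented by a Borel
   probability measure on R^2 giving mass 1 to [0,1]^2. *)
Definition permuton mu : Prop :=
  [/\ mu unit_square = 1,
      forall A : set mR, measurable A -> pushforward mu fst A = uniform01 A &
      forall A : set mR, measurable A -> pushforward mu snd A = uniform01 A].

(* The negative part of the integrand is always [mu]-integrable, so that the
   integral is well defined in [0, +oo]. *)
Definition KL mu (nu : probability plane R) : \bar R :=
  if `[< mu `<< nu >]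
  then \int[mu]_z lne (('d (charge_of_finite_measure mu) '/d nu) z)
  else +oo.

Definition h (p q : plane) : R := (((p.1 - q.1) * (p.2 - q.2) < 0)%R)%:R.

Definition objective theta mu : \bar R :=
  (theta / 2)%:E * \int[mu \x mu]_z (h z.1 z.2)%:E - KL mu uniform_square.

Definition Csup theta : \bar R := ereal_sup [set objective theta mu | mu in permuton].

Definition C theta : R := fine (Csup theta).

Definition density_on_square mu (f : R -> R -> R) : Prop :=
  forall A : set plane, measurable A ->
    mu A = \int[(@lebesgue_measure R) \x (@lebesgue_measure R)]_(z in A `&` unit_square)
             (f z.1 z.2)%:E.

(* The formulas below are 0/0 at theta = 0, where they are understood as their
   limits as theta -> 0. *)
Definition ext0 (T : ptopologicalType) (f : R -> T) theta : T :=
  if theta == 0%R then lim (f t @[t --> (0%R : R)^']) else f theta.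

Local Open Scope ring_scope.

Definition sinh (x : R) : R := (expR x - expR (- x)) / 2.
Definition cosh (x : R) : R := (expR x + expR (- x)) / 2.

Definition rho_formula (x y theta : R) : R :=
  theta / 2 * sinh (theta / 2) /
  (expR (- (theta / 4)) * cosh (theta * (x - y) / 2)
   - expR (theta / 4) * cosh (theta * (x + y - 1) / 2)) ^+ 2.

Definition rho theta (x y : R) : R := ext0 (rho_formula x y) theta.

Definition C_formula theta : \bar R :=
  (\int[lebesgue_measure]_(x in `[0%R, 1%R])
     (ln ((expR (theta * x) - 1) / (theta * x)))%:E)%E.

Definition ML n (s : 'S_n) theta : R :=
  (n%:R ^+ 2)^-1 * (Inv s)%:R - n%:R^-1 * derive1 (@Cn R n) theta.

Definition LD n (s : 'S_n) theta : R :=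
  (n%:R ^+ 2)^-1 * (Inv s)%:R - derive1 C theta.

End Variational.

(* Main.v *)
From HB Require Import structures.
Require Import Defs.
From mathcomp Require Import all_boot all_order all_algebra perm.
From mathcomp Require Import all_classical all_reals all_analysis.
From mathcomp Require Import measurable_realfun.
From mathcomp Require Import zify ring lra.

(** Why the theorem is true.

    The limit of the normalizing constant. Choosing the first value of a
    permutation and then the pattern of the others shows that the generating
    function of inversions is the product of the geometric sums
    [1 + q + ... + q^i] ([sum_Inv_prod]). For [q = expR (theta / n)] each of them
    is a ratio of values of [expR (ucgf t) = (expR t - 1) / t]. So
    [(Cn n theta - Cn n 0) / n] is, up to a vanishing term, a Riemann sum of
    [ucgf (theta * x)], and converges to its integral [mrate theta]
    ([cvg_Cn]).

    The variational problem. It is solved by an exact computation, independently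
    of the limit above. Let [mu] be a permuton with density [f] and distribution
    function [G], and let [g (x, y)] be the distribution function at [x] of the
    first coordinate given the second one, which is the derivative of [G] in
    [y]. At a random point [(X, Y)] of [mu] the variables [X] and [g (X, Y)] are
    both uniform, by the probability integral transform, so [ln X] and
    [ln (g (X, Y))] have the same mean; and the probability of an inversion is
    [1 - 2 * E (G (X, Y))] ([integral_inversions]). Hence the function
    [l = ln g - ln x + theta * (x - G) - ucgf (theta * x)] has [mu]-integral
    [theta / 2] times the inversion probability, minus [mrate theta]. On a column
    [expR l] is a function of [G] times [g], the derivative of [G], so that its
    integral is explicit: it is [1]. Thus [expR l] is a probability density, and
    Gibbs' inequality, in the form [gibbs_hellinger] which keeps a Hellinger
    distance as defect, gives [objective theta mu <= mrate theta] with equality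
    if and only if [f = expR l] almost everywhere ([objective_le],
    [objective_density_eq], [objective_density_attained]).

    Uniqueness and existence. Integrating [f = expR l] over quadrants gives the
    differential equation
    [dG/dx = expR (theta * x) * (1 - expR (- theta * G)) / (expR (theta * x) - 1)],
    by which [(expR (theta * G) - 1) / (expR (theta * x) - 1)] does not depend on
    [x]. As [G] equals [y] at [x = 1], this determines [G] and the measure
    ([maximiser_unique]). The solution is the Frank copula, whose density is
    [rho theta]; it is checked directly that it is a permuton satisfying
    [f = expR l] ([frank_permuton], [objective_frank]). Writing
    [texp theta t] for [(expR (theta * t) - 1) / theta], equal to [t] for
    [theta = 0], makes all this uniform in [theta].

    The estimators. [C = mrate] is differentiable and strictly convex. An
    exponential Markov inequality, with [cvg_Cn], shows that the inversion density
    [Inv s / n^2] converges in probability to the derivative of [mrate] at the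
    true parameter ([invdens_cvg]). Both estimating equations equate the inversion
    density with the derivative of a strictly convex function, [Cn n / n] or
    [mrate], and these converge pointwise to [mrate] up to constants. By convexity
    such an equation has exactly one root, close to the true parameter, once the
    inversion density is close to its limit ([root_criterion],
    [unique_root_cvg]). *)

Set Implicit Arguments.
Unset Strict Implicit.
Unset Printing Implicit Defensive.

Import Order.TTheory GRing.Theory Num.Theory.
Import numFieldNormedType.Exports.

Local Open Scope classical_set_scope.
Local Open Scope ring_scope.

(** * Derivatives of real functions *)

Section derive_rules.
Context {R : realType}.
Implicit Types (f g : R -> R) (x a b c : R).

(** The rules below are for functions written pointwise and have derivatives in
    ring form, so that the derivative of a formula is built by one term and
    compared with the expected one by [field]. *)
Lemma is_derive_add f g x a b : is_derive x 1 f a -> is_derive x 1 g b ->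
  is_derive x 1 (fun t => f t + g t) (a + b).
Proof. by move=> fa gb; exact: is_deriveD. Qed.

Lemma is_derive_sub f g x a b : is_derive x 1 f a -> is_derive x 1 g b ->
  is_derive x 1 (fun t => f t - g t) (a - b).
Proof. by move=> fa gb; exact: is_deriveB. Qed.

Lemma is_derive_mul f g x a b : is_derive x 1 f a -> is_derive x 1 g b ->
  is_derive x 1 (fun t => f t * g t) (a * g x + f x * b).
Proof.
move=> fa gb; apply: (is_derive_eq (is_deriveM fa gb)).
by rewrite addrC /GRing.scale/= mulrC.
Qed.

Lemma is_derive_inv f x a : f x != 0 -> is_derive x 1 f a ->
  is_derive x 1 (fun t => (f t)^-1) (- a / f x ^+ 2).
Proof.
move=> fx0 fa; apply: (is_derive_eq (is_deriveV fx0 fa)).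
by rewrite /GRing.scale/= mulNr mulNr mulrC.
Qed.

Lemma is_derive_div f g x a b : g x != 0 ->
  is_derive x 1 f a -> is_derive x 1 g b ->
  is_derive x 1 (fun t => f t / g t) ((a * g x - f x * b) / g x ^+ 2).
Proof.
move=> gx0 fa gb.
apply: (is_derive_eq (is_derive_mul fa (is_derive_inv gx0 gb))).
by field.
Qed.

Lemma is_derive_const c x : is_derive x 1 (fun=> c) 0.
Proof. exact: is_derive_cst. Qed.

Lemma is_derive_scale c x : is_derive x 1 (fun t => c * t) c.
Proof.
apply: (is_derive_eq (is_derive_mul (is_derive_const c x) (is_derive_id x 1))).
by rewrite mul0r mulr1 add0r.
Qed.

Lemma is_derive_cexp c x :
  is_derive x 1 (fun t => expR (c * t)) (c * expR (c * x)).
Proof.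
rewrite mulrC.
exact: (@is_derive1_comp _ expR (fun t => c * t) x _ _ (is_derive_expR _)
  (is_derive_scale c x)).
Qed.

Lemma is_derive_lnf f x a : 0 < f x -> is_derive x 1 f a ->
  is_derive x 1 (fun t => ln (f t)) (a / f x).
Proof.
move=> fx0 fa; rewrite mulrC.
exact: (@is_derive1_comp _ (@ln R) f x _ _ (is_derive1_ln fx0) fa).
Qed.

Lemma is_derive_cont f x a : is_derive x 1 f a -> {for x, continuous f}.
Proof. by move=> [+ _]; move/derivable1_diffP/differentiable_continuous. Qed.

Lemma derive_gt0_lt f (df : R -> R) (a b : R) :
  (forall x, a < x < b -> is_derive x 1 f (df x)) ->
  (forall x, a < x < b -> 0 < df x) ->
  {within `[a, b], continuous f} -> a < b -> f a < f b.
Proof.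
move=> fd df0 fc ab.
have fd' x : x \in `]a, b[ -> is_derive x 1 f (df x).
  by rewrite in_itv/=; exact: fd.
have [c] := MVT ab fd' fc.
rewrite in_itv/= => /df0 dc e; rewrite -subr_gt0 e mulr_gt0// subr_gt0//.
Qed.

Lemma derive_gt0_ltT f (df : R -> R) (a b : R) :
  (forall x, a < x < b -> 0 < df x) ->
  (forall x, is_derive x 1 f (df x)) -> a < b -> f a < f b.
Proof.
move=> df0 fd; apply: (@derive_gt0_lt _ df) => //.
by apply: continuous_subspaceT => x; exact: is_derive_cont (fd x).
Qed.

End derive_rules.

(** * The cumulant generating function of the uniform distribution *)

Section ucgf.
Context {R : realType}.
Implicit Types t x : R.

(** The logarithm of the integral of [expR (t * x)] over [[0, 1]]. Division by
    zero and the logarithm of zero being zero, the formula takes at [0] its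
    limit value [0]. *)
Definition ucgf t : R := ln ((expR t - 1) / t).

(** The mean of the uniform law tilted by [expR (t * x)]; it lies between [0]
    and [1] and increases with [t], which makes [ucgf] 1-Lipschitz and
    strictly convex. *)
Definition ducgf t : R :=
  if t == 0 then 2^-1 else expR t / (expR t - 1) - t^-1.

Lemma expRB1_eq0 t : (expR t - 1 == 0) = (t == 0).
Proof. by rewrite subr_eq0 -[X in _ == X]expR0 (inj_eq (@expR_inj R)). Qed.

Lemma expRB1_div_gt0 t : t != 0 -> 0 < (expR t - 1) / t.
Proof.
case: (ltrgt0P t) => // t0 _.
  by rewrite divr_gt0// subr_gt0 expR_gt1.
by rewrite -mulrNN -invrN divr_gt0 ?oppr_gt0// subr_lt0 expR_lt1.
Qed.

Lemma ucgf0 : ucgf 0 = 0.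
Proof. by rewrite /ucgf invr0 mulr0 ln0. Qed.

Lemma expR_ucgf t : t != 0 -> expR (ucgf t) = (expR t - 1) / t.
Proof. by move=> t0; rewrite lnK// posrE expRB1_div_gt0. Qed.

Lemma is_derive_ucgfN0 t : t != 0 -> is_derive t 1 ucgf (ducgf t).
Proof.
move=> t0; have E0 : expR t - 1 != 0 by rewrite expRB1_eq0.
have D := @is_derive_lnf _ (fun t => (expR t - 1) / t) _ _
  (expRB1_div_gt0 t0) (is_derive_div t0
  (is_derive_sub (is_derive_expR t) (is_derive_const 1 t)) (is_derive_id t 1)).
apply: (is_derive_eq D).
by rewrite /ducgf (negbTE t0); field; rewrite t0.
Qed.

Lemma expR_convexity t : 0 < t -> 0 < t * expR t - expR t + 1.
Proof.
move=> t0; have : 1 - t < expR (- t) by rewrite expR_gt1Dx// oppr_eq0 gt_eqF.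
rewrite -(ltr_pM2r (expR_gt0 t)) -expRD addNr expR0; lra.
Qed.

(** The numerator of [ducgf t - 1/2] over a positive denominator. It vanishes at
    [0], and so does its derivative, which is positive for [t > 0]. *)
Lemma ducgf_num_gt0 t : 0 < t -> 0 < t * expR t + t - 2 * expR t + 2.
Proof.
move=> t0.
pose df t : R := t * expR t - expR t + 1.
have D x : is_derive x 1 (fun t => t * expR t + t - 2 * expR t + 2) (df x).
  have E := is_derive_expR x.
  apply: (is_derive_eq (is_derive_add (is_derive_sub (is_derive_add
    (is_derive_mul (is_derive_id x 1) E) (is_derive_id x 1))
    (is_derive_mul (is_derive_const 2 x) E)) (is_derive_const 2 x))).
  by rewrite /df; ring.
have := @derive_gt0_ltT _ _ df 0 t _ D t0.
rewrite expR0 => H; have {}H := H (fun x h => expR_convexity (proj1 (andP h))).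
by apply: le_lt_trans H; lra.
Qed.

Lemma expR_gt2 t : 0 < t -> 1 + t + t ^+ 2 / 2 < expR t.
Proof.
move=> t0.
pose df t : R := expR t - (1 + t).
have D x : is_derive x 1 (fun t => expR t - (1 + t + t * t / 2)) (df x).
  apply: (is_derive_eq (is_derive_sub (is_derive_expR x) (is_derive_add
    (is_derive_add (is_derive_const 1 x) (is_derive_id x 1))
    (is_derive_mul (is_derive_mul (is_derive_id x 1) (is_derive_id x 1))
      (is_derive_const 2^-1 x))))).
  by rewrite /df; field.
have := @derive_gt0_ltT _ _ df 0 t _ D t0.
rewrite expR0 => H; have {}H : 0 < expR t - (1 + t + t * t / 2).
  apply: le_lt_trans (H _); first by lra.
  by move=> x /andP[x0 _]; rewrite /df subr_gt0 expR_gt1Dx// gt_eqF.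
by rewrite -subr_gt0 expr2.
Qed.

(** This is [t / 2 < sinh (t / 2)], multiplied by [2 * expR (t / 2)]. It gives
    the sign of the derivative of [ducgf]. *)
Lemma expR_sub_gt t : 0 < t -> t * expR (t / 2) < expR t - 1.
Proof.
move=> t0.
pose df s : R := expR s + expR (- s) - 2.
have D x : is_derive x 1 (fun t => expR t - expR (-1 * t) - 2 * t) (df x).
  apply: (is_derive_eq (is_derive_sub (is_derive_sub (is_derive_expR x)
    (is_derive_cexp (-1) x)) (is_derive_scale 2 x))).
  by rewrite /df !mulN1r; ring.
have s0 : 0 < t / 2 by rewrite divr_gt0.
have H : 0 < expR (t / 2) - expR (-1 * (t / 2)) - 2 * (t / 2).
  have := @derive_gt0_ltT _ _ df 0 (t / 2) _ D s0.
  rewrite !mulr0 expR0 subrr subr0; apply => x /andP[x0 _].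
  have := @expR_gt1Dx R x; have := @expR_gt1Dx R (- x).
  rewrite oppr_eq0 gt_eqF// /df => /(_ isT) + /(_ isT); lra.
move: H; rewrite -(pmulr_lgt0 _ (expR_gt0 (t / 2))) mulN1r !mulrBl -!expRD.
by rewrite addNr expR0 -splitr mulrC (mulrC 2) divfK ?pnatr_eq0// subr_gt0 mulrC.
Qed.

(** The uniform law is symmetric about [1/2], so that results on [t > 0] extend
    to [t < 0]. *)
Lemma ducgfN t : ducgf (- t) = 1 - ducgf t.
Proof.
rewrite /ducgf oppr_eq0; case: eqVneq => [_|t0]; first by field.
have := t0; rewrite -expRB1_eq0 => E0; rewrite expRN; field.
by rewrite t0 E0 expR_eq0/= mulN1r -oppr_eq0 opprB.
Qed.

Lemma ducgf_pos t : 0 < t -> [/\ 2^-1 < ducgf t, ducgf t < 1 & ducgf t <= 2^-1 + t].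
Proof.
move=> t0; rewrite /ducgf gt_eqF//.
have E0 : 0 < expR t - 1 by rewrite subr_gt0 expR_gt1.
have tE0 : 0 < t * (expR t - 1) by rewrite mulr_gt0.
have n0 : t != 0 by rewrite gt_eqF.
have n1 : expR t - 1 != 0 by rewrite gt_eqF.
split.
- rewrite -subr_gt0 (_ : _ - _ = (t * expR t + t - 2 * expR t + 2) / (2 * (t * (expR t - 1)))).
    by rewrite divr_gt0 ?ducgf_num_gt0// mulr_gt0.
  by field; rewrite n0 n1.
- rewrite -subr_gt0 (_ : _ - _ = (expR t - (1 + t)) / (t * (expR t - 1))).
    by rewrite divr_gt0// subr_gt0 expR_gt1Dx.
  by field; rewrite n0 n1.
- rewrite -subr_ge0 (_ : _ - _ =
    ((2 * t ^+ 2 - t + 2) * expR t - t - 2 * t ^+ 2 - 2) / (2 * (t * (expR t - 1)))).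
    apply: divr_ge0; last by rewrite mulr_ge0// ltW.
    have h := ltW (expR_gt2 t0).
    have k : 0 <= 2 * t ^+ 2 - t + 2 by nra.
    have := ler_wpM2l k h.
    have : 0 <= t ^+ 3 by rewrite exprn_ge0// ltW.
    have : 0 <= t ^+ 4 by rewrite exprn_ge0// ltW.
    rewrite !exprS !expr0; nra.
  by field; rewrite n0 n1.
Qed.

Lemma ducgf_bound t : 0 < ducgf t < 1.
Proof.
have [t0|t0|->] := ltrgt0P t.
- by have [? ? _] := ducgf_pos t0; apply/andP; split => //; lra.
- have : 0 < - t by rewrite oppr_gt0.
  move=> /ducgf_pos; rewrite ducgfN => -[? ? _]; apply/andP; split; lra.
- by rewrite /ducgf eqxx; apply/andP; split; lra.
Qed.

Lemma ducgf_lip0 t : `|ducgf t - 2^-1| <= `|t|.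
Proof.
have [t0|t0|->] := ltrgt0P t.
- by have [? ? ?] := ducgf_pos t0; rewrite ler_norml; apply/andP; split; lra.
- have : 0 < - t by rewrite oppr_gt0.
  by move=> /ducgf_pos; rewrite ducgfN => -[? ? ?]; rewrite ler_norml; apply/andP; split; lra.
- by rewrite /ducgf eqxx subrr normr0.
Qed.

Lemma ducgf_incr_pos s t : 0 < s -> s < t -> ducgf s < ducgf t.
Proof.
move=> s0 st.
pose f t : R := expR t / (expR t - 1) - t^-1.
pose df t : R := t^-1 ^+ 2 - expR t / (expR t - 1) ^+ 2.
have D x : 0 < x -> is_derive x 1 f (df x).
  move=> x0; have E0 : expR x - 1 != 0 by rewrite expRB1_eq0 gt_eqF.
  have xn0 : x != 0 by rewrite gt_eqF.
  have E := is_derive_expR x.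
  have D0 := (is_derive_sub (@is_derive_div _ expR (fun y => expR y - 1) x _ _ E0 E (is_derive_sub E
    (is_derive_const 1 x))) (is_derive_inv xn0 (is_derive_id x 1))).
  apply: (is_derive_eq D0).
  by rewrite /df/=; field; rewrite E0.
have -> : ducgf s = f s by rewrite /ducgf gt_eqF.
have -> : ducgf t = f t by rewrite /ducgf gt_eqF// (lt_trans s0).
apply: (@derive_gt0_lt _ f df) => //.
- by move=> x /andP[sx _]; apply: D; exact: lt_trans sx.
- move=> x /andP[sx _]; have x0 := lt_trans s0 sx.
  rewrite /df subr_gt0 exprVn ltr_pdivrMr; last first.
    by rewrite exprn_gt0// subr_gt0 expR_gt1.
  rewrite ltr_pdivlMl ?exprn_gt0// [X in _ * expR X]splitr expRD -expr2 -exprMn.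
  rewrite ltr_pXn2r// ?nnegrE.
  + exact: expR_sub_gt.
  + by rewrite mulr_ge0// ?expR_ge0// ltW.
  + by rewrite subr_ge0 ltW// expR_gt1.
- apply: derivable_within_continuous => x; rewrite in_itv/= => /andP[sx _].
  by have [] := D x (lt_le_trans s0 sx).
Qed.

Lemma ducgf_incr s t : s < t -> ducgf s < ducgf t.
Proof.
move=> st.
have pos x : 0 < x -> 2^-1 < ducgf x by move=> /ducgf_pos[].
have neg x : x < 0 -> ducgf x < 2^-1.
  by rewrite -oppr_gt0 => /pos; rewrite ducgfN; lra.
have z : ducgf 0 = 2^-1 by rewrite /ducgf eqxx.
have [s0|s0|s0] := ltrgt0P s.
- exact: ducgf_incr_pos.
- have [t0|t0|t0] := ltrgt0P t.
  + exact: lt_trans (neg _ s0) (pos _ t0).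
  + have : ducgf (- t) < ducgf (- s).
      by apply: ducgf_incr_pos; rewrite ?oppr_gt0// ltrN2.
    by rewrite !ducgfN; lra.
  + by rewrite t0 z; exact: neg.
- by rewrite s0 z; apply: pos; rewrite -s0.
Qed.

Lemma ucgfN t : ucgf (- t) = ucgf t - t.
Proof.
have [->|t0] := eqVneq t 0; first by rewrite oppr0 addr0.
apply: (@expR_inj R); rewrite expRB !expR_ucgf ?oppr_eq0// expRN; field.
by rewrite t0 expR_eq0.
Qed.

Lemma ucgf_pos t : 0 < t -> 0 <= ucgf t <= t.
Proof.
move=> t0; have n0 : t != 0 by rewrite gt_eqF.
apply/andP; split.
  rewrite /ucgf ln_ge0// ler_pdivlMr// mul1r.
  by have := expR_ge1Dx t; lra.
rewrite -[X in _ <= X]expRK /ucgf ler_ln ?posrE ?expR_gt0 ?expRB1_div_gt0//.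
rewrite ler_pdivrMr//.
by have := expR_convexity t0; lra.
Qed.

Lemma ucgf_lip0 t : `|ucgf t| <= `|t|.
Proof.
have [t0|t0|->] := ltrgt0P t.
- by have /andP[? ?] := ucgf_pos t0; rewrite ger0_norm.
- have : 0 < - t by rewrite oppr_gt0.
  by move=> /ucgf_pos; rewrite ucgfN ler_norml => /andP[? ?]; apply/andP; split; lra.
- by rewrite ucgf0 normr0.
Qed.

Lemma lip0_cvg (f : R -> R) (l : R) :
  (forall t, `|f t - l| <= `|t|) -> f t @[t --> (0:R)] --> l.
Proof.
move=> H; apply/cvgrPdist_lt => e e0; near=> t.
rewrite distrC (le_lt_trans (H t))//.
Unshelve. all: end_near. Qed.

(** At [0] the difference quotient is [ucgf x / x], and l'Hopital's rule reduces
    its limit to that of [ducgf] at [0]. *)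
Lemma is_derive_ucgf t : is_derive t 1 ucgf (ducgf t).
Proof.
have [->|] := eqVneq t 0; last exact: is_derive_ucgfN0.
have c1 : (0:R) \in `](-1), 1[ by rewrite in_itv/= ltrN10 ltr01.
have H : ucgf x / x @[x --> (0:R)^'] --> (2^-1 : R).
  apply: (@lhopital _ ucgf ducgf id (fun=> 1) _ _ _ _ c1).
  - move=> x; rewrite inE => -[_ /eqP x0]; exact: is_derive_ucgfN0.
  - by apply: lip0_cvg => t'; rewrite subr0 ucgf_lip0.
  - exact: cvg_id.
  - by move=> x _; exact: oner_neq0.
  - by under eq_fun do rewrite divr1; apply: lip0_cvg => t'; exact: ducgf_lip0.
have {}H : h^-1 *: ((ucgf \o shift 0) (h *: 1) - ucgf 0) @[h --> (0:R)^'] --> (2^-1 : R).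
  apply: cvg_trans H; apply: near_eq_cvg; near=> h => /=.
  by rewrite ucgf0 subr0 addr0 /GRing.scale/= mulr1 mulrC.
rewrite /ducgf eqxx; apply: DeriveDef; first by apply/cvg_ex; exists 2^-1.
exact/cvg_lim.
Unshelve. all: end_near. Qed.

Lemma ucgf_lip s t : `|ucgf t - ucgf s| <= `|t - s|.
Proof.
wlog st : s t / s < t.
  move=> H; have [st|ts|->] := ltgtP s t; last by rewrite subrr normr0.
    exact: H st.
  by rewrite distrC (distrC t); exact: H ts.
have fd x : x \in `]s, t[ -> is_derive x 1 ucgf (ducgf x).
  by move=> _; exact: is_derive_ucgf.
have [|c _ ->] := MVT st fd.
  by apply: continuous_subspaceT => x; exact: is_derive_cont (is_derive_ucgf x).
rewrite normrM ler_piMl//; have /andP[c0 c1] := ducgf_bound c.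
by rewrite ler_norml; apply/andP; split; lra.
Qed.

Lemma continuous_ucgf : continuous ucgf.
Proof. by move=> x; exact: is_derive_cont (is_derive_ucgf x). Qed.

End ucgf.

(** * Riemann sums of Lipschitz functions *)

Section riemann_sum.
Context {R : realType}.
Notation lam := (@lebesgue_measure R).

Lemma lipschitz_continuous (f : R -> R) (K : R) :
  (forall x y, `|f y - f x| <= K * `|y - x|) -> continuous f.
Proof.
move=> H x; apply/cvgrPdist_lt => e e0.
have K0 : 0 <= K.
  have := H 0 1; rewrite subr0 normr1 mulr1; exact: le_trans.
have d0 : 0 < e / (K + 1) by rewrite divr_gt0// ltr_wpDl.
near=> t; rewrite (le_lt_trans (H t x))//.
have h : `|x - t| < e / (K + 1) by near: t; exact: cvgr_dist_lt.
have K1 : 0 < K + 1 by rewrite ltr_wpDl.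
rewrite ltr_pdivlMr// mulrC mulrDl mul1r in h.
by have := normr_ge0 (x - t); lra.
Unshelve. all: end_near. Qed.

Lemma continuous_itv_integrable (f : R -> R) (a b : R) : continuous f ->
  lam.-integrable `[a, b] (EFin \o f).
Proof.
move=> cf; apply: continuous_compact_integrable; first exact: segment_compact.
exact: continuous_subspaceT.
Qed.

(** The interval exceeds [[0, 1]] on both sides in order that the primitive be
    differentiable at the end points too. *)
Lemma primitive_ex (f : R -> R) : continuous f ->
  exists F : R -> R, forall x : R, -1 < x < 2 -> is_derive x 1 F (f x).
Proof.
move=> cf; exists (fun x => \int[lam]_(t in `[(-1), x]) f t) => x /andP[x1 x2].
have [D E] := continuous_FTC1_closed x2 (continuous_itv_integrable (-1) 2 cf) x1 (cf x).
by split; [exact: D|rewrite -derive1E].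
Qed.

(** The integral over each of the [n+1] pieces is the value of [f] at some point
    of the piece divided by [n+1], by the mean value theorem for a primitive;
    this point is within [1 / (n+1)] of the right end of the piece. *)
Lemma riemann_sum_lipschitz (f : R -> R) (K : R) (n : nat) :
  (forall x y, `|f y - f x| <= K * `|y - x|) ->
  `|\int[lam]_(x in `[0, 1]) f x
    - n.+1%:R^-1 * \sum_(i < n.+1) f (i.+1%:R / n.+1%:R)| <= K / n.+1%:R.
Proof.
move=> H; have cf := lipschitz_continuous H.
have [F dF] := primitive_ex cf.
have -> : \int[lam]_(x in `[0, 1]) f x = F 1 - F 0.
  rewrite /Rintegral (@continuous_FTC2 _ f F 0 1)//.
  - exact: continuous_subspaceT.
  - split.
    + by move=> x; rewrite in_itv/= => /andP[? ?]; have [] // := dF x; apply/andP; split; lra.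
    + by apply: cvg_at_right_filter; apply: (is_derive_cont (dF 0 _)); apply/andP; split; lra.
    + by apply: cvg_at_left_filter; apply: (is_derive_cont (dF 1 _)); apply/andP; split; lra.
  - move=> x; rewrite in_itv/= => /andP[? ?].
    by rewrite derive1E; apply: derive_val; apply: dF; apply/andP; split; lra.
set N : R := n.+1%:R; have N0 : 0 < N by rewrite ltr0n.
have -> : F 1 - F 0 = \sum_(i < n.+1) (F (i.+1%:R / N) - F (i%:R / N)).
  rewrite -(big_mkord xpredT (fun i => F (i.+1%:R / N) - F (i%:R / N))).
  by rewrite (telescope_sumr (fun i => F (i%:R / N)))// divff ?gt_eqF// mul0r.
rewrite mulr_sumr -sumrB; apply: (le_trans (ler_norm_sum _ _ _)).
have -> : K / N = \sum_(i < n.+1) (K / N / N).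
  by rewrite sumr_const card_ord -mulr_natr -/N divfK// gt_eqF.
apply: ler_sum => i _.
have i01 : i%:R / N < i.+1%:R / N by rewrite ltr_pM2r ?invr_gt0// ltr_nat.
have r0 : 0 <= i%:R / N by rewrite divr_ge0// ltW.
have r1 : i.+1%:R / N <= 1 by rewrite ler_pdivrMr// mul1r ler_nat.
have dF' x : i%:R / N <= x <= i.+1%:R / N -> is_derive x 1 F (f x).
  move=> /andP[x0 x1]; apply: dF; apply/andP; split.
    by apply: lt_le_trans x0; apply: lt_le_trans r0; rewrite ltrN10.
  by apply: le_lt_trans x1 _; apply: le_lt_trans r1 _; rewrite ltr1n.
have fd x : x \in `](i%:R / N), (i.+1%:R / N)[ -> is_derive x 1 F (f x).
  by rewrite in_itv/= => /andP[? ?]; apply: dF'; apply/andP; split; exact: ltW.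
have [|c] := MVT i01 fd.
  by apply: derivable_within_continuous => x; rewrite in_itv/= => /dF'[].
rewrite in_itv/= => /andP[c0 c1] ->.
have -> : i.+1%:R / N - i%:R / N = N^-1 by rewrite -mulrBl -natrB// subSnn mul1r.
rewrite mulrC -mulrBr normrM ger0_norm ?invr_ge0 ?(ltW N0)// mulrC.
rewrite ler_pM2r ?invr_gt0//; apply: (le_trans (H _ _)).
have K0 : 0 <= K.
  have := H 0 1; rewrite subr0 normr1 mulr1; exact: le_trans.
apply: ler_wpM2l => //.
have : i.+1%:R / N - i%:R / N = N^-1 by rewrite -mulrBl -natrB// subSnn mul1r.
by move=> e; rewrite distrC ger0_norm ?subr_ge0 ?(ltW c1)// -[leRHS]e lerD2l lerN2 ltW.
Qed.

End riemann_sum.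

(** * The limiting free energy *)

Section rate.
Context {R : realType}.
Notation lam := (@lebesgue_measure R).
Implicit Types theta : R.

(** The closed form of the limit [C]. No exception is needed for [theta = 0]
    because [ucgf 0 = 0]. *)
Definition mrate theta : R := \int[lam]_(x in `[0, 1]) ucgf (theta * x).

Lemma ucgf_scale_lip theta (x y : R) :
  `|ucgf (theta * y) - ucgf (theta * x)| <= `|theta| * `|y - x|.
Proof. by apply: (le_trans (ucgf_lip _ _)); rewrite -mulrBr normrM. Qed.

Lemma continuous_ucgf_scale theta : continuous (fun x : R => ucgf (theta * x)).
Proof. exact: lipschitz_continuous (ucgf_scale_lip theta). Qed.

Lemma integrable_ucgf_scale theta a b :
  lam.-integrable `[a, b] (EFin \o (fun x : R => ucgf (theta * x))).
Proof. by apply: continuous_itv_integrable; exact: continuous_ucgf_scale. Qed.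

Lemma C_formulaE theta : C_formula theta = (mrate theta)%:E.
Proof.
rewrite /C_formula /mrate /Rintegral fineK//.
apply: integrable_fin_num => //; exact: integrable_ucgf_scale.
Qed.

Lemma cvg_riemann_ucgf theta :
  n.+1%:R^-1 * (\sum_(i < n.+1) ucgf (theta * (i.+1%:R / n.+1%:R)))
    @[n --> \oo] --> mrate theta.
Proof.
apply/cvgrPdist_le => e e0; near=> n.
apply: (le_trans (riemann_sum_lipschitz n (ucgf_scale_lip theta))).
rewrite ler_pdivrMr ?ltr0n// -ler_pdivrMl//.
near: n; apply: filterS (nbhs_infty_ger (e^-1 * `|theta|)) => n h.
by rewrite (le_trans h)// ler_nat.
Unshelve. all: end_near. Qed.

Lemma lebesgue01 : lam `[0, 1] = 1%E.
Proof. by rewrite lebesgue_measure_itv/= lte_fin ltr01 sube0. Qed.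

Lemma integrable_cst01 (c : R) : lam.-integrable `[0, 1] (EFin \o cst c).
Proof. by apply: continuous_itv_integrable => x; exact: cvg_cst. Qed.

Lemma is_derive_ucgf_scale (x t : R) :
  is_derive t 1 (fun th => ucgf (th * x)) (x * ducgf (t * x)).
Proof.
have D : is_derive t 1 (fun th => th * x) x.
  by under eq_fun do rewrite mulrC; exact: is_derive_scale.
have := @is_derive1_comp _ (@ucgf R) (fun th => th * x) t _ _ (is_derive_ucgf _) D.
by rewrite mulrC.
Qed.

Lemma norm_dscale (x t : R) : x \in `[0, 1] -> `|x * ducgf (t * x)| <= 1.
Proof.
rewrite in_itv/= => /andP[x0 x1]; have /andP[? ?] := ducgf_bound (t * x).
by rewrite ger0_norm; nra.
Qed.

(** Differentiation under the integral sign, dominated by the constant [1]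
    because [ducgf] takes its values in [[0, 1]]. *)
Lemma derive1_mrate t : derivable mrate t 1 /\
  derive1 mrate t = \int[lam]_(x in `[0, 1]) (x * ducgf (t * x)).
Proof.
have It : (`]t - 1, t + 1[)%classic t by rewrite /= in_itv/=; apply/andP; split; lra.
pose f (th x : R) := ucgf (th * x).
have mB : measurable (`[0%R, 1%R] : set (measurableTypeR R)) by [].
have H1 (th : R) : `]t - 1, t + 1[%classic th -> lam.-integrable `[0, 1] (EFin \o f th).
  by move=> _; exact: integrable_ucgf_scale.
have H2 (th x : R) : `]t - 1, t + 1[%classic th -> `[0, 1]%classic x -> derivable (f ^~ x) th 1.
  by move=> _ _; have [] := is_derive_ucgf_scale x th.
have H3 (th x : R) : `]t - 1, t + 1[%classic th -> `[0, 1]%classic x ->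
    `|partial1of2 f th x| <= cst 1 x.
  move=> _ x01; rewrite partial1of2E.
  by have [_ ->] := is_derive_ucgf_scale x th; exact: norm_dscale.
have G0 (y : R) : 0 <= cst 1 y :> R by [].
have := @derivable_under_integral _ _ _ lam f _ mB t _ _ It H1 H2 _ G0 (integrable_cst01 1) H3.
have := @differentiation_under_integral _ _ _ lam f _ mB t _ _ It H1 H2 _ G0 (integrable_cst01 1) H3.
move=> E D; split => //; rewrite E; apply: eq_Rintegral => x _.
by rewrite partial1of2E; have [_ ->] := is_derive_ucgf_scale x t.
Qed.

Lemma derivable_mrate t : derivable mrate t 1.
Proof. by have [] := derive1_mrate t. Qed.

Lemma integrable_dscale t : lam.-integrable `[0, 1] (EFin \o (fun x => x * ducgf (t * x))).
Proof.
apply: (@le_integrable _ _ _ lam _ _ _ (EFin \o cst 1)) => //.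
- apply/measurable_EFinP; apply: measurable_funM => //.
  apply: (measurableT_comp (f := ducgf)) => //.
    by apply: nondecreasing_measurable => // x y; rewrite le_eqVlt => /predU1P[->//|/ducgf_incr/ltW].
- move=> x x01; rewrite /= lee_fin normr1; exact: norm_dscale.
- exact: integrable_cst01.
Qed.

Lemma Rintegral_gt0 d (T : measurableType d) (mu : {measure set T -> \bar R})
    (D : set T) (f : T -> R) : measurable D -> (0 < mu D)%E ->
  mu.-integrable D (EFin \o f) -> (forall x, D x -> 0 < f x) ->
  0 < \int[mu]_(x in D) f x.
Proof.
move=> mD muD intf f0; rewrite lt_neqAle Rintegral_ge0 ?andbT; last first.
  by move=> x /f0/ltW.
rewrite eq_sym; apply/eqP => I0.
have mf := measurable_int _ intf.
have : (\int[mu]_(x in D) `|(EFin \o f) x| = 0)%E.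
  have -> : (\int[mu]_(x in D) `|(EFin \o f) x| = \int[mu]_(x in D) (EFin \o f) x)%E.
    by apply: eq_integral => x /set_mem /f0 fx /=; rewrite ger0_norm// ltW.
  rewrite -[LHS]fineK; last exact: integrable_fin_num.
  by move: I0; rewrite /Rintegral => ->.
move/(ae_eq_integral_abs mu mD mf) => -[N [mN N0 DN]].
have DsubN : D `<=` N.
  by move=> x Dx; apply: DN => /= /(_ Dx)/eqP; rewrite eqe gt_eqF// f0.
by move: muD; rewrite (subset_measure0 mD mN DsubN N0) ltxx.
Qed.

(** Strictness comes from the strict monotonicity of [ducgf], at every [x] in
    the half-open interval. *)
Lemma derive1_mrate_incr (s t : R) : s < t -> derive1 mrate s < derive1 mrate t.
Proof.
move=> st; have [_ ->] := derive1_mrate s; have [_ ->] := derive1_mrate t.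
have I x : lam.-integrable `]0, 1] (EFin \o (fun y : R => y * ducgf (x * y))).
  by apply: (integrableS _ _ _ (integrable_dscale x)) => //; exact: subset_itv_oc_cc.
(* the integrands agree at 0, which is removed to get a strict inequality everywhere *)
rewrite -subr_gt0 -!(@Rintegral_itv_obnd_cbnd _ 0)//; try exact: I.
rewrite -RintegralB//; try exact: I.
apply: Rintegral_gt0 => //.
- by rewrite /= lebesgue_measure_itv/= lte_fin ltr01 sube0 lte01.
- have := integrableB _ (I t) (I s); apply => //.
- move=> x /=; rewrite in_itv/= => /andP[x0 _].
  by rewrite -mulrBr mulr_gt0// subr_gt0 ducgf_incr// ltr_pM2r.
Qed.

Lemma continuous_mrate : continuous mrate.
Proof. by move=> x; apply: differentiable_continuous; apply/derivable1_diffP; exact: derivable_mrate. Qed.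

Lemma mrate0 : mrate 0 = 0.
Proof.
rewrite /mrate; under eq_Rintegral do rewrite mul0r ucgf0.
by rewrite Rintegral_cst// mul0r.
Qed.

Lemma ext0_C_formula theta : ext0 C_formula theta = (mrate theta)%:E.
Proof.
rewrite /ext0; case: eqVneq => [->|_]; last exact: C_formulaE.
apply/cvg_lim => //; rewrite (_ : C_formula = EFin \o mrate); last first.
  by apply/funext => t; rewrite C_formulaE.
apply: cvg_EFin; first exact: nearW.
by apply: cvg_within_filter; exact: continuous_mrate.
Qed.

End rate.

(** * The generating function of the number of inversions *)

Section inversions.

(** The permutation [lift_perm ord0 i s] sends the first index to [i] and is
    order isomorphic to [s] on the others, so that its first entry forms an
    inversion with each of the [i] smaller values, and the other inversions
    are those of [s]. *)
Lemma Inv_lift_perm n (i : 'I_n.+1) (s : 'S_n) :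
  Defs.Inv (lift_perm ord0 i s) = (i + Defs.Inv s)%N.
Proof.
rewrite /Defs.Inv big_ord_recl; congr addn.
  rewrite big_mkcond big_ord_recl /= add0n.
  under eq_bigr do rewrite lift_perm_lift lift_perm_id /=.
  rewrite (reindex_inj (@perm_inj _ (s^-1)%g)) /=.
  under eq_bigr do rewrite permKV /bump.
  have E (k : 'I_n) : ((i <= k) + k < i)%N = (k < i)%N.
    by case: (leqP i k) => ik /=; lia.
  under eq_bigr do rewrite E.
  rewrite -(big_mkord xpredT (fun k => (k < i)%N : nat)).
  have ilen : (i <= n)%N by rewrite -ltnS.
  rewrite (big_cat_nat (leq0n i) ilen)//= [X in (_ + X)%N]big1_seq ?addn0; last first.
    by move=> k /=; rewrite mem_index_iota => /andP[ik _]; rewrite ltnNge ik.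
  rewrite big_nat_cond (eq_bigr (fun=> 1%N)); last by move=> k /andP[/andP[_ ->]].
  by rewrite -big_nat_cond sum_nat_const_nat subn0 muln1.
apply: eq_bigr => a _.
rewrite big_mkcond big_ord_recl /= add0n [RHS]big_mkcond /=.
apply: eq_bigr => b _; rewrite !lift_perm_lift /= [bump 0 a]/bump [bump 0 b]/bump !add1n ltnS.
by case: ifP => // _; rewrite /bump; do 2 case: leqP => /=; lia.
Qed.

Lemma Inv_perm1 n : Defs.Inv (1%g : 'S_n) = 0%N.
Proof.
rewrite /Defs.Inv big1// => i _; rewrite big1// => j ij; rewrite !perm1.
by rewrite ltnNge ltnW.
Qed.

Lemma Inv_tperm01 n : (0 < Defs.Inv (tperm (ord0 : 'I_n.+2) (lift ord0 ord0)))%N.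
Proof.
rewrite /Defs.Inv (bigD1 ord0)//= (bigD1 (lift ord0 ord0))//=.
by rewrite tpermL tpermR.
Qed.

Lemma sum_Sn_recl (V : nmodType) n (F : 'S_n.+1 -> V) :
  \sum_s F s = \sum_(i < n.+1) \sum_(s : 'S_n) F (lift_perm ord0 i s).
Proof.
rewrite pair_big /=.
pose h (p : 'I_n.+1 * 'S_n) := lift_perm ord0 p.1 p.2.
have hinj : injective h.
  move=> [i s] [j t] /= e.
  have ij : i = j by have := congr1 (fun u : 'S_n.+1 => u ord0) e; rewrite !lift_perm_id.
  rewrite /h/= -ij in e; congr pair; first exact: ij.
  apply/permP => k.
  by have := congr1 (fun u : 'S_n.+1 => u (lift ord0 k)) e; rewrite !lift_perm_lift => /lift_inj.
rewrite (reindex h) //; apply: onW_bij; apply: inj_card_bij => //.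
by rewrite card_prod card_ord !card_Sn factS.
Qed.

(** A permutation is given by its first value and the pattern of the remaining
    ones; by [Inv_lift_perm] the two contribute additively. *)
Lemma sum_Inv_prod (R : comNzRingType) (q : R) n :
  \sum_(s : 'S_n) q ^+ Defs.Inv s = \prod_(i < n) \sum_(k < i.+1) q ^+ k.
Proof.
elim: n => [|n IH].
  rewrite big_ord0 (big_pred1 (1%g : 'S_0)) ?Inv_perm1// => s.
  by apply/esym/eqP/permP => -[].
rewrite sum_Sn_recl [RHS]big_ord_recr /= -IH mulr_sumr; apply: eq_bigr => i _.
rewrite mulr_suml; apply: eq_bigr => s _.
by rewrite Inv_lift_perm addnC exprD.
Qed.

End inversions.

(** * The log normalizing constant as a Riemann sum *)

Section log_normalizing_constant.
Context {R : realType}.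
Implicit Types theta t : R.

(** The geometric sum is [(q ^ (m+1) - 1) / (q - 1)], a ratio of two values of
    [(expR t - 1) / t] up to the factor [m+1]. *)
Lemma geometric_ucgf t m :
  \sum_(k < m.+1) expR t ^+ k = m.+1%:R * expR (ucgf (t * m.+1%:R) - ucgf t).
Proof.
have [->|t0] := eqVneq t 0.
  rewrite mul0r subrr expR0 mulr1; under eq_bigr do rewrite expr1n.
  by rewrite sumr_const card_ord.
have m0 : m.+1%:R != 0 :> R by rewrite pnatr_eq0.
have E0 : expR t - 1 != 0 by rewrite expRB1_eq0.
rewrite expRB !expR_ucgf ?mulf_neq0//.
apply: (mulfI E0); rewrite -subrX1 expRM_natr; field.
by rewrite t0 E0 addrC natr1 m0.
Qed.

(** The first sum is [ln n`!], which cancels in [Cn n theta - Cn n 0]; the second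
    one is [n] times a Riemann sum of [ucgf (theta * x)], up to [n] times
    [ucgf (theta / n)], which stays bounded. *)
Lemma CnE n theta : Cn n theta =
  \sum_(i < n) ln (i.+1%:R : R)
  + \sum_(i < n) (ucgf (theta * (i.+1%:R / n%:R)) - ucgf (theta / n%:R)).
Proof.
rewrite /Cn.
have -> : \sum_(s : 'S_n) expR (theta / n%:R * (Defs.Inv s)%:R) =
    \prod_(i < n) \sum_(k < i.+1) expR (theta / n%:R) ^+ k.
  by rewrite -sum_Inv_prod; apply: eq_bigr => s _; rewrite expRM_natr.
rewrite -big_split /=.
under eq_bigr do rewrite geometric_ucgf.
apply: (@expR_inj R); rewrite lnK; last first.
  by rewrite posrE; apply: prodr_gt0 => i _; rewrite mulr_gt0 ?expR_gt0 ?ltr0n.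
rewrite expR_sum; apply: eq_bigr => i _.
have -> : theta / n%:R * i.+1%:R = theta * (i.+1%:R / n%:R) by rewrite mulrAC mulrA.
by rewrite [RHS]expRD lnK ?posrE ?ltr0n.
Qed.

Lemma cvg_Cn theta : (Cn n theta - Cn n 0) / n%:R @[n --> \oo] --> mrate theta.
Proof.
rewrite -cvg_shiftS.
have H : n.+1%:R^-1 * (\sum_(i < n.+1) ucgf (theta * (i.+1%:R / n.+1%:R)))
    - ucgf (theta / n.+1%:R) @[n --> \oo] --> mrate theta - ucgf (theta * 0).
  apply: cvgB; first exact: cvg_riemann_ucgf.
  apply: (cvg_comp (fun n => (n.+1%:R : R)^-1) (fun x => ucgf (theta * x))).
    exact: cvg_harmonic.
  exact: continuous_ucgf_scale.
move: H; rewrite mulr0 ucgf0 subr0; apply: cvg_trans; apply: near_eq_cvg.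
near=> n; rewrite /= !CnE opprD addrACA subrr add0r.
rewrite [X in (_ - X) / _]big1 ?subr0; last by move=> i _; rewrite !mul0r subrr.
rewrite sumrB sumr_const card_ord mulrBl [X in X - _ = _]mulrC.
by rewrite -[ucgf _ *+ n.+1]mulr_natr mulfK// pnatr_eq0.
Unshelve. all: end_near. Qed.

End log_normalizing_constant.

(** * Exponential families on a finite set *)

Section log_sum_exp.
Context {R : realType} (T : finType) (w : T -> R).
Implicit Types t : R.

(** The log partition function of the exponential family with sufficient
    statistic [w]; [dlse] is the mean of [w] under the tilted law. *)
Definition lse t : R := ln (\sum_s expR (t * w s)).
Definition dlse t : R := (\sum_s w s * expR (t * w s)) / \sum_s expR (t * w s).

Lemma is_derive_bigsum (I : Type) (r : seq I) (f : I -> R -> R) (df : I -> R) (x : R) :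
  (forall s, is_derive x 1 (f s) (df s)) ->
  is_derive x 1 (fun t => \sum_(s <- r) f s t) (\sum_(s <- r) df s).
Proof.
move=> H; elim: r => [|s r IH].
  rewrite big_nil (_ : (fun t => _) = fun=> 0); first exact: is_derive_const.
  by apply/funext => t; rewrite big_nil.
rewrite big_cons (_ : (fun t => _) = fun t => f s t + \sum_(s <- r) f s t).
  exact: is_derive_add.
by apply/funext => t; rewrite big_cons.
Qed.

Hypothesis T0 : (0 < #|T|)%N.

Lemma sum_expR_gt0 t : 0 < \sum_s expR (t * w s).
Proof.
have /card_gt0P[s0 _] := T0.
rewrite (bigD1 s0)//= ltr_pwDl ?expR_gt0// sumr_ge0// => s _; exact: expR_ge0.
Qed.

Lemma is_derive_lse t : is_derive t 1 lse (dlse t).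
Proof.
apply: (@is_derive_lnf _ (fun t => \sum_s expR (t * w s))); first exact: sum_expR_gt0.
apply: is_derive_bigsum => s.
rewrite (_ : (fun t => _) = fun t => expR (w s * t)); last first.
  by apply/funext => x; rewrite mulrC.
by rewrite [t * _]mulrC; exact: is_derive_cexp.
Qed.

(** After clearing denominators the difference of the two sides is a sum over
    pairs, which symmetrises to a sum of terms
    [(w y - w x) * (A x * B y - A y * B x)] with the weights
    [A s = expR (a * w s)] and [B s = expR (b * w s)]. Each is nonnegative
    since [B / A] is increasing in [w], and positive where [w] differs. *)
Lemma dlse_incr (s0 t0 : T) a b : w s0 != w t0 -> a < b -> dlse a < dlse b.
Proof.
move=> w0 ab; rewrite /dlse ltr_pdivrMr ?sum_expR_gt0// mulrAC ltr_pdivlMr ?sum_expR_gt0//.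
pose A s := expR (a * w s); pose B s := expR (b * w s).
pose D := \sum_(p : T * T) (w p.2 - w p.1) * (A p.1 * B p.2).
have DE : D = (\sum_s w s * B s) * (\sum_s A s) - (\sum_s w s * A s) * (\sum_s B s).
  rewrite /D (eq_bigr (fun p => w p.2 * B p.2 * A p.1 - w p.1 * A p.1 * B p.2)).
    rewrite sumrB -(pair_bigA _ (fun s t : T => w t * B t * A s)).
    rewrite -(pair_bigA _ (fun s t : T => w s * A s * B t))/=; congr (_ - _).
      rewrite exchange_big mulr_suml; apply: eq_bigr => t _; by rewrite mulr_sumr.
    by rewrite mulr_suml; apply: eq_bigr => t _; rewrite mulr_sumr.
  by move=> p _; ring.
rewrite -subr_gt0 -DE.
have D2 : D + D = \sum_(p : T * T) (w p.2 - w p.1) * (A p.1 * B p.2 - A p.2 * B p.1).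
  have -> : D + D = D + \sum_(p : T * T) (w p.1 - w p.2) * (A p.2 * B p.1).
    congr (_ + _); rewrite /D (reindex (fun p : T * T => (p.2, p.1)))//=.
    by apply: onW_bij; exists (fun p => (p.2, p.1)) => -[].
  by rewrite -big_split; apply: eq_bigr => p _ /=; ring.
have term x y : w x < w y -> 0 < (w y - w x) * (A x * B y - A y * B x).
  move=> xy; rewrite mulr_gt0 ?subr_gt0// /A /B -!expRD ltr_expR; nra.
have ge0 p : 0 <= (w p.2 - w p.1) * (A p.1 * B p.2 - A p.2 * B p.1).
  have [/term/ltW //|/term/ltW|->] := ltgtP (w p.1) (w p.2); last by rewrite subrr mul0r.
  by rewrite -mulrNN !opprB.
have : 0 < D + D.
  rewrite D2 (bigD1 (s0, t0))//= ltr_pwDl//; last by rewrite sumr_ge0.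
  have [/term //|/term|e] := ltgtP (w s0) (w t0); last by rewrite e eqxx in w0.
  by rewrite -mulrNN !opprB.
lra.
Qed.

End log_sum_exp.

(** * Stationary points of strictly convex functions *)

Section convexity.
Context {R : realType}.
Implicit Types (f df : R -> R) (a b c d r t x : R).

Lemma derive_secant f df a b : (forall t, is_derive t 1 f (df t)) -> a < b ->
  exists2 c, a < c < b & f b - f a = df c * (b - a).
Proof.
move=> H ab; have [c cab E] := @MVT _ f df a b ab (fun x _ => H x)
  (continuous_subspaceT (fun x => is_derive_cont (H x))).
by exists c.
Qed.

(** Provides the descent directions which exclude a minimum at an end point, and
    the small parameters of the exponential Markov inequality. *)
Lemma derive_lt_right f c d r e : is_derive c 1 f d -> d < r -> 0 < e ->
  exists2 h, 0 < h < e & f (c + h) - f c < r * h.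
Proof.
move=> [/cvg_ex[/= l fl] dE] dr e0.
have ld : l = d.
  by rewrite -dE; apply/esym; exact: (cvg_lim _ fl).
rewrite ld in fl.
have {}fl := cvg_dnbhs_at_right fl.
have : \forall h \near (0:R)^'+, h^-1 *: (f (h *: 1 + c) - f c) < r by exact: (cvgr_lt _ fl).
move=> H; near (0:R)^'+ => h.
exists h; first by apply/andP; split; near: h; [exact: nbhs_right_gt|exact: nbhs_right_lt].
have h0 : 0 < h by near: h; exact: nbhs_right_gt.
have : h^-1 *: (f (h *: 1 + c) - f c) < r by near: h.
by rewrite /GRing.scale/= mulr1 ltr_pdivrMl// (addrC h) (mulrC h).
Unshelve. all: end_near. Qed.

Lemma derive_gt_left f c d r e : is_derive c 1 f d -> r < d -> 0 < e ->
  exists2 h, 0 < h < e & f (c - h) - f c < - (r * h).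
Proof.
move=> fd rd e0.
have D : is_derive (- c) 1 (fun x => f (- x)) (d * -1).
  have Dn : is_derive (- c) 1 (fun x : R => - x) (-1).
    rewrite (_ : (fun x : R => - x) = fun x => -1 * x); first exact: is_derive_scale.
    by apply/funext => x; rewrite mulN1r.
  by apply: (@is_derive1_comp _ f (fun x => - x) (- c) d (-1) _ Dn); rewrite opprK.
have [|h he] := @derive_lt_right _ _ _ (- r) e D _ e0; first by lra.
by rewrite opprK opprD opprK mulNr => ?; exists h.
Qed.

(** Intermediate value property of a derivative: [f x - a * x] attains its
    minimum over the interval in the interior, since it decreases at the left
    end and increases at the right end. *)
Lemma unique_root_derive f df a e t :
  (forall t, is_derive t 1 f (df t)) ->
  (forall s t, s < t -> df s < df t) ->
  0 < e -> df (t - e) < a -> a < df (t + e) ->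
  exists2 c, `|c - t| <= e & df c = a /\ forall c', df c' = a -> c' = c.
Proof.
move=> fd mono e0 lo hi.
pose g x : R := f x - a * x.
have gd x : is_derive x 1 g (df x - a).
  exact: is_derive_sub (fd x) (is_derive_scale a x).
have lh : t - e < t + e by lra.
have [c cin cmin] := @EVT_min _ g _ _ (ltW lh)
  (continuous_subspaceT (fun x => is_derive_cont (gd x))).
have uniq c' : df c' = a -> df c = a -> c' = c.
  move=> e1 e2; have [/mono|/mono|//] := ltgtP c' c; lra.
move: cin; rewrite in_itv/= => /andP[cl ch].
suff dc : df c = a.
  exists c; first by rewrite ler_norml; apply/andP; split; lra.
  by split => // c' /uniq; exact.
(* a minimum at an end point is excluded by the sign of the derivative there *)
move: cl; rewrite le_eqVlt => /predU1P[cE|cl].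
  have d0 : df c - a < 0 by rewrite -cE; lra.
  have [h /andP[h0 h1]] := derive_lt_right (gd c) d0 (mulr_gt0 (ltr0n R 2) e0).
  have : g c <= g (c + h) by apply: cmin; rewrite in_itv/=; apply/andP; split; lra.
  by rewrite mul0r; lra.
move: ch; rewrite le_eqVlt => /predU1P[cE|ch].
  have d0 : 0 < df c - a by rewrite cE; lra.
  have [h /andP[h0 h1]] := derive_gt_left (gd c) d0 (mulr_gt0 (ltr0n R 2) e0).
  have : g c <= g (c - h) by apply: cmin; rewrite in_itv/=; apply/andP; split; lra.
  by rewrite mul0r oppr0; lra.
have cin : c \in `](t - e), (t + e)[ by rewrite in_itv/= cl ch.
have [_ E] := @derive1_at_min _ g _ _ c (ltW lh) (fun x _ => @ex_derive _ _ _ _ _ _ _ (gd x)) cin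
  (fun x xin => cmin x (subset_itv_oo_cc xin)).
by have [_ E'] := gd c; move: E'; rewrite E; lra.
Qed.

End convexity.

(** * Concentration of the inversion density and consistency *)

Section mallows_probability.
Context {R : realType}.
Implicit Types (theta t a : R).

(** [Cn n] is the log partition function of the exponential family with this
    sufficient statistic. *)
Definition normInv n (s : 'S_n) : R := (Defs.Inv s)%:R / n%:R.

Lemma Cn_lse n : @Cn R n = lse (@normInv n).
Proof.
apply/funext => t; rewrite /Cn /lse; congr ln; apply: eq_bigr => s _.
by rewrite /normInv mulrAC mulrA.
Qed.

Lemma card_Sn_gt0 n : (0 < #|{: 'S_n}|)%N.
Proof. by apply/card_gt0P; exists 1%g. Qed.

Definition dCn n := dlse (@normInv n).

Lemma is_derive_Cn n t : is_derive t 1 (@Cn R n) (dCn n t).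
Proof. by rewrite Cn_lse; apply: is_derive_lse; exact: card_Sn_gt0. Qed.

Lemma derive1_Cn n t : derive1 (@Cn R n) t = dCn n t.
Proof. by rewrite derive1E; apply: derive_val; exact: is_derive_Cn. Qed.

(** The bound [2 <= n] ensures that the number of inversions is not constant:
    the identity has none and a transposition of the first two points has one. *)
Lemma dCn_incr n a b : a < b -> dCn n.+2 a < dCn n.+2 b.
Proof.
apply: (@dlse_incr _ _ _ (card_Sn_gt0 _) (tperm ord0 (lift ord0 ord0)) 1%g).
rewrite /normInv Inv_perm1 mul0r mulf_neq0// ?invr_eq0 ?pnatr_eq0//.
by rewrite -lt0n Inv_tperm01.
Qed.

Lemma mallows_ge0 n theta (s : 'S_n) : 0 <= mallows theta s.
Proof. exact: expR_ge0. Qed.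

Lemma sum_mallows n theta : \sum_(s : 'S_n) mallows theta s = 1.
Proof.
rewrite /mallows; under eq_bigr do rewrite expRB.
rewrite -mulr_suml /Cn lnK ?divff//.
  rewrite gt_eqF//.
  have := sum_expR_gt0 (@normInv n) (card_Sn_gt0 n) theta.
  by congr (_ < _); apply: eq_bigr => s _; rewrite /normInv mulrA mulrAC.
rewrite posrE.
have := sum_expR_gt0 (@normInv n) (card_Sn_gt0 n) theta.
by congr (_ < _); apply: eq_bigr => s _; rewrite /normInv mulrA mulrAC.
Qed.

Lemma Pr_mallows_ge0 n theta E : 0 <= Pr_mallows n theta E.
Proof. by apply: sumr_ge0 => s _; exact: mallows_ge0. Qed.

Lemma Pr_mallows_le n theta (E F : set 'S_n) : E `<=` F ->
  Pr_mallows n theta E <= Pr_mallows n theta F.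
Proof.
move=> EF; rewrite /Pr_mallows big_mkcond [leRHS]big_mkcond /=.
apply: ler_sum => s _; case: asboolP => [/EF Fs|_].
  by rewrite (asboolT Fs).
by case: ifP => // _; exact: mallows_ge0.
Qed.

Lemma Pr_mallowsC n theta (E : set 'S_n) :
  Pr_mallows n theta E + Pr_mallows n theta (~` E) = 1.
Proof.
rewrite -(sum_mallows n theta) /Pr_mallows [RHS](bigID (fun s => `[< E s >])) /=.
by congr (_ + _); apply: eq_bigl => s; rewrite -asbool_neg.
Qed.

Lemma Pr_mallowsU n theta (E F : set 'S_n) :
  Pr_mallows n theta (E `|` F) <= Pr_mallows n theta E + Pr_mallows n theta F.
Proof.
rewrite /Pr_mallows !(big_mkcond (fun s => `[< _ >])) /= -big_split /=.
apply: ler_sum => s _; have m0 := mallows_ge0 theta s.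
case: (asboolP (E s)) => Es; case: (asboolP (F s)) => Fs; case: asboolP => //= EFs;
  rewrite ?addr0 ?add0r// ?ler_wpDr//; try exact: addr_ge0.
by case: EFs.
Qed.

(** The statistic entering both estimating equations. *)
Definition invdens n (s : 'S_n) : R := (n%:R ^+ 2)^-1 * (Defs.Inv s)%:R.

(** Exponential Markov inequality: the weight of [s] is at most its product with
    [expR (n * t * (invdens s - a))] on the event, and this product is, up to a
    constant, the weight of [s] under the parameter [theta + t]. Taking
    [t < 0] gives the lower tail. *)
Lemma mallows_chernoff n theta t a :
  Pr_mallows n.+1 theta [set s : 'S_n.+1 | 0 <= t * (invdens s - a)] <=
  expR (n.+1%:R * ((Cn n.+1 (theta + t) - Cn n.+1 0) / n.+1%:R
     - (Cn n.+1 theta - Cn n.+1 0) / n.+1%:R - t * a)).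
Proof.
have n0 : n.+1%:R != 0 :> R by rewrite pnatr_eq0.
have -> : n.+1%:R * ((Cn n.+1 (theta + t) - Cn n.+1 0) / n.+1%:R
     - (Cn n.+1 theta - Cn n.+1 0) / n.+1%:R - t * a) =
   Cn n.+1 (theta + t) - Cn n.+1 theta - n.+1%:R * (t * a).
  move: (Cn n.+1 theta) (Cn n.+1 (theta + t)) (Cn n.+1 0) => u v w.
  by move: n0; move: (n.+1%:R) => N n0; field.
apply: (@le_trans _ _ (\sum_(s : 'S_n.+1) mallows theta s * expR (n.+1%:R * (t * (invdens s - a))))).
  rewrite /Pr_mallows big_mkcond /=; apply: ler_sum => s _; case: asboolP => /= h.
    rewrite ler_peMr ?mallows_ge0// -expR0 ler_expR mulr_ge0//.
  by apply: mulr_ge0; [exact: mallows_ge0|exact: expR_ge0].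
rewrite (eq_bigr (fun s => mallows (theta + t) s *
   expR (Cn n.+1 (theta + t) - Cn n.+1 theta - n.+1%:R * (t * a)))); last first.
  move=> s _; rewrite /mallows /invdens.
  move: (Cn n.+1 theta) (Cn n.+1 (theta + t)) ((Defs.Inv s)%:R) => u v w.
  rewrite -!expRD; congr expR; by move: n0; move: (n.+1%:R) => N n0; field.
by rewrite -mulr_suml sum_mallows mul1r.
Qed.

Definition dmrate t : R := derive1 mrate t.

Lemma is_derive_mrate t : is_derive t 1 mrate (dmrate t).
Proof. by rewrite /dmrate; split; [exact: derivable_mrate|rewrite derive1E]. Qed.

Lemma dmrate_incr s t : s < t -> dmrate s < dmrate t.
Proof. exact: derive1_mrate_incr. Qed.

(** By strict convexity the slope of a secant to the right of [t] exceeds the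
    slope of the tangent at [t]. *)
Lemma mrate_secant_right t e : 0 < e ->
  exists2 d, dmrate t < d & mrate (t + e) - mrate t = d * e.
Proof.
move=> e0; have te : t < t + e by lra.
have [x /andP[tx _] E] := derive_secant is_derive_mrate te.
exists (dmrate x); first exact: dmrate_incr.
by rewrite E; congr (_ * _); ring.
Qed.

Lemma mrate_secant_left t e : 0 < e ->
  exists2 d, d < dmrate t & mrate t - mrate (t - e) = d * e.
Proof.
move=> e0; have te : t - e < t by lra.
have [x /andP[_ tx] E] := derive_secant is_derive_mrate te.
exists (dmrate x); first exact: dmrate_incr.
by rewrite E; congr (_ * _); ring.
Qed.

(** The exponent in [mallows_chernoff], divided by [n], converges to
    [mrate (theta + t) - mrate theta - t * a], which is negative. *)
Lemma tail_cvg0 theta t a : mrate (theta + t) - mrate theta < t * a ->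
  Pr_mallows n theta [set s : 'S_n | 0 <= t * (invdens s - a)] @[n --> \oo] --> (0:R).
Proof.
move=> H; rewrite -cvg_shiftS.
set eta := (t * a - (mrate (theta + t) - mrate theta)) / 2.
have eta0 : 0 < eta by rewrite divr_gt0// subr_gt0.
have lim : (Cn n (theta + t) - Cn n 0) / n%:R - (Cn n theta - Cn n 0) / n%:R - t * a
    @[n --> \oo] --> mrate (theta + t) - mrate theta - t * a.
  by apply: cvgB; [apply: cvgB; exact: cvg_Cn|exact: cvg_cst].
rewrite -cvg_shiftS /= in lim.
have e2 : mrate (theta + t) - mrate theta - t * a < - eta.
  by rewrite /eta; set x := _ - _ in H *; lra.
have nearlim := cvgr_lt _ lim _ e2.
have {}nearlim := nearlim ltac:(typeclasses eauto).
apply: (@squeeze_cvgr _ _ _ _ (fun=> 0) (fun n => expR (eta * - n%:R))).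
- near=> n; rewrite Pr_mallows_ge0 /=; apply: le_trans (mallows_chernoff _ _ _ _) _.
  rewrite ler_expR; apply: (@le_trans _ _ (n.+1%:R * - eta)).
    by apply: ler_wpM2l => //; apply: ltW; near: n.
  by rewrite mulrN mulrN lerN2 mulrC ler_wpM2r ?(ltW eta0)// ler_nat.
- exact: cvg_cst.
- apply/cvgrPdist_lt => e e0; near=> n.
  rewrite sub0r normrN ger0_norm ?expR_ge0//.
  have [k kE] : exists k, expR k = e by exists (ln e); rewrite lnK.
  rewrite -kE ltr_expR mulrN ltrNl -ltr_pdivrMl//.
  rewrite (_ : eta^-1 * - k = - (ln e) / eta); last by rewrite -kE expRK mulrC.
  near: n; exact: nbhs_infty_gtr.
Unshelve. all: end_near. Qed.

(** Law of large numbers. For a small [t > 0] the hypothesis of [tail_cvg0] holds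
    with [a = dmrate theta + d] because [dmrate theta] is the derivative of
    [mrate]; similarly for the lower tail with a small [t < 0]. *)
Lemma invdens_cvg theta d : 0 < d ->
  Pr_mallows n theta [set s : 'S_n | d <= `|invdens s - dmrate theta| ]
    @[n --> \oo] --> (0:R).
Proof.
move=> d0; set c := dmrate theta.
have [h1 /andP[h10 _] H1] := derive_lt_right (is_derive_mrate theta) (ltr_pwDr d0 (lexx c)) ltr01.
have cd : c - d < c by lra.
have [h2 /andP[h20 _] H2] := derive_gt_left (is_derive_mrate theta) cd ltr01.
rewrite mulrC in H1; rewrite -mulNr mulrC mulrN -mulNr in H2.
apply: (@squeeze_cvgr _ _ _ _ (fun=> 0) (fun n =>
    Pr_mallows n theta [set s : 'S_n | 0 <= h1 * (invdens s - (c + d))] +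
    Pr_mallows n theta [set s : 'S_n | 0 <= - h2 * (invdens s - (c - d))])).
- near=> n; rewrite Pr_mallows_ge0 /=; apply: le_trans (Pr_mallowsU _ _ _).
  apply: Pr_mallows_le => s /=; rewrite ler_normr => /orP[h|h]; [left|right].
    by rewrite mulr_ge0 ?(ltW h10)//; lra.
  by rewrite mulNr -mulrN mulr_ge0 ?(ltW h20)//; lra.
- exact: cvg_cst.
- rewrite -[X in _ --> X](addr0 0); apply: cvgD; exact: tail_cvg0.
Unshelve. all: end_near. Qed.

(** A pointwise limit controls the slopes of the convex functions [g n]: for
    large [n] the secants of [g n] on the two sides of [theta] have slopes close
    to those of [mrate], which lie strictly below and above [dmrate theta]. So
    every [a] close to [dmrate theta] lies between [dg n (theta - e)] and
    [dg n (theta + e)]. *)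
Lemma root_criterion theta e (g dg : nat -> R -> R) :
  0 < e ->
  (forall n t, is_derive t 1 (g n) (dg n t)) ->
  (\forall n \near \oo, forall s t, s < t -> dg n s < dg n t) ->
  (forall t, g n t - g n 0 @[n --> \oo] --> mrate t) ->
  exists2 d, 0 < d & \forall n \near \oo, forall a, `|a - dmrate theta| < d ->
    exists2 c, `|c - theta| <= e & a - dg n c = 0 /\ forall c', a - dg n c' = 0 -> c' = c.
Proof.
move=> e0 gd mono lim; set c := dmrate theta.
have te : theta < theta + e by lra.
have et : theta - e < theta by lra.
have [d1 c1 E1] := mrate_secant_right theta e0.
have [d2 c2 E2] := mrate_secant_left theta e0.
rewrite -/c in c1 c2.
pose d : R := Num.min (d1 - c) (c - d2) / 2.
have d0 : 0 < d by rewrite divr_gt0// lt_min !subr_gt0 c1 c2.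
have dd1 : d * 2 <= d1 - c by rewrite divfK// ge_min lexx.
have dd2 : d * 2 <= c - d2 by rewrite divfK// ge_min lexx orbT.
exists d => //.
have L1 : (g n (theta + e) - g n 0 - (g n theta - g n 0)) @[n --> \oo] -->
    mrate (theta + e) - mrate theta by apply: cvgB.
have L2 : (g n theta - g n 0 - (g n (theta - e) - g n 0)) @[n --> \oo] -->
    mrate theta - mrate (theta - e) by apply: cvgB.
have B1 : (c + d) * e < mrate (theta + e) - mrate theta.
  rewrite E1 ltr_pM2r//; lra.
have B2 : mrate theta - mrate (theta - e) < (c - d) * e.
  rewrite E2 ltr_pM2r//; lra.
have N1 := cvgr_gt _ L1 _ B1; have N2 := cvgr_lt _ L2 _ B2.
have {}N1 := N1 ltac:(typeclasses eauto); have {}N2 := N2 ltac:(typeclasses eauto).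
near=> n => a; rewrite ltr_norml => /andP[a1 a2].
have mn : forall s t, s < t -> dg n s < dg n t by near: n.
have M1 : (c + d) * e < g n (theta + e) - g n 0 - (g n theta - g n 0) by near: n.
have M2 : g n theta - g n 0 - (g n (theta - e) - g n 0) < (c - d) * e by near: n.
have [y1 /andP[_ y1h] F1] := derive_secant (gd n) te.
have [y2 /andP[y2h _] F2] := derive_secant (gd n) et.
have y1d := mn _ _ y1h; have y2d := mn _ _ y2h.
have K1 : c + d < dg n y1.
  rewrite -(ltr_pM2r e0); apply: (lt_le_trans M1).
  by rewrite opprB addrA subrK F1 addrC addKr.
have K2 : dg n y2 < c - d.
  rewrite -(ltr_pM2r e0); apply: le_lt_trans M2.
  by rewrite opprB addrA subrK F2 opprB addrC subrK.
have lo : dg n (theta - e) < a by lra.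
have hi : a < dg n (theta + e) by lra.
have [r rt [ra ru]] := unique_root_derive (gd n) mn e0 lo hi.
exists r => //; split; first by rewrite ra subrr.
by move=> c' /eqP; rewrite subr_eq0 => /eqP h; apply: ru.
Unshelve. all: end_near. Qed.

(** Both estimating equations have the form [invdens s = dg n t]. By
    [root_criterion] there is a unique root, close to [theta], as soon as
    [invdens s] is close to [dmrate theta], and this event has probability
    tending to [1] by [invdens_cvg]. *)
Lemma unique_root_cvg theta (F : forall n, 'S_n -> R -> R) (g dg : nat -> R -> R) :
  (forall n s t, @F n s t = invdens s - dg n t) ->
  (forall n t, is_derive t 1 (g n) (dg n t)) ->
  (\forall n \near \oo, forall s t, s < t -> dg n s < dg n t) ->
  (forall t, g n t - g n 0 @[n --> \oo] --> mrate t) ->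
  Pr_mallows n theta [set s : 'S_n | unique_root (@F n s)] @[n --> \oo] --> (1 : R) /\
  forall est : (forall n, 'S_n -> R), root_estimator F est -> consistent_at theta est.
Proof.
move=> FE gd mono lim; split.
  have [d d0 H] := root_criterion theta ltr01 gd mono lim.
  apply: (@squeeze_cvgr _ _ _ _ (fun n => 1 - Pr_mallows n theta
    [set s : 'S_n | d <= `|invdens s - dmrate theta|]) (fun=> 1)).
  - near=> n; apply/andP; split; last first.
      by rewrite -[leRHS](Pr_mallowsC theta [set s : 'S_n | unique_root (@F n s)]) lerDl Pr_mallows_ge0.
    rewrite lerBlDr -[leLHS](Pr_mallowsC theta [set s : 'S_n | unique_root (@F n s)]) lerD2l.
    apply: Pr_mallows_le => s /= nu; rewrite leNgt; apply/negP => close; apply: nu.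
    have Hn : forall a, `|a - dmrate theta| < d ->
      exists2 c, `|c - theta| <= 1 & a - dg n c = 0 /\ forall c', a - dg n c' = 0 -> c' = c by near: n.
    have [c _ [c0 cu]] := Hn _ close.
    by exists c; split; [rewrite FE|move=> x; rewrite FE => /cu].
  - rewrite -[X in _ --> X]subr0; apply: cvgB; [exact: cvg_cst|exact: invdens_cvg].
  - exact: cvg_cst.
move=> est rest e e0.
have [d d0 H] := root_criterion theta e0 gd mono lim.
apply: (@squeeze_cvgr _ _ _ _ (fun=> 0) (fun n => Pr_mallows n theta
    [set s : 'S_n | d <= `|invdens s - dmrate theta|])).
- near=> n; rewrite Pr_mallows_ge0 /=; apply: Pr_mallows_le => s /= far.
  rewrite leNgt; apply/negP => close.
  have Hn : forall a, `|a - dmrate theta| < d ->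
    exists2 c, `|c - theta| <= e & a - dg n c = 0 /\ forall c', a - dg n c' = 0 -> c' = c by near: n.
  have [c ce [c0 cu]] := Hn _ close.
  have : F n s (est n s) = 0.
    by apply: rest; exists c; split; [rewrite FE|move=> x; rewrite FE => /cu].
  by rewrite FE => /cu E; move: far; rewrite E ltNge ce.
- exact: cvg_cst.
- exact: invdens_cvg.
Unshelve. all: end_near. Qed.

Lemma ML_consistent theta :
  Pr_mallows n theta [set s : 'S_n | unique_root (@ML R n s)] @[n --> \oo] --> (1 : R) /\
  forall est : (forall n, 'S_n -> R), root_estimator (@ML R) est -> consistent_at theta est.
Proof.
apply: (@unique_root_cvg _ _ (fun n t => n%:R^-1 * Cn n t) (fun n t => n%:R^-1 * dCn n t)).
- by move=> n s t; rewrite /ML derive1_Cn.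
- move=> n t; apply: (is_derive_eq (is_derive_mul (is_derive_const _ t) (is_derive_Cn n t))).
  by rewrite mul0r add0r.
- exists 2%N => // -[|[|n]]// _ s t st.
  by rewrite ltr_pM2l ?invr_gt0 ?ltr0n// dCn_incr.
- move=> t; have := @cvg_Cn R t; apply: cvg_trans; apply: near_eq_cvg.
  by near=> n; rewrite -mulrBr mulrC.
Unshelve. all: end_near. Qed.

Lemma LD_consistent theta : (C : R -> R) = mrate ->
  Pr_mallows n theta [set s : 'S_n | unique_root (@LD R n s)] @[n --> \oo] --> (1 : R) /\
  forall est : (forall n, 'S_n -> R), root_estimator (@LD R) est -> consistent_at theta est.
Proof.
move=> CE.
apply: (@unique_root_cvg _ _ (fun n => mrate) (fun n => dmrate)).
- by move=> n s t; rewrite /LD CE.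
- by move=> n t; exact: is_derive_mrate.
- by apply: nearW => n s t; exact: dmrate_incr.
- by move=> t; rewrite mrate0; under eq_fun do rewrite subr0; exact: cvg_cst.
Qed.

End mallows_probability.

(** * Measures on the line and their distribution functions *)

Section halflines.
Context {R : realType}.
Notation mR := (measurableTypeR R).
Notation lam := (@lebesgue_measure R).
Local Open Scope ereal_scope.

Definition lray (x : R) : set mR := [set t | (t <= x)%R].

Lemma lrayE x : lray x = `]-oo, x]%classic.
Proof. by apply/seteqP; split => t /=; rewrite in_itv. Qed.

Lemma measurable_lray x : measurable (lray x).
Proof. by rewrite lrayE; exact: measurable_itv. Qed.

Lemma bigcup_lray : \bigcup_n lray n%:R = setT.
Proof.
apply/seteqP; split => // x _; exists (Num.bound `|x|) => //=; rewrite /lray/=.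
by apply/ltW; apply: le_lt_trans (ler_norm _) _; exact: archi_boundP.
Qed.

Lemma measure_eq_lray (m1 m2 : {measure set mR -> \bar R}) :
  (forall x : R, m1 (lray x) = m2 (lray x)) ->
  (forall x : R, m1 (lray x) < +oo) ->
  forall A, measurable A -> m1 A = m2 A.
Proof.
move=> H fin A mA.
pose G : set (set mR) := [set A | exists x : R, A = lray x].
apply: (@measure_unique _ _ _ G (fun n => lray n%:R)) => //.
- rewrite eqEsubset; split => [B|].
    rewrite [measurable]RGenOInfty.measurableE; move: B.
    apply: smallest_sub; first exact: smallest_sigma_algebra.
    move=> _ [x ->].
    have -> : (`]x, +oo[%classic : set mR) = ~` lray x.
      by rewrite lrayE setCitvl.
    apply: (@measurableC _ (g_sigma_algebraType G)).
    by apply: sub_sigma_algebra; exists x.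
  apply: smallest_sub; first exact: sigma_algebra_measurable.
  by move=> _ [x ->]; exact: measurable_lray.
- move=> _ _ [x ->] [y ->]; exists (Num.min x y).
  by rewrite eqEsubset; split => z; rewrite /lray /= le_min => /andP.
- by move=> n; exists n%:R.
- exact: bigcup_lray.
- by move=> _ [x ->].
Qed.

Lemma cvg_lray_left (m : {measure set mR -> \bar R}) (S : R) :
  m (lray (S - n.+1%:R^-1)) @[n --> \oo] --> m [set t | (t < S)%R].
Proof.
have -> : [set t | (t < S)%R] = \bigcup_n lray (S - n.+1%:R^-1).
  apply/seteqP; split => t /=.
    move=> tS; have St : (0 < S - t)%R by rewrite subr_gt0.
    exists (Num.bound (S - t)^-1) => //; rewrite /lray/= lerBrDr -lerBrDl.
    rewrite invf_ple ?posrE ?ltr0n//; apply/ltW.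
    apply: lt_le_trans (archi_boundP _) _; first by rewrite invr_ge0 ltW.
    by rewrite ler_nat.
  move=> [n _]; rewrite /lray/= => h; apply: le_lt_trans h _.
  by rewrite ltrBlDr ltrDl invr_gt0.
apply: nondecreasing_cvg_mu.
- by move=> n; exact: measurable_lray.
- by apply: bigcup_measurable => n _; exact: measurable_lray.
- move=> i j ij; apply/subsetPset => t; rewrite /lray/= => h; apply: le_trans h _.
  by rewrite lerD2l lerN2 lef_pV2 ?posrE ?ltr0n// ler_nat.
Qed.

Lemma cvg_lray_right (m : {measure set mR -> \bar R}) (S : R) :
  (forall x, m (lray x) < +oo) ->
  m (lray (S + n.+1%:R^-1)) @[n --> \oo] --> m (lray S).
Proof.
move=> fin.
have -> : lray S = \bigcap_n lray (S + n.+1%:R^-1).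
  apply/seteqP; split => t /=.
    move=> tS n _; rewrite /lray/=; apply: le_trans tS _.
    by rewrite lerDl invr_ge0.
  move=> h; rewrite /lray/= leNgt; apply/negP => St.
  have St0 : (0 < t - S)%R by rewrite subr_gt0.
  have := h (Num.bound (t - S)^-1) I; rewrite /lray/= leNgt => /negP; apply.
  rewrite -ltrBrDl invf_plt ?posrE ?ltr0n//.
  apply: lt_le_trans (archi_boundP _) _; first by rewrite invr_ge0 ltW.
  by rewrite ler_nat.
apply: nonincreasing_cvg_mu => //.
- by move=> n; exact: measurable_lray.
- by apply: bigcap_measurable => // n _; exact: measurable_lray.
- move=> i j ij; apply/subsetPset => t; rewrite /lray/= => h; apply: le_trans h _.
  by rewrite lerD2l lef_pV2 ?posrE ?ltr0n// ler_nat.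
Qed.

Lemma cvg_lray_pinfty (m : {measure set mR -> \bar R}) :
  m (lray n%:R) @[n --> \oo] --> m setT.
Proof.
rewrite -bigcup_lray; apply: nondecreasing_cvg_mu.
- by move=> n; exact: measurable_lray.
- by apply: bigcup_measurable => n _; exact: measurable_lray.
- move=> i j ij; apply/subsetPset => t; rewrite /lray/= => h; apply: le_trans h _.
  by rewrite ler_nat.
Qed.

Lemma cvg_lray_ninfty (m : {measure set mR -> \bar R}) :
  (forall x, m (lray x) < +oo) -> m (lray (- n%:R)) @[n --> \oo] --> 0.
Proof.
move=> fin; rewrite -(measure0 m).
have -> : set0 = \bigcap_n lray (- n%:R).
  apply/seteqP; split => t //= h.
  have := h (Num.bound `|t|) I; rewrite /lray/= lerNr leNgt => /negP; apply.
  by apply: le_lt_trans (ler_norm _) _; rewrite normrN; exact: archi_boundP.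
apply: nonincreasing_cvg_mu => //.
- by move=> n; exact: measurable_lray.
- by apply: bigcap_measurable => // n _; exact: measurable_lray.
- move=> i j ij; apply/subsetPset => t; rewrite /lray/= => h; apply: le_trans h _.
  by rewrite lerN2 ler_nat.
Qed.

End halflines.

(** * The probability integral transform *)

Section probability_integral_transform.
Context {R : realType}.
Notation mR := (measurableTypeR R).
Notation lam := (@lebesgue_measure R).
Local Open Scope ereal_scope.
Variables (nu : {measure set mR -> \bar R}) (m : R).
Hypothesis nuT : nu setT = m%:E.
Hypothesis nu1 : forall x : R, nu [set x] = 0.

Definition mcdf (x : mR) : mR := fine (nu (lray x)).

Let m0 : (0 <= m)%R. Proof. by rewrite -lee_fin -nuT. Qed.

Let finA A : measurable A -> nu A \is a fin_num.
Proof.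
move=> mA; rewrite ge0_fin_numE//; apply: (@le_lt_trans _ _ (nu setT)).
  by apply: le_measure; rewrite ?inE.
by rewrite nuT ltry.
Qed.

Lemma mcdfE x : (mcdf x)%:E = nu (lray x).
Proof. by rewrite fineK// finA//; exact: measurable_lray. Qed.

Lemma mcdf_nd : {homo mcdf : x y / (x <= y)%R}.
Proof.
move=> x y xy; rewrite -lee_fin !mcdfE; apply: le_measure; rewrite ?inE; try exact: measurable_lray.
by move=> t; rewrite /lray/= => h; exact: le_trans xy.
Qed.

Lemma mcdf_ge0 x : (0 <= mcdf x)%R. Proof. by rewrite -lee_fin mcdfE. Qed.

Lemma mcdf_le x : (mcdf x <= m)%R.
Proof.
rewrite -lee_fin mcdfE -nuT; apply: le_measure; rewrite ?inE//; exact: measurable_lray.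
Qed.

Lemma measurable_mcdf : measurable_fun setT mcdf.
Proof. by apply: nondecreasing_measurable => // x y; exact: mcdf_nd. Qed.

Let itv0m (t : R) : (0 <= t <= m)%R -> lam (lray t `&` `[0%R, m]%classic) = t%:E.
Proof.
move=> /andP[t0 tm].
rewrite (_ : lray t `&` _ = `[0%R, t]%classic).
  by rewrite lebesgue_measure_itv/= lte_fin; case: ltgtP t0 => // [_|<-] _; rewrite ?sube0.
apply/seteqP; split => z /=; rewrite /lray/= !in_itv/=.
  by move=> [zt /andP[z0 zm]]; rewrite z0.
by move=> /andP[z0 zt]; split => //; rewrite z0 (le_trans zt).
Qed.

(** The set where the distribution function is at most [t] is a half-line with
    supremum [S]. The measure of the half-line up to [S] is at most [t] by
    continuity from below, atoms being excluded, and at least [t] by continuity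
    from above since the function exceeds [t] to the right of [S]. The cases
    where this set is empty or unbounded are treated with the limits at
    infinity. *)
Lemma mcdf_preimage (t : R) : nu (mcdf @^-1` lray t) = lam (lray t `&` `[0%R, m]%classic).
Proof.
have [t0|t0] := ltP t 0%R.
  rewrite (_ : lray t `&` _ = set0); last first.
    by apply/seteqP; split => z //=; rewrite /lray/= in_itv/= => -[zt /andP[]]; lra.
  rewrite measure0 (_ : _ @^-1` _ = set0) ?measure0//.
  by apply/seteqP; split => z //=; rewrite /lray/=; have := mcdf_ge0 z; lra.
have [tm|mt] := ltP t m; last first.
  rewrite (_ : lray t `&` _ = `[0%R, m]%classic); last first.
    by apply/setIidPr => z /=; rewrite in_itv/= /lray/= => /andP[_ zm]; exact: le_trans mt.
  rewrite (_ : _ @^-1` _ = setT); last first.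
    by apply/seteqP; split => z //= _; rewrite /lray/=; apply: le_trans mt; exact: mcdf_le.
  rewrite nuT lebesgue_measure_itv/= lte_fin.
  by case: ltgtP m0 => // [_|<-] _; rewrite ?sube0.
rewrite itv0m; last by rewrite t0 ltW.
set A := mcdf @^-1` lray t.
have Adown x y : A y -> (x <= y)%R -> A x.
  by rewrite /A /lray/= => h xy; apply: le_trans h; exact: mcdf_nd.
have finr x : nu (lray x) < +oo by rewrite -mcdfE ltry.
have [[x0 Ax0]|A0] := pselect (A !=set0); last first.
  have t00 : (t <= 0)%R.
    rewrite -lee_fin; apply: (cvge_to_ge (cvg_lray_ninfty finr)).
    apply: nearW => n; rewrite -mcdfE lee_fin leNgt; apply/negP => h.
    by apply: A0; exists (- n%:R)%R; rewrite /A/= /lray/= ltW.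
  rewrite (_ : A = set0) ?measure0; last first.
    by apply/seteqP; split => // z Az; apply: A0; exists z.
  by congr EFin; apply/eqP; rewrite eq_le t0 t00.
have [ub|nub] := pselect (has_ubound A); last first.
  exfalso; move: tm; rewrite ltNge => /negP; apply.
  have H := @cvg_lray_pinfty R nu; rewrite [X in _ --> X]nuT in H.
  rewrite -lee_fin; apply: (cvge_to_le H).
  apply: nearW => n; rewrite -mcdfE lee_fin leNgt; apply/negP => h.
  apply: nub; exists (n%:R)%R => x Ax; rewrite leNgt; apply/negP => nx.
  by have := Adown _ _ Ax (ltW nx); rewrite /A /lray/= leNgt h.
have supA : has_sup A by split; [exists x0|].
pose S := sup A.
have AS x : A x -> (x <= S)%R by move=> Ax; exact: ub_le_sup.
have SA x : (x < S)%R -> A x.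
  by move=> xS; have [|y Ay xy] := @sup_gt _ A x _ xS; [exists x0|exact: Adown Ay (ltW xy)].
have mlt : measurable ([set x | (x < S)%R] : set mR).
  rewrite (_ : [set x | _] = `]-oo, S[%classic); first exact: measurable_itv.
  by apply/seteqP; split => z /=; rewrite in_itv.
have mA : measurable (A : set mR).
  by rewrite -[A]setTI; apply: measurable_mcdf => //; exact: measurable_lray.
have nuS' : nu [set x | (x < S)%R] = nu (lray S).
  rewrite (_ : lray S = [set x | (x < S)%R] `|` [set S]).
    rewrite measureU//; first by rewrite [X in _ + X]nu1 adde0.
    by apply/seteqP; split => z //= [+ zS]; rewrite zS ltxx.
  apply/seteqP; split => z; rewrite /lray/= le_eqVlt.
    by move=> /predU1P[->|]; [right|left].
  by move=> [->|->]; rewrite ?orbT ?eqxx.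
have nuS : nu A = nu (lray S).
  apply/eqP; rewrite eq_le; apply/andP; split.
    apply: le_measure; rewrite ?inE//; exact: measurable_lray.
  by rewrite -nuS'; apply: le_measure; rewrite ?inE.
apply/eqP; rewrite eq_le; apply/andP; split.
- have H := @cvg_lray_left R nu S; rewrite [X in _ --> X]nuS' -nuS in H.
  apply: (cvge_to_le H).
  apply: nearW => n; rewrite -mcdfE lee_fin.
  have : A (S - n.+1%:R^-1)%R by apply: SA; rewrite ltrBlDr ltrDl invr_gt0.
  by [].
- rewrite nuS; apply: (cvge_to_ge (@cvg_lray_right R nu S finr)).
  apply: nearW => n; rewrite -mcdfE lee_fin leNgt; apply/negP => h.
  have : A (S + n.+1%:R^-1)%R by rewrite /A/= /lray/= ltW.
  by move/AS; rewrite leNgt ltrDl invr_gt0 ltr0n.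
Qed.

(** A finite atomless measure of total mass [m] is transported by its own
    distribution function to Lebesgue measure on [[0, m]]. *)
Lemma integral_mcdf (psi : mR -> \bar R) : measurable_fun setT psi ->
  (forall x, 0 <= psi x) ->
  \int[nu]_x psi (mcdf x) = \int[lam]_(x in `[0%R, m]) psi x.
Proof.
move=> mpsi psi0.
have mm : measurable (`[0%R, m]%classic : set mR) by exact: measurable_itv.
pose nu' : {measure set mR -> \bar R} :=
  @measure_function_pushforward__canonical__measure_function_Measure _ _ mR mR _ nu mcdf measurable_mcdf.
have E : forall A, measurable A -> nu' A = mrestr lam mm A.
  apply: measure_eq_lray.
    by move=> x; exact: mcdf_preimage.
  move=> x; rewrite /= /pushforward -ge0_fin_numE// finA// -[X in measurable X]setTI.
  by apply: measurable_mcdf => //; exact: measurable_lray.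
transitivity (\int[nu']_(x in `[0%R, m]) psi x); last first.
  by apply: eq_measure_integral => A mA Am; rewrite E// /mrestr setIidl.
rewrite [RHS]ge0_integral_pushforward//.
- rewrite (_ : mcdf @^-1` _ = setT)//.
  by apply/seteqP; split => // x _ /=; rewrite in_itv/= mcdf_ge0 mcdf_le.
- exact: measurable_mcdf.
- exact: measurable_funTS.
Qed.

End probability_integral_transform.

(** * Measures given by a density *)

Section density.
Context {R : realType} d (T : measurableType d) (mu : {sigma_finite_measure set T -> \bar R}).
Local Open Scope ereal_scope.

Lemma integral_density (nu : {finite_measure set T -> \bar R}) (f : T -> R)
    (phi : T -> \bar R) :
  measurable_fun setT f -> (forall x, 0 <= f x)%R ->
  (forall A, measurable A -> nu A = \int[mu]_(x in A) (f x)%:E) ->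
  measurable_fun setT phi -> (forall x, 0 <= phi x) ->
  \int[nu]_x phi x = \int[mu]_x (phi x * (f x)%:E).
Proof.
move=> mf f0 nuE mphi phi0.
have numu : nu `<< mu.
  apply/null_content_dominatesP => A mA A0; rewrite nuE//.
  by apply: null_set_integral => //; apply/measurable_EFinP/measurable_funTS.
rewrite -(Radon_Nikodym_SigmaFinite.change_of_variables numu)//.
have mRN : measurable_fun setT (Radon_Nikodym_SigmaFinite.f nu mu).
  exact: measurable_int (Radon_Nikodym_SigmaFinite.f_integrable numu).
apply: ge0_ae_eq_integral => //.
- exact: emeasurable_funM.
- by apply: emeasurable_funM => //; exact/measurable_EFinP.
- by move=> x _; apply: mule_ge0 => //; exact: Radon_Nikodym_SigmaFinite.f_ge0.
- by move=> x _; rewrite mule_ge0// lee_fin.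
- apply: ae_eqe_mul2l.
  apply: integral_ae_eq => //.
  + exact: Radon_Nikodym_SigmaFinite.f_integrable.
  + exact/measurable_EFinP.
  + by move=> E _ mE; rewrite -Radon_Nikodym_SigmaFinite.f_integral// nuE.
Qed.

Variables (f : T -> R) (mf : measurable_fun setT f) (f0 : forall x, (0 <= f x)%R)
  (fint : \int[mu]_x (f x)%:E < +oo).

(** The measurability, positivity and finiteness proofs are arguments in order
    that this function carry the structure of a finite measure. *)
Definition mdens (mf : measurable_fun setT f) (f0 : forall x, (0 <= f x)%R)
  (fint : \int[mu]_x (f x)%:E < +oo) : set T -> \bar R :=
  fun A => \int[mu]_(x in A) (f x)%:E.

Let mdens0 : mdens mf f0 fint set0 = 0.
Proof. by rewrite /mdens integral_set0. Qed.

Let mdens_ge0 A : 0 <= mdens mf f0 fint A.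
Proof. by apply: integral_ge0 => x _; rewrite lee_fin. Qed.

Let mdens_sigma_additive : semi_sigma_additive (mdens mf f0 fint).
Proof.
move=> /= F mF tF mUF; rewrite /mdens; apply: cvg_toP.
  apply: ereal_nondecreasing_is_cvgn => m n mn.
  apply: lee_sum_nneg_natr => // k _ _.
  by apply: integral_ge0 => /= x Fkx; rewrite lee_fin.
rewrite ge0_integral_bigcup//=.
- by apply: measurable_funTS; exact/measurable_EFinP.
- by move=> x _; rewrite lee_fin.
Qed.

HB.instance Definition _ := isMeasure.Build _ _ _ (mdens mf f0 fint)
  mdens0 mdens_ge0 mdens_sigma_additive.

Let mdens_fin : fin_num_fun (mdens mf f0 fint).
Proof.
move=> A mA; rewrite ge0_fin_numE//; apply: le_lt_trans fint.
apply: ge0_subset_integral => //; first exact/measurable_EFinP.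
by move=> x _; rewrite lee_fin.
Qed.

HB.instance Definition _ := Measure_isFinite.Build _ _ _ (mdens mf f0 fint) mdens_fin.

End density.

(** * The uniform distribution on the unit interval *)

Section uniform01.
Context {R : realType}.
Notation mR := (measurableTypeR R).
Notation lam := (@lebesgue_measure R).
Notation U := (@uniform01 R).
Local Open Scope ereal_scope.

Lemma uniform01E (A : set mR) : measurable A -> U A = lam (A `&` `[0%R, 1%R]%classic).
Proof.
move=> mA; rewrite /uniform01/= /uniform_prob integral_uniform_pdf.
rewrite (eq_integral (cst 1)); last first.
  move=> x; rewrite inE/= in_itv/= => -[_ x01].
  by rewrite /uniform_pdf x01 subr0 invr1.
by rewrite integral_cst ?mul1e//; exact: measurableI.
Qed.

Lemma integral_uniform01 (f : mR -> \bar R) : measurable_fun setT f ->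
  (forall x, 0 <= f x) -> \int[U]_x f x = \int[lam]_(x in `[0%R, 1%R]) f x.
Proof.
by move=> mf f0; rewrite /uniform01 integral_uniform// subr0 invr1 mul1e.
Qed.

Lemma uniform01_lray (x : R) : (0 <= x <= 1)%R -> U (lray x) = x%:E.
Proof.
move=> /andP[x0 x1]; rewrite uniform01E; last exact: measurable_lray.
rewrite (_ : _ `&` _ = `[0%R, x]%classic).
  by rewrite lebesgue_measure_itv/= lte_fin; case: ltgtP x0 => // [_|<-] _; rewrite ?sube0.
apply/seteqP; split => z /=; rewrite /lray/= !in_itv/=.
  by move=> [zx /andP[z0 _]]; rewrite z0.
by move=> /andP[z0 zx]; split => //; rewrite z0 (le_trans zx).
Qed.

Lemma uniform01_set1 (x : R) : U [set x] = 0.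
Proof.
rewrite uniform01E//; apply/eqP; rewrite -measure_le0 -(lebesgue_measure_set1 x).
by apply: le_measure; rewrite ?inE//; exact: measurableI.
Qed.

End uniform01.

(** * Gibbs' variational inequality *)

Section gibbs.
Context {R : realType} d (T : measurableType d) (mu nu : probability T R).
Variables (f phi l : T -> R).
Hypotheses (mf : measurable_fun setT f) (f0 : forall x, (0 <= f x)%R).
Hypothesis nuE : forall A, measurable A -> nu A = (\int[mu]_(x in A) (f x)%:E)%E.
Hypotheses (mphi : measurable_fun setT phi) (phi0 : forall x, (0 <= phi x)%R).
Hypothesis intphi : (\int[mu]_x (phi x)%:E <= 1)%E.
Hypothesis intl : nu.-integrable setT (EFin \o l).
Hypothesis phil : {ae nu, forall x, phi x = expR (l x)}.

Let a x : R := ln (f x).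

Let ma : measurable_fun setT a.
Proof. by apply: (measurableT_comp (f := @ln R)) => //; exact: measurable_ln. Qed.

Let msqrt (g : T -> R) : measurable_fun setT g -> measurable_fun setT (fun x => Num.sqrt (g x)).
Proof.
move=> mg; apply: (measurableT_comp (f := @Num.sqrt R)) => //.
apply: continuous_measurable_fun; exact: sqrt_continuous.
Qed.

Let f_gt0 : {ae nu, forall x, 0 < f x}.
Proof.
exists (f @^-1` [set 0]); split.
- by rewrite -[X in measurable X]setTI; apply: mf.
- rewrite nuE; last by rewrite -[X in measurable X]setTI; apply: mf.
  apply: integral0_eq => x /= fx; by rewrite fx.
- by move=> x /= /negP; rewrite -leNgt => fx; apply/eqP; rewrite eq_le fx f0.
Qed.

(** On nonnegative numbers [lne] and [ln] differ at [0] only, and the density is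
    positive almost everywhere for the measure which it defines. *)
Lemma KL_ln : (\int[nu]_x lne (f x)%:E = \int[nu]_x (a x)%:E)%E.
Proof.
apply: ae_eq_integral => //.
- rewrite (_ : (fun x => lne _) = fun x => if f x <= 0 then -oo%E else (a x)%:E).
    apply: measurable_fun_ifT => //; last exact/measurable_EFinP.
    exact: measurable_fun_ler.
  apply/funext => x; case: leP => fx; first by rewrite le0_lneNy// lee_fin.
  by rewrite lne_EFin.
- exact/measurable_EFinP.
- by apply: filterS f_gt0 => x fx _; rewrite lne_EFin.
Qed.

Let s x : R := Num.sqrt (phi x) * Num.sqrt (f x).
Let k x : R := Num.sqrt (phi x) * expR (a x * - 2^-1).

Let ms : measurable_fun setT s.
Proof. by apply: measurable_funM; exact: msqrt. Qed.

Let mk : measurable_fun setT k.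
Proof.
apply: measurable_funM; first exact: msqrt.
apply: (measurableT_comp (f := @expR R)) => //.
exact: measurable_funM.
Qed.

Let kf x : k x * f x = s x.
Proof.
rewrite /k /s -mulrA; congr (_ * _).
have := f0 x; rewrite le_eqVlt => /predU1P[<-|fx]; first by rewrite sqrtr0 mulr0.
have fE : f x = expR (a x / 2) ^+ 2 by rewrite expr2 -expRD -splitr lnK.
rewrite fE sqrtr_sqr ger0_norm ?expR_ge0// mulrN expRN.
by rewrite expr2 mulrA mulVf ?mul1r// gt_eqF ?expR_gt0.
Qed.

Let intf : mu.-integrable setT (EFin \o f).
Proof.
apply/integrableP; split; first exact/measurable_EFinP.
under eq_integral do rewrite gee0_abs ?lee_fin//.
by rewrite -nuE// (le_lt_trans (probability_le1 _ _))// ltry.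
Qed.

Let intp : mu.-integrable setT (EFin \o phi).
Proof.
apply/integrableP; split; first exact/measurable_EFinP.
under eq_integral do rewrite gee0_abs ?lee_fin//.
by rewrite (le_lt_trans intphi)// ltry.
Qed.

Let ints : mu.-integrable setT (EFin \o s).
Proof.
have := integrableD measurableT intf intp; apply: le_integrable => //.
  exact/measurable_EFinP.
move=> x _; rewrite /= lee_fin !ger0_norm ?addr_ge0//; last by rewrite mulr_ge0 ?sqrtr_ge0.
rewrite -[X in X + _](sqr_sqrtr (f0 x)) -[X in _ + X](sqr_sqrtr (phi0 x)) /s.
have := sqrtr_ge0 (f x); have := sqrtr_ge0 (phi x); nra.
Qed.

Let intk_eq : (\int[nu]_x (k x)%:E = \int[mu]_x (s x)%:E)%E.
Proof.
rewrite (@integral_density _ _ _ mu nu f)//.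
- by apply: eq_integral => x _; rewrite -EFinM kf.
- exact/measurable_EFinP.
- by move=> x; rewrite lee_fin mulr_ge0 ?sqrtr_ge0 ?expR_ge0.
Qed.

Let intk : nu.-integrable setT (EFin \o k).
Proof.
apply/integrableP; split; first exact/measurable_EFinP.
under eq_integral do rewrite gee0_abs ?lee_fin ?mulr_ge0 ?sqrtr_ge0 ?expR_ge0//.
rewrite intk_eq; have := integrable_fin_num measurableT ints.
by rewrite ge0_fin_numE//; apply: integral_ge0 => x _; rewrite lee_fin mulr_ge0 ?sqrtr_ge0.
Qed.

Definition hellinger : \bar R :=
  (\int[mu]_x ((Num.sqrt (f x) - Num.sqrt (phi x)) ^+ 2)%:E)%E.

Let hellingerE : hellinger =
  (\int[mu]_x (f x) + \int[mu]_x (phi x) - 2 * \int[mu]_x (s x))%:E.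
Proof.
have I2 : mu.-integrable setT (EFin \o (fun x => 2 * s x)).
  by apply: eq_integrable (integrableZl measurableT 2 ints).
have Ifp : mu.-integrable setT (EFin \o (fun x => f x + phi x)).
  by apply: eq_integrable (integrableD measurableT intf intp).
rewrite -RintegralZl// -RintegralD// -RintegralB//.
rewrite /Rintegral fineK; last first.
  apply: integrable_fin_num => //.
  by apply: eq_integrable (integrableB measurableT Ifp I2).
apply: eq_integral => x _; congr EFin.
rewrite sqrrB !sqr_sqrtr// /s -mulr_natl; ring.
Qed.

Let ae_lower : {ae nu, forall x, l x + 2 - 2 * k x <= a x}.
Proof.
apply: filterS2 f_gt0 phil => x fx px.
have -> : k x = expR ((l x - a x) / 2).
  rewrite /k px (_ : expR (l x) = expR (l x / 2) ^+ 2); last first.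
    by rewrite expr2 -expRD -splitr.
  by rewrite sqrtr_sqr ger0_norm ?expR_ge0// -expRD mulrN -mulrBl.
by have := expR_ge1Dx ((l x - a x) / 2); lra.
Qed.

Let b x : R := l x + 2 - 2 * k x.

Let intb : nu.-integrable setT (EFin \o b).
Proof.
have := integrableB measurableT
  (integrableD measurableT intl (finite_measure_integrable_cst nu 2 measurableT))
  (integrableZl measurableT 2 intk).
by apply: eq_integrable.
Qed.

Let Rintb : \int[nu]_x b x = \int[nu]_x l x + 2 - 2 * \int[nu]_x k x.
Proof.
rewrite /b RintegralB//; last 2 first.
- by apply: eq_integrable (integrableD measurableT intl (finite_measure_integrable_cst nu 2 measurableT)).
- by apply: eq_integrable (integrableZl measurableT 2 intk).
rewrite RintegralD//; last exact: finite_measure_integrable_cst.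
rewrite RintegralZl// Rintegral_cst//.
by rewrite [X in fine X](_ : _ = 1%E) ?mulr1//; exact: probability_setT.
Qed.

(** The negative part of [ln f] is integrable because the integrable function [b]
    is a lower bound, so that only an infinite positive part could fail. *)
Let inta : (\int[nu]_x (a x)%:E < +oo)%E -> nu.-integrable setT (EFin \o a).
Proof.
move=> aoo.
have mea : measurable_fun setT (EFin \o a) by exact/measurable_EFinP.
have neg : (\int[nu]_x (EFin \o a)^\- x < +oo)%E.
  have negb : (\int[nu]_x (EFin \o b)^\- x < +oo)%E by exact: integral_funeneg_lt_pinfty.
  apply: le_lt_trans negb.
  apply: ae_ge0_le_integral => //.
  - exact: measurable_funeneg.
  - by apply: measurable_funeneg; exact: measurable_int intb.
  - apply: filterS ae_lower => x h _; rewrite !funenegE/=.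
    by rewrite ge_max le_max /= lee_fin lerN2 h /= le_max lexx orbT.
apply/integrableP; split => //.
rewrite (eq_integral (fun x => (EFin \o a)^\+ x + (EFin \o a)^\- x)%E); last first.
  by move=> x _; rewrite -[RHS]/(((EFin \o a)^\+ \+ (EFin \o a)^\-)%E x) -fune_abse.
rewrite ge0_integralD//; try exact: measurable_funepos; try exact: measurable_funeneg.
rewrite lte_add_pinfty//.
have aoo' : (\int[nu]_x (EFin \o a) x < +oo)%E := aoo.
rewrite integralE in aoo'; move: aoo' neg.
case: (\int[nu]_x (EFin \o a)^\+ x)%E => [r _ _| |_ _]; [exact: ltry| |by []].
by case: (\int[nu]_x (EFin \o a)^\- x)%E.
Qed.

(** Write [k] for [expR ((l - ln f) / 2)], which is the square root of [phi / f]
    almost everywhere for [nu]. The inequality [1 + x <= expR x] gives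
    [l + 2 - 2 * k <= ln f]. The integral of [k] for [nu] is that of
    [sqrt (phi * f)] for [mu], so that integrating leaves the squared Hellinger
    distance of [f] and [phi] as a defect. Unlike Jensen's inequality this form
    also yields the equality case, by [gibbs_eq]. *)
Lemma gibbs_hellinger :
  (\int[nu]_x (l x)%:E + hellinger <= \int[nu]_x lne (f x)%:E)%E.
Proof.
rewrite KL_ln; have [aoo|] := ltP (\int[nu]_x (a x)%:E)%E +oo%E; last first.
  by rewrite leye_eq => /eqP ->; exact: leey.
have ia := inta aoo.
rewrite hellingerE -[X in (X + _)%E]fineK; last exact: integrable_fin_num intl.
rewrite -[leRHS]fineK; last exact: integrable_fin_num ia.
rewrite -EFinD lee_fin.
have R1 : 0 <= \int[nu]_x (a x - b x).
  have mr : measurable_fun setT (fun x => a x - b x).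
    by apply: measurable_funB => //; apply/measurable_EFinP; exact: measurable_int intb.
  rewrite /Rintegral (_ : (\int[nu]_x (a x - b x)%:E = \int[nu]_x `|(a x - b x)%:E|)%E).
    by rewrite fine_ge0// integral_ge0.
  apply: ae_eq_integral => //; first exact/measurable_EFinP.
    by apply: (measurableT_comp (f := abse)) => //; exact/measurable_EFinP.
  by apply: filterS ae_lower => x h _ /=; rewrite ger0_norm// subr_ge0.
rewrite RintegralB// Rintb in R1.
have R2 : \int[nu]_x k x = \int[mu]_x s x by rewrite /Rintegral intk_eq.
have R3 : \int[mu]_x f x <= 1.
  by rewrite /Rintegral -nuE// -lee_fin fineK ?fin_num_measure// probability_le1.
have R4 : \int[mu]_x phi x <= 1.
  by rewrite /Rintegral -lee_fin fineK//; exact: integrable_fin_num intp.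
rewrite -[fine (integral nu _ _)]/(\int[nu]_x l x) -[leRHS]/(\int[nu]_x a x).
lra.
Qed.

Lemma gibbs_le : (\int[nu]_x (l x)%:E <= \int[nu]_x lne (f x)%:E)%E.
Proof.
apply: le_trans gibbs_hellinger; rewrite leeDl// integral_ge0// => x _.
by rewrite lee_fin sqr_ge0.
Qed.

Lemma gibbs_eq : (\int[nu]_x lne (f x)%:E = \int[nu]_x (l x)%:E)%E ->
  {ae mu, forall x, f x = phi x}.
Proof.
move=> E; have := gibbs_hellinger; rewrite E.
have lfin : (\int[nu]_x (l x)%:E)%E \is a fin_num by exact: integrable_fin_num intl.
rewrite -[leRHS]adde0 leeD2lE// => H.
have H0 : hellinger = 0%E.
  apply/eqP; rewrite eq_le H integral_ge0// => x _; by rewrite lee_fin sqr_ge0.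
have mh : measurable_fun setT (fun x => ((Num.sqrt (f x) - Num.sqrt (phi x)) ^+ 2)%:E).
  by apply/measurable_EFinP/measurable_funX/measurable_funB; exact: msqrt.
have : ae_eq mu setT (fun x => ((Num.sqrt (f x) - Num.sqrt (phi x)) ^+ 2)%:E) (cst 0%E).
  apply/ae_eq_integral_abs => //; rewrite -[RHS]H0.
  by apply: eq_integral => x _; rewrite gee0_abs// lee_fin sqr_ge0.
apply: filterS => x /(_ I) /eqP; rewrite eqe sqrf_eq0 subr_eq0 => /eqP.
by move=> /(congr1 (fun u => u ^+ 2)); rewrite !sqr_sqrtr.
Qed.

Lemma gibbs_attained : {ae mu, forall x, f x = phi x} ->
  (\int[nu]_x lne (f x)%:E = \int[nu]_x (l x)%:E)%E.
Proof.
move=> fphi; rewrite KL_ln; apply: ae_eq_integral => //.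
- exact/measurable_EFinP.
- exact: measurable_int intl.
have numu : nu `<< mu.
  apply/null_content_dominatesP => A mA A0; rewrite nuE//.
  by apply: null_set_integral => //; apply/measurable_EFinP/measurable_funTS.
have fphi' : {ae nu, forall x, f x = phi x}.
  have [N [mN N0 HN]] := fphi; exists N; split => //.
  by move/null_content_dominatesP : numu; apply.
by apply: filterS2 fphi' phil => x fx px _; rewrite /a fx px expRK.
Qed.

End gibbs.

(** * The unit square *)

Section plane.
Context {R : realType}.
Notation mR := (measurableTypeR R).
Notation plane := (mR * mR)%type.
Notation lam := (@lebesgue_measure R).
Notation U := (@uniform01 R).
Notation u := (@uniform_square R).
Local Open Scope ereal_scope.

(** The distribution function of the uniform law, equal to [x] clamped to
    [[0, 1]]. Functions on the square are extended to the plane through it,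
    which avoids restricting integrals to the square. *)
Definition ucdf (x : mR) : mR := mcdf U x.

Lemma uniform01T : U setT = 1%:E. Proof. exact: probability_setT. Qed.

Lemma ucdfE x : (ucdf x)%:E = U (lray x).
Proof. by rewrite /ucdf (mcdfE uniform01T). Qed.

Lemma ucdf_id (x : R) : (0 <= x <= 1)%R -> ucdf x = x.
Proof. by move=> x01; apply: EFin_inj; rewrite ucdfE uniform01_lray. Qed.

Lemma ucdf_ge0 x : (0 <= ucdf x)%R. Proof. exact: mcdf_ge0 uniform01T x. Qed.
Lemma ucdf_le1 x : (ucdf x <= 1)%R. Proof. exact: mcdf_le uniform01T x. Qed.
Lemma ucdf_nd : {homo ucdf : x y / (x <= y)%R}.
Proof. exact: mcdf_nd uniform01T. Qed.

Lemma ucdf_le0 (x : R) : (x <= 0)%R -> ucdf x = 0%R.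
Proof.
move=> x0; apply/eqP; rewrite eq_le ucdf_ge0 andbT.
by rewrite -[leRHS](@ucdf_id 0%R) ?lexx ?ler01//; exact: ucdf_nd.
Qed.

Lemma ucdf_ge1 (x : R) : (1 <= x)%R -> ucdf x = 1%R.
Proof.
move=> x0; apply/eqP; rewrite eq_le ucdf_le1 /=.
by rewrite -[leLHS](@ucdf_id 1%R) ?lexx ?ler01//; exact: ucdf_nd.
Qed.

Lemma ucdf_lip x y : (`|ucdf x - ucdf y| <= `|x - y|)%R.
Proof.
wlog xy : x y / (y <= x)%R.
  by move=> H; case: (leP y x) => [/H//|/ltW/H]; rewrite distrC [X in (_ <= X)%R -> _]distrC.
have [x0|x0] := leP x 0%R.
  by rewrite !ucdf_le0 ?(le_trans xy)// subrr normr0.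
have [y0|y0] := leP y 0%R; have [x1|x1] := leP x 1%R.
- by rewrite (ucdf_le0 y0) ucdf_id ?(ltW x0)// subr0 !ger0_norm; lra.
- by rewrite (ucdf_le0 y0) ucdf_ge1 ?(ltW x1)// subr0 !ger0_norm; lra.
- by rewrite !ucdf_id// ?(ltW x0) ?(ltW y0)//= (le_trans xy).
- rewrite (ucdf_ge1 (ltW x1)); have [y1|y1] := leP y 1%R.
    by rewrite ucdf_id ?(ltW y0)// !ger0_norm; lra.
  by rewrite (ucdf_ge1 (ltW y1)) subrr normr0.
Qed.

Lemma measurable_ucdf : measurable_fun setT ucdf.
Proof. exact: measurable_mcdf uniform01T. Qed.

Lemma integral_ucdf (psi : mR -> \bar R) : measurable_fun setT psi ->
  (forall x, 0 <= psi x) ->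
  \int[U]_x psi (ucdf x) = \int[lam]_(x in `[0%R, 1%R]) psi x.
Proof. by move=> mp p0; apply: (integral_mcdf uniform01T) => //; exact: uniform01_set1. Qed.

Lemma integral_u12 (F : plane -> \bar R) : measurable_fun setT F ->
  (forall z, 0 <= F z) -> \int[u]_z F z = \int[U]_x \int[U]_y F (x, y).
Proof. by move=> mF F0; rewrite [LHS](fubini_tonelli1 F mF F0). Qed.

Lemma integral_u21 (F : plane -> \bar R) : measurable_fun setT F ->
  (forall z, 0 <= F z) -> \int[u]_z F z = \int[U]_y \int[U]_x F (x, y).
Proof. by move=> mF F0; rewrite integral_u12//; exact: fubini_tonelli. Qed.

Lemma measurable_int1 d1 d2 (T1 : measurableType d1) (T2 : measurableType d2)
    (m : {sigma_finite_measure set T2 -> \bar R}) (F : T1 * T2 -> \bar R) :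
  measurable_fun setT F -> (forall z, 0 <= F z) ->
  measurable_fun setT (fun x => \int[m]_y F (x, y)).
Proof. by move=> mF F0; exact: measurable_fun_fubini_tonelli_F. Qed.

Lemma measurable_int2 d1 d2 (T1 : measurableType d1) (T2 : measurableType d2)
    (m : {sigma_finite_measure set T1 -> \bar R}) (F : T1 * T2 -> \bar R) :
  measurable_fun setT F -> (forall z, 0 <= F z) ->
  measurable_fun setT (fun y => \int[m]_x F (x, y)).
Proof. by move=> mF F0; exact: measurable_fun_fubini_tonelli_G. Qed.

Lemma integral_lray1 (psi : mR -> \bar R) : measurable_fun setT psi -> (forall t, 0 <= psi t) ->
  \int[U]_t psi t = \int[U]_(t in lray 1%R) psi t.
Proof.
move=> mpsi psi0.
rewrite -(setUv (lray (1%R : R))) ge0_integral_setU//; last 4 first.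
- exact: measurable_lray.
- by apply: measurableC; exact: measurable_lray.
- by rewrite setUv.
- by apply/disj_setPS; rewrite setICr.
rewrite [X in _ + X](_ : _ = 0) ?adde0//.
apply: null_set_integral => //.
- by apply: measurableC; exact: measurable_lray.
- exact: measurable_funTS.
- transitivity (lam (~` lray (1%R : R) `&` `[0%R, 1%R]%classic)).
    by apply: uniform01E; apply: measurableC; exact: measurable_lray.
  rewrite (_ : _ `&` _ = set0) ?measure0//.
  apply/seteqP; split => // y [/= h]; rewrite in_itv/= => /andP[_ h'].
  by case: h.
Qed.

Lemma measurable_quadrant x y : measurable (lray x `*` lray y : set plane).
Proof. by apply: measurableX; exact: measurable_lray. Qed.

(** One factor is treated at a time: the measure of [A `*` lray y], as a function
    of [A], is determined by the half-lines, and then so is that of [A `*` B] as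
    a function of [B]. Rectangles generate and are stable under intersection. *)
Lemma measure_eq_quadrant (m1 m2 : probability plane R) :
  (forall x y : R, m1 (lray x `*` lray y) = m2 (lray x `*` lray y)) ->
  forall A, measurable A -> m1 A = m2 A.
Proof.
move=> H.
have step1 (y : R) (A : set mR) : measurable A -> m1 (A `*` lray y) = m2 (A `*` lray y).
  have mD : measurable ([set z : plane | lray y z.2]).
    by rewrite -[X in measurable X]setTI; apply: measurable_snd => //; exact: measurable_lray.
  have E (m : probability plane R) (B : set mR) :
      m (B `*` lray y) = pushforward (mrestr m mD) fst B.
    rewrite /pushforward /mrestr.
    by have -> : fst @^-1` B `&` [set z : plane | lray y z.2] = B `*` lray y.
  pose p (m : probability plane R) : {measure set mR -> \bar R} :=
    @measure_function_pushforward__canonical__measure_function_Measure _ _ plane mR _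
      (mrestr m mD) fst measurable_fst.
  move=> mA; rewrite !E; apply: (@measure_eq_lray _ (p m1) (p m2)) => //.
    by move=> x; rewrite /= -!E.
  move=> x; rewrite /= -E; apply: (le_lt_trans (probability_le1 _ _)); last exact: ltry.
  exact: measurable_quadrant.
have step2 (A B : set mR) : measurable A -> measurable B -> m1 (A `*` B) = m2 (A `*` B).
  move=> mA; have mD : measurable ([set z : plane | A z.1]).
    by rewrite -[X in measurable X]setTI; apply: measurable_fst.
  have E (m : probability plane R) (B' : set mR) :
      m (A `*` B') = pushforward (mrestr m mD) snd B'.
    rewrite /pushforward /mrestr.
    have -> // : snd @^-1` B' `&` [set z : plane | A z.1] = A `*` B'.
    by rewrite predeqE => z; split=> -[].
  pose p (m : probability plane R) : {measure set mR -> \bar R} :=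
    @measure_function_pushforward__canonical__measure_function_Measure _ _ plane mR _
      (mrestr m mD) snd measurable_snd.
  move=> mB; rewrite !E; apply: (@measure_eq_lray _ (p m1) (p m2)) => //.
    by move=> x; rewrite /= -!E; exact: step1.
  move=> x; rewrite /= -E; apply: (le_lt_trans (probability_le1 _ _)); last exact: ltry.
  by apply: measurableX => //; exact: measurable_lray.
pose Cr : set (set plane) :=
  [set C | exists A, measurable A /\ exists B, measurable B /\ C = A `*` B].
move=> X mX; apply: (@measure_unique _ _ _ Cr (fun _ => setT)) => //.
- rewrite measurable_prod_measurableType //; congr (<<s _ >>).
  rewrite predeqE; split => [[A mA [B mB <-]]|[A [mA [B [mB ->]]]]].
    by exists A; split => //; exists B.
  by exists A => //; exists B.
- move=> /= _ _ [X1 [mX1 [X2 [mX2 ->]]]] [Y1 [mY1 [Y2 [mY2 ->]]]].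
  rewrite -setXI; exists (X1 `&` Y1); split; first exact: measurableI.
  by exists (X2 `&` Y2); split => //; exact: measurableI.
- by move=> n; exists setT; split => //; exists setT; split => //; rewrite setXTT.
- by apply/seteqP; split => // z _; exists 0%N.
- by move=> _ [A1 [mA1 [A2 [mA2 ->]]]]; exact: step2.
- by move=> k; rewrite /= probability_setT ltry.
Qed.

End plane.

(** * Distribution functions of permutons *)

Section permuton_cdf.
Context {R : realType}.
Notation mR := (measurableTypeR R).
Notation plane := (mR * mR)%type.
Notation lam := (@lebesgue_measure R).
Notation U := (@uniform01 R).
Local Open Scope ereal_scope.
Variable mu : probability plane R.
Hypothesis pmu : permuton mu.

Definition pcdf (x y : mR) : mR := fine (mu (lray x `*` lray y)).

Lemma pcdfE x y : (pcdf x y)%:E = mu (lray x `*` lray y).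
Proof. by rewrite fineK// fin_num_measure//; exact: measurable_quadrant. Qed.

Lemma permuton_fst A : measurable A -> mu (A `*` setT) = U A.
Proof.
by move=> mA; have [_ + _] := pmu => /(_ _ mA) <-; congr (mu _); apply/seteqP; split => z //= [].
Qed.

Lemma permuton_snd A : measurable A -> mu (setT `*` A) = U A.
Proof.
by move=> mA; have [_ _] := pmu => /(_ _ mA) <-; congr (mu _); apply/seteqP; split => z //= [].
Qed.

Lemma integral_fst (psi : mR -> \bar R) : measurable_fun setT psi ->
  (forall x, 0 <= psi x) -> \int[mu]_z psi z.1 = \int[U]_x psi x.
Proof.
move=> mp p0; have := @ge0_integral_pushforward _ _ _ _ R _ measurable_fst mu setT psi measurableT mp (fun x _ => p0 x).
rewrite preimage_setT => <-; apply: eq_measure_integral => A mA _.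
by have [_ h _] := pmu; exact: h.
Qed.

Lemma integral_snd (psi : mR -> \bar R) : measurable_fun setT psi ->
  (forall x, 0 <= psi x) -> \int[mu]_z psi z.2 = \int[U]_x psi x.
Proof.
move=> mp p0; have := @ge0_integral_pushforward _ _ _ _ R _ measurable_snd mu setT psi measurableT mp (fun x _ => p0 x).
rewrite preimage_setT => <-; apply: eq_measure_integral => A mA _.
by have [_ _ h] := pmu; exact: h.
Qed.

Lemma pcdf_ge0 x y : (0 <= pcdf x y)%R. Proof. exact: fine_ge0. Qed.

Lemma pcdf_le_fst x y : (pcdf x y <= ucdf x)%R.
Proof.
rewrite -lee_fin pcdfE ucdfE -permuton_fst; last exact: measurable_lray.
apply: le_measure; rewrite ?inE; [exact: measurable_quadrant| |].
  by apply: measurableX => //; exact: measurable_lray.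
by move=> z [].
Qed.

Lemma pcdf_le_snd x y : (pcdf x y <= ucdf y)%R.
Proof.
rewrite -lee_fin pcdfE ucdfE -permuton_snd; last exact: measurable_lray.
apply: le_measure; rewrite ?inE; [exact: measurable_quadrant| |].
  by apply: measurableX => //; exact: measurable_lray.
by move=> z [].
Qed.

Lemma pcdf_nd1 x x' y : (x <= x')%R -> (pcdf x y <= pcdf x' y)%R.
Proof.
move=> xx; rewrite -lee_fin !pcdfE; apply: le_measure; rewrite ?inE; try exact: measurable_quadrant.
by move=> z [h1 h2]; split => //; exact: le_trans xx.
Qed.

(** The difference of the quadrants lies in a vertical strip, whose measure is
    given by the uniform marginal. *)
Lemma pcdf_lip1 x x' y : (x <= x')%R -> (pcdf x' y - pcdf x y <= ucdf x' - ucdf x)%R.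
Proof.
move=> xx; suff : (pcdf x' y + ucdf x <= pcdf x y + ucdf x')%R by lra.
have mL := @measurable_lray R.
rewrite -lee_fin !EFinD !pcdfE !ucdfE -!permuton_fst//.
have mT t : measurable (lray t `*` setT : set plane) by apply: measurableX.
have mD : measurable ((lray x' `*` setT) `\` (lray x `*` setT) : set plane) by exact: measurableD.
have E1 : mu (lray x' `*` setT) = mu (lray x `*` setT) + mu ((lray x' `*` setT) `\` (lray x `*` setT)).
  rewrite -measureU//; last by rewrite setDE setICA setICr setI0.
  congr (mu _); rewrite setDUK// => z [h1 h2]; split => //; exact: le_trans xx.
have E2 : mu (lray x' `*` lray y) <= mu (lray x `*` lray y) + mu ((lray x' `*` setT) `\` (lray x `*` setT)).
  apply: le_trans (measureU2 _ _ _) => //; last exact: measurable_quadrant.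
  apply: le_measure; rewrite ?inE; first exact: measurable_quadrant.
    by apply: measurableU => //; exact: measurable_quadrant.
  move=> z [h1 h2]; have [h|h] := leP z.1 x; first by left.
  by right; split => // -[]; rewrite /lray/= leNgt h.
by rewrite E1 addeCA [leLHS]addeC; exact: leeD2l.
Qed.

Lemma pcdf_cont1 y : continuous (fun x : R => pcdf x y : R).
Proof.
apply: (@lipschitz_continuous R _ 1) => x x'; rewrite mul1r.
have := ucdf_lip x' x.
have [xx|xx] := leP x x'.
  have := pcdf_lip1 y xx; have := pcdf_nd1 y xx; have := ucdf_nd xx.
  by move=> h1 h2 h3 h4; rewrite ger0_norm; [|lra]; move: h4; rewrite ger0_norm; lra.
have := pcdf_lip1 y (ltW xx); have := pcdf_nd1 y (ltW xx); have := ucdf_nd (ltW xx).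
by move=> h1 h2 h3 h4; rewrite ler0_norm; [|lra]; move: h4; rewrite ler0_norm; lra.
Qed.

Lemma pcdf_ge1_snd x y : (1 <= y)%R -> pcdf x y = ucdf x.
Proof.
move=> y1; apply/eqP; rewrite eq_le pcdf_le_fst /= -lee_fin pcdfE ucdfE -permuton_fst; last exact: measurable_lray.
have mL := @measurable_lray R.
have mC : measurable (setT `*` ~` lray y : set plane) by apply: measurableX => //; apply: measurableC.
have z : mu (setT `*` ~` lray y) = 0.
  rewrite permuton_snd; last exact: measurableC.
  have := probability_setC U (mL y); rewrite -ucdfE ucdf_ge1// => ->.
  by rewrite -EFinB subrr.
apply: (@le_trans _ _ (mu ((lray x `*` lray y) `|` (setT `*` ~` lray y)))).
  apply: le_measure; rewrite ?inE.
  - exact: measurableX.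
  - by apply: measurableU => //; exact: measurable_quadrant.
  - by move=> [a b] [h1 _]; have [h|h] := leP b y; [left|right]; split => //=; rewrite /lray/= leNgt h.
apply: le_trans (measureU2 _ _ _) _ => //; first exact: measurable_quadrant.
by rewrite [X in _ + X]z adde0.
Qed.

Lemma pcdf_ge1_fst x y : (1 <= x)%R -> pcdf x y = ucdf y.
Proof.
move=> y1; apply/eqP; rewrite eq_le pcdf_le_snd /= -lee_fin pcdfE ucdfE -permuton_snd; last exact: measurable_lray.
have mL := @measurable_lray R.
have mC : measurable (~` lray x `*` setT : set plane) by apply: measurableX => //; apply: measurableC.
have z : mu (~` lray x `*` setT) = 0.
  rewrite permuton_fst; last exact: measurableC.
  have := probability_setC U (mL x); rewrite -ucdfE ucdf_ge1// => ->.
  by rewrite -EFinB subrr.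
apply: (@le_trans _ _ (mu ((lray x `*` lray y) `|` (~` lray x `*` setT)))).
  apply: le_measure; rewrite ?inE.
  - exact: measurableX.
  - by apply: measurableU => //; exact: measurable_quadrant.
  - by move=> [a b] [_ h1]; have [h|h] := leP a x; [left|right]; split => //=; rewrite /lray/= leNgt h.
apply: le_trans (measureU2 _ _ _) _ => //; first exact: measurable_quadrant.
by rewrite [X in _ + X]z adde0.
Qed.

(** The value at [z] is the integral over [w] of the indicator of the event that
    [w] lies below [z] in both coordinates, a measurable function of the pair. *)
Lemma measurable_pcdf : measurable_fun setT (fun z : plane => pcdf z.1 z.2).
Proof.
pose F (p : plane * plane) : \bar R :=
  if ((p.2.1 : R) <= p.1.1)%R && ((p.2.2 : R) <= p.1.2)%R then 1 else 0.
have mF : measurable_fun setT F.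
  apply: measurable_fun_ifT => //; apply: measurable_and; apply: measurable_fun_ler.
  - exact: (measurableT_comp measurable_fst measurable_snd).
  - exact: (measurableT_comp measurable_fst measurable_fst).
  - exact: (measurableT_comp measurable_snd measurable_snd).
  - exact: (measurableT_comp measurable_snd measurable_fst).
have E z : (pcdf z.1 z.2)%:E = \int[mu]_w F (z, w).
  rewrite pcdfE -[lray _ `*` _]setIT -integral_indic//; last exact: measurable_quadrant.
  apply: eq_integral => w _; rewrite indicE /F/=.
  case: ifP => [/andP[h1 h2]|h]; first by rewrite mem_set.
  by rewrite memNset// => -[h1 h2]; move: h; rewrite [X in X && _]h1 [X in _ && X]h2.
apply/measurable_EFinP; rewrite /comp; under eq_fun do rewrite E.
apply: measurable_int1 => // p; by rewrite /F; case: ifP.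
Qed.

End permuton_cdf.

(** * Random variables with uniform law *)

Section uniform_rv.
Context {R : realType}.
Notation mR := (measurableTypeR R).
Notation lam := (@lebesgue_measure R).
Notation U := (@uniform01 R).
Local Open Scope ereal_scope.

(** [- ln t] made nonnegative outside [[0, 1]], because integrals of uniform
    random variables are first known for nonnegative functions. *)
Definition neglog (t : mR) : \bar R := (Num.max 0%R (- ln t)%R)%:E.

Lemma measurable_neglog : measurable_fun setT neglog.
Proof.
apply/measurable_EFinP; apply: measurable_maxr => //.
by apply: (measurableT_comp (f := @GRing.opp R)) => //; exact: measurable_ln.
Qed.

Lemma neglog_ge0 t : 0 <= neglog t. Proof. by rewrite lee_fin le_max lexx. Qed.

(** A primitive of [- ln t] is [t - t * ln t]; its increments on [[a, 1]] are at
    most [1], and monotone convergence lets [a] decrease to [0]. *)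
Lemma integral_neglog_lty : \int[lam]_(t in `[0%R, 1%R]) neglog t < +oo.
Proof.
rewrite -integral_itv_obnd_cbnd; last by apply: measurable_funTS; exact: measurable_neglog.
pose F (n : nat) : set mR := `[(n.+2%:R^-1)%R, 1%R]%classic.
have FE : `]0%R, 1%R]%classic = \bigcup_n F n.
  apply/seteqP; split => t; rewrite /F /= ?in_itv/=.
    move=> /andP[t0 t1]; exists (Num.bound t^-1) => //=; rewrite in_itv/= t1 andbT.
    rewrite invf_ple ?posrE ?ltr0n//; apply/ltW.
    apply: lt_le_trans (archi_boundP _) _; first by rewrite invr_ge0 ltW.
    by rewrite ler_nat; apply: leqW.
  move=> [n _]; rewrite /= in_itv/= => /andP[t0 t1]; rewrite t1 andbT.
  by apply: lt_le_trans t0; rewrite invr_gt0.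
rewrite FE.
have H : \int[lam]_(t in F n) neglog t @[n --> \oo] --> \int[lam]_(t in \bigcup_n F n) neglog t.
  apply: ge0_nondecreasing_set_cvg_integral.
  - move=> i j ij; apply/subsetPset => t; rewrite /F/= !in_itv/= => /andP[h ->].
    by rewrite andbT (le_trans _ h)// lef_pV2 ?posrE ?ltr0n// ler_nat ltnS ltnS.
  - by move=> n; exact: measurable_itv.
  - by move=> n; apply: measurable_funTS; exact: measurable_neglog.
  - by move=> n t _; exact: neglog_ge0.
apply: (@le_lt_trans _ _ 1); last exact: ltry.
apply: (cvge_to_le H); apply: nearW => n.
set a : R := (n.+2%:R^-1)%R.
have a0 : (0 < a)%R by rewrite invr_gt0.
have a1 : (a < 1)%R by rewrite invf_lt1 ?ltr0n// ltr1n.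
pose P (t : R) : R := (t - t * ln t)%R.
have dP (t : R) : (0 < t)%R -> is_derive t 1%R P (- ln t)%R.
  move=> t0; have D := is_derive_sub (is_derive_id t 1%R)
    (is_derive_mul (is_derive_id t 1%R) (is_derive1_ln t0)).
  by apply: (is_derive_eq D); rewrite mul1r mulfV ?gt_eqF// opprD addrCA subrr addr0.
rewrite (eq_integral (fun t : mR => (- ln t)%R%:E)); last first.
  move=> t; rewrite inE /F/= in_itv/= => /andP[t0 t1].
  by rewrite /neglog (max_idPr _)// oppr_ge0 ln_le0.
rewrite (@continuous_FTC2 _ (fun t => - ln t)%R P a 1%R a1).
- rewrite -EFinB lee_fin /P ln1 mulr0 subr0.
  have : (ln a <= 0)%R by rewrite ln_le0// ltW.
  nra.
- apply: continuous_in_subspaceT => t; rewrite inE/= in_itv/= => /andP[ta _].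
  by apply: continuousN; apply: continuous_ln; exact: lt_le_trans ta.
- split.
  + by move=> t; rewrite in_itv/= => /andP[ta _]; have [] := dP t (lt_trans a0 ta).
  + by apply: cvg_at_right_filter; exact: (is_derive_cont (dP _ a0)).
  + by apply: cvg_at_left_filter; exact: (is_derive_cont (dP _ ltr01)).
- move=> t; rewrite in_itv/= => /andP[ta _].
  by rewrite derive1E; have [_ ->] := dP t (lt_trans a0 ta).
Qed.

Context d (T : measurableType d) (m : probability T R).

(** The values are required to lie in [[0, 1]] everywhere, so that bounds on
    [psi] over this interval pass to [psi (X z)] without exceptional sets. *)
Definition uniform_rv (X : T -> R) : Prop :=
  [/\ measurable_fun setT X, (forall z, 0 <= X z <= 1)%R &
      forall psi : mR -> \bar R, measurable_fun setT psi -> (forall t, 0 <= psi t) ->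
        \int[m]_z psi (X z) = \int[lam]_(t in `[0%R, 1%R]) psi t].

Variable X : T -> R.
Hypothesis uX : uniform_rv X.

Let mX : measurable_fun setT X. Proof. by case: uX. Qed.
Let X01 z : (0 <= X z <= 1)%R. Proof. by case: uX. Qed.

Lemma bounded_integrable (F : T -> R) (M : R) : measurable_fun setT F ->
  (forall z, `|F z| <= M)%R -> m.-integrable setT (EFin \o F).
Proof.
move=> mF FM; have IM := finite_measure_integrable_cst m M measurableT.
apply: (le_integrable measurableT _ _ IM); first exact/measurable_EFinP.
by move=> z _; rewrite /= lee_fin (le_trans (FM z))// ler_norm.
Qed.

(** A bounded [psi] becomes nonnegative by adding a constant. *)
Lemma uniform_rv_Rintegral (psi : R -> R) (M : R) : measurable_fun setT psi ->
  (forall t, 0 <= t <= 1 -> `|psi t| <= M)%R ->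
  (\int[m]_z psi (X z))%R = (\int[lam]_(t in `[0%R, 1%R]) psi t)%R.
Proof.
move=> mpsi pM.
pose Psi (t : mR) : \bar R := (Num.max 0%R (psi t + M)%R)%:E.
have PsiE t : (0 <= t <= 1)%R -> Psi t = (psi t + M)%:E.
  move=> /pM; rewrite ler_norml => /andP[h _]; rewrite /Psi (max_idPr _)//.
  by rewrite -lerBlDr sub0r.
have mPsi : measurable_fun setT Psi.
  apply/measurable_EFinP; apply: measurable_maxr => //.
  by apply: measurable_funD.
have [_ _ /(_ Psi mPsi)] := uX.
move=> /(_ (fun t => _)) E.
have {}E : \int[m]_z Psi (X z) = \int[lam]_(t in `[0%R, 1%R]) Psi t.
  by apply: E => t; rewrite lee_fin le_max lexx.
have I1 : m.-integrable setT (EFin \o (fun z => psi (X z))).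
  apply: (@bounded_integrable _ M); first exact: measurableT_comp.
  by move=> z; exact: pM.
have I2 : lam.-integrable `[0%R, 1%R] (EFin \o psi).
  apply: (le_integrable _ _ _ (integrable_cst01 M)) => //.
    by apply/measurable_EFinP; exact: measurable_funTS.
  by move=> t; rewrite /= in_itv/= => /pM h; rewrite lee_fin (le_trans h)// ler_norm.
move: E; rewrite (eq_integral (fun z => ((psi (X z) + M)%:E))); last first.
  by move=> z _; rewrite PsiE.
rewrite [RHS](eq_integral (fun t : mR => ((psi t + M)%:E))); last first.
  by move=> t; rewrite inE/= in_itv/= => h; rewrite PsiE.
move=> /(congr1 fine).
rewrite -[LHS]/(\int[m]_z (psi (X z) + M))%R -[RHS]/(\int[lam]_(t in `[0%R, 1%R]) (psi t + M))%R.
rewrite RintegralD//; last exact: finite_measure_integrable_cst.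
rewrite RintegralD//; last exact: (integrable_cst01 M).
rewrite !Rintegral_cst//.
rewrite [X in (_ + _ * fine X)%R = _ -> _](_ : _ = 1); last exact: probability_setT.
rewrite [X in _ = (_ + _ * fine X)%R -> _](_ : _ = 1); last exact: lebesgue01.
by move=> /addIr.
Qed.

Lemma uniform_rv_gt0 : {ae m, forall z, (0 < X z)%R}.
Proof.
exists (X @^-1` [set 0%R]); split.
- by rewrite -[X in measurable X]setTI; exact: mX.
- pose psi (t : mR) : \bar R := (\1_[set 0%R] t)%:E.
  have [_ _ /(_ psi)] := uX.
  have mpsi : measurable_fun setT psi.
    by apply/measurable_EFinP; exact: measurable_indic.
  move=> /(_ mpsi (fun t => _)) H.
  have {}H : \int[m]_z psi (X z) = \int[lam]_(t in `[0%R, 1%R]) psi t.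
    by apply: H => t; rewrite lee_fin.
  move: H; rewrite [RHS]integral_indic// => H.
  have {}H : \int[m]_z (\1_(X @^-1` [set 0%R]) z)%:E = lam ([set 0%R] `&` `[0%R, 1%R]).
    by rewrite -H.
  move: H; rewrite integral_indic ?setIT//; last by rewrite -[X in measurable X]setTI; exact: mX.
  move=> ->; apply/eqP; rewrite -measure_le0 -(lebesgue_measure_set1 (0%R : R)).
  by apply: le_measure; rewrite ?inE//; apply: measurableI => //; exact: measurable_itv.
- move=> z /= /negP; rewrite -leNgt => h; apply/eqP; rewrite eq_le h /=.
  by have /andP[] := X01 z.
Qed.

Let neglogE z : neglog (X z) = (- ln (X z))%:E.
Proof. by rewrite /neglog (max_idPr _)// oppr_ge0 ln_le0//; have /andP[] := X01 z. Qed.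

Lemma uniform_rv_integrable_ln : m.-integrable setT (EFin \o (fun z => ln (X z))).
Proof.
have mln : measurable_fun setT (fun z => ln (X z)).
  by apply: (measurableT_comp (f := @ln R)) => //; exact: measurable_ln.
apply/integrableP; split; first exact/measurable_EFinP.
rewrite (eq_integral (fun z => neglog (X z))); last first.
  move=> z _; rewrite neglogE /= ler0_norm// ln_le0//; by have /andP[] := X01 z.
have [_ _ ->] := uX; [exact: integral_neglog_lty|exact: measurable_neglog|exact: neglog_ge0].
Qed.

(** The right-hand side does not depend on [X], so that the mean logarithms of
    two uniform random variables cancel. *)
Lemma uniform_rv_Rintegral_ln :
  (\int[m]_z ln (X z))%R = (- fine (\int[lam]_(t in `[0%R, 1%R]) neglog t))%R.
Proof.
have [_ _ H] := uX; rewrite -H; [|exact: measurable_neglog|exact: neglog_ge0].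
rewrite (eq_integral (fun z => (-1 * ln (X z))%:E)); last first.
  by move=> z _; rewrite neglogE mulN1r.
rewrite -[fine _]/(\int[m]_z (-1 * ln (X z)))%R RintegralZl// ?mulN1r ?opprK//.
exact: uniform_rv_integrable_ln.
Qed.

End uniform_rv.

(** * Densities of permutons *)

Section density_of_permuton.
Context {R : realType}.
Notation mR := (measurableTypeR R).
Notation plane := (mR * mR)%type.
Notation lam := (@lebesgue_measure R).
Notation U := (@uniform01 R).
Notation u := (@uniform_square R).
Local Open Scope ereal_scope.
Variable mu : probability plane R.

Lemma density_dominates (f : plane -> R) : measurable_fun setT f ->
  (forall A, measurable A -> mu A = \int[u]_(z in A) (f z)%:E) -> mu `<< u.
Proof.
move=> mf muE; apply/null_content_dominatesP => A mA A0; rewrite muE//.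
by apply: null_set_integral => //; apply/measurable_EFinP/measurable_funTS.
Qed.

Lemma KL_density (f : plane -> R) : measurable_fun setT f -> (forall z, 0 <= f z)%R ->
  (forall A, measurable A -> mu A = \int[u]_(z in A) (f z)%:E) ->
  KL mu u = \int[mu]_z lne (f z)%:E.
Proof.
move=> mf f0 muE; have muu := density_dominates mf muE.
rewrite /KL asboolT//; set rn := Radon_Nikodym _ _.
have rnfin z : rn z \is a fin_num by exact: Radon_Nikodym_fin_num.
have mrn : measurable_fun setT rn by apply: measurable_int; exact: Radon_Nikodym_integrable.
have mlne (k : plane -> R) : measurable_fun setT k -> measurable_fun setT (fun z => lne (k z)%:E).
  move=> mk; rewrite (_ : (fun x => lne _) = fun x => if (k x <= 0)%R then -oo else (ln (k x))%:E).
    apply: measurable_fun_ifT => //; first exact: measurable_fun_ler.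
    apply/measurable_EFinP; apply: (measurableT_comp (f := @ln R)) => //; exact: measurable_ln.
  apply/funext => x; case: leP => fx; first by rewrite le0_lneNy// lee_fin.
  by rewrite lne_EFin.
apply: ae_eq_integral => //.
- rewrite (_ : (fun z => _) = fun z => lne (fine (rn z))%:E); last first.
    by apply/funext => z; rewrite fineK.
  by apply: mlne; apply: (measurableT_comp (f := fine)) => //; exact: measurable_fine.
- exact: mlne.
have E : ae_eq u setT rn (EFin \o f).
  apply: integral_ae_eq => //.
  - exact: Radon_Nikodym_integrable.
  - exact/measurable_EFinP.
  - by move=> A _ mA; rewrite -Radon_Nikodym_integral// -muE.
have [N [mN N0 HN]] := E; exists N; split => //.
  by move/null_content_dominatesP : muu; apply.
by move=> z /= h; apply: HN => /= h'; apply: h => _; rewrite h'.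
Qed.

(** The second marginal gives the normalisation of the rows [y] for almost all
    [y] only; on the exceptional rows, which form a null set, the density is
    replaced by [1]. Having it for all [y] makes each row a probability law. *)
Lemma permuton_density : permuton mu -> mu `<< u ->
  exists f : plane -> R, [/\ measurable_fun setT f, (forall z, 0 <= f z)%R,
    (forall A, measurable A -> mu A = \int[u]_(z in A) (f z)%:E) &
    (forall y, \int[U]_x (f (x, y))%:E = 1)].
Proof.
move=> pmu muu; pose r := Radon_Nikodym_SigmaFinite.f mu u.
pose f0 z : R := fine (r z).
have rfin z : r z \is a fin_num by exact: Radon_Nikodym_SigmaFinite.f_fin_num.
have rE z : (f0 z)%:E = r z by rewrite fineK.
have mr : measurable_fun setT r.
  by apply: measurable_int; exact: Radon_Nikodym_SigmaFinite.f_integrable.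
have mf0 : measurable_fun setT f0.
  by apply: (measurableT_comp (f := fine)) => //; exact: measurable_fine.
have f00 z : (0 <= f0 z)%R by rewrite fine_ge0// Radon_Nikodym_SigmaFinite.f_ge0.
have ef0 z : 0 <= (f0 z)%:E by rewrite lee_fin.
have mef0 : measurable_fun setT (EFin \o f0) by exact/measurable_EFinP.
have muE0 A : measurable A -> mu A = \int[u]_(z in A) (f0 z)%:E.
  move=> mA; rewrite (Radon_Nikodym_SigmaFinite.f_integral muu)//.
  by apply: eq_integral => z _; rewrite rE.
pose S (y : mR) : \bar R := \int[U]_x (f0 (x, y))%:E.
have mS : measurable_fun setT S by exact: (measurable_int2 U mef0 ef0).
have S1 : ae_eq U setT (cst 1) S.
  apply: integral_ae_eq => //.
  - exact: finite_measure_integrable_cst.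
  - move=> B _ mB; transitivity (mu (setT `*` B)).
      by rewrite permuton_snd// integral_cst// mul1e.
    rewrite muE0; last exact: measurableX.
    rewrite [LHS]integral_mkcond integral_u21//; last 2 first.
    + apply/(measurable_restrictT (fun z : plane => (f0 z)%:E)); first exact: measurableX.
      exact: measurable_funTS.
    + by move=> z; rewrite patchE; case: ifP.
    rewrite [RHS]integral_mkcond; apply: eq_integral => y _; rewrite patchE.
    case: ifPn => yB.
      apply: eq_integral => x _; rewrite patchE ifT//.
      by rewrite inE; split => //=; rewrite inE in yB.
    apply: integral0_eq => x _; rewrite patchE ifN//.
    by rewrite notin_setE => -[_ /=]; rewrite notin_setE in yB.
pose B : set mR := S @^-1` [set 1].
have mB : measurable B by rewrite -[B]setTI; apply: mS.
have UB : U (~` B) = 0.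
  have [N [mN N0 HN]] := S1; apply: (subset_measure0 _ mN _ N0); first exact: measurableC.
  by move=> y By; apply: HN => /= /(_ I) h; apply: By; rewrite /B/= -h.
pose b (z : plane) : bool := S z.2 == 1.
have mb : measurable_fun setT b.
  apply: (measurable_fun_bool true).
  rewrite (_ : _ `&` _ = snd @^-1` B).
    by rewrite -[X in measurable X]setTI; apply: measurable_snd.
  by apply/seteqP; split => z /=; [move=> [_ /eqP]|move=> h; split => //; apply/eqP].
pose f z : R := if b z then f0 z else 1%R.
have mf : measurable_fun setT f by exact: measurable_fun_ifT.
have fE : ae_eq u setT (EFin \o f0) (EFin \o f).
  exists (setT `*` ~` B); split.
  - by apply: measurableX => //; exact: measurableC.
  - have mBc : measurable (~` B) by exact: measurableC.
    by have := product_measure1E U U measurableT mBc; rewrite [X in _ * X]UB mule0.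
  - move=> [x y] /= h; split => // By; apply: h => _ /=.
    by rewrite /f /b/= ifT//; apply/eqP.
exists f; split => //.
- by move=> z; rewrite /f; case: ifP.
- move=> A mA; rewrite muE0//; apply: ae_eq_integral => //.
  + exact: measurable_funTS.
  + by apply: measurable_funTS; exact/measurable_EFinP.
  + exact: ae_eq_subset fE.
- move=> y; have [Sy|Sy] := eqVneq (S y) 1.
    by rewrite -[RHS]Sy; apply: eq_integral => x _; rewrite /f /b/= Sy eqxx.
  rewrite (eq_integral (cst 1)); last by move=> x _; rewrite /f /b/= (negbTE Sy).
  by rewrite integral_cst// mul1e; exact: uniform01T.
Qed.

End density_of_permuton.

(** * The exponential primitive *)

Section texp.
Context {R : realType}.
Implicit Types theta t : R.
Notation lam := (@lebesgue_measure R).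

(** The integral of [expR (theta * s)] over [[0, t]]. It treats [theta = 0] on
    the same footing as the other parameters. *)
Definition texp theta t : R :=
  if theta == 0 then t else (expR (theta * t) - 1) / theta.

Lemma texp0 theta : texp theta 0 = 0.
Proof. by rewrite /texp; case: ifP => // _; rewrite mulr0 expR0 subrr mul0r. Qed.

Lemma texp_expR theta t : 1 + theta * texp theta t = expR (theta * t).
Proof.
rewrite /texp; case: eqVneq => [->|t0]; first by rewrite !mul0r expR0 addr0.
by field.
Qed.

Lemma is_derive_texp theta t : is_derive t 1 (texp theta) (expR (theta * t)).
Proof.
rewrite /texp; case: eqVneq => [->|t0].
  by rewrite mul0r expR0; exact: is_derive_id.
have H := @is_derive_mul R _ _ _ _ _ (@is_derive_sub R _ _ _ _ _ (@is_derive_cexp R theta t) (is_derive_const 1 t)) (is_derive_const theta^-1 t).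
by apply: (is_derive_eq H); rewrite subr0 mulr0 addr0; field.
Qed.

Lemma continuous_texp theta : continuous (texp theta).
Proof. by move=> t; exact: is_derive_cont (is_derive_texp theta t). Qed.

Lemma texp_incr theta s t : s < t -> texp theta s < texp theta t.
Proof.
move=> st; apply: (@derive_gt0_ltT R (texp theta) (fun t => expR (theta * t))) => //.
- by move=> x _; exact: expR_gt0.
- exact: is_derive_texp.
Qed.

Lemma texp_inj theta : injective (texp theta).
Proof.
move=> s t e; apply/eqP; case: ltgtP => // /(texp_incr theta); by rewrite e ltxx.
Qed.

Lemma texp_gt0 theta t : 0 < t -> 0 < texp theta t.
Proof. by move=> t0; rewrite -(texp0 theta); exact: texp_incr. Qed.

(** Substitution [s -> t - s] in the integral. *)
Lemma texpN theta t : expR (theta * t) * texp (- theta) t = texp theta t.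
Proof.
rewrite /texp oppr_eq0; case: eqVneq => [->|t0]; first by rewrite mul0r expR0 mul1r.
rewrite mulNr expRN; field.
by rewrite t0 gt_eqF ?expR_gt0.
Qed.

Lemma texp_ucgf theta t : t * expR (ucgf (theta * t)) = texp theta t.
Proof.
rewrite /texp; case: eqVneq => [->|th0]; first by rewrite mul0r ucgf0 expR0 mulr1.
have [->|t0] := eqVneq t 0; first by rewrite mulr0 expR0 subrr !mul0r.
rewrite expR_ucgf ?mulf_neq0//; field.
by rewrite th0 t0.
Qed.

Lemma FTC2_itv (F f : R -> R) (a b : R) : a <= b -> continuous f ->
  (forall x : R, is_derive x 1 F (f x)) ->
  (\int[lam]_(x in `[a, b]) (f x)%:E)%E = (F b - F a)%:E.
Proof.
move=> ab cf D; move: ab; rewrite le_eqVlt => /predU1P[->|ab].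
  rewrite subrr set_itv1; apply: null_set_integral => //.
    by apply/measurable_EFinP/measurable_funTS; exact: continuous_measurable_fun.
  exact: lebesgue_measure_set1.
rewrite (@continuous_FTC2 R f F a b ab)//.
- exact: continuous_subspaceT.
- split => [t _||].
  + by have [] := D t.
  + by apply: cvg_at_right_filter; exact: is_derive_cont (D _).
  + by apply: cvg_at_left_filter; exact: is_derive_cont (D _).
- by move=> t _; rewrite derive1E; have H := D t; exact: derive_val.
Qed.

Lemma integral_expR theta t : 0 <= t ->
  (\int[lam]_(s in `[0%R, t]) (expR (theta * s))%:E)%E = (texp theta t)%:E.
Proof.
move=> t0; rewrite (FTC2_itv t0 _ (is_derive_texp theta)); first by rewrite texp0 subr0.
by move=> s; exact: is_derive_cont (is_derive_cexp theta s).
Qed.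

End texp.

(** * Conditional distribution functions of a permuton *)

Section conditional_cdf.
Context {R : realType}.
Notation mR := (measurableTypeR R).
Notation plane := (mR * mR)%type.
Notation lam := (@lebesgue_measure R).
Notation U := (@uniform01 R).
Notation u := (@uniform_square R).
Local Open Scope ereal_scope.
Variable mu : probability plane R.
Hypothesis pmu : permuton mu.
Variable f : plane -> R.
Hypotheses (mf : measurable_fun setT f) (f0 : forall z, (0 <= f z)%R)
  (muE : forall A, measurable A -> mu A = \int[u]_(z in A) (f z)%:E)
  (fy1 : forall y, \int[U]_x (f (x, y))%:E = 1).

Let mef : measurable_fun setT (EFin \o f). Proof. exact/measurable_EFinP. Qed.

Let mfy y : measurable_fun setT (fun x => f (x, y)).
Proof. exact: measurable_fun_pair1. Qed.

(** The distribution function, at [x], of the first coordinate given that the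
    second one is [y]; it is the partial derivative of [pcdf] in [y]. *)
Definition ccdf (x y : mR) : mR := fine (\int[U]_(x' in lray x) (f (x', y))%:E).

Lemma ccdfE x y : (ccdf x y)%:E = \int[U]_(x' in lray x) (f (x', y))%:E.
Proof.
rewrite fineK// ge0_fin_numE; last by apply: integral_ge0 => t _; rewrite lee_fin.
apply: (@le_lt_trans _ _ 1); last exact: ltry.
rewrite -[leRHS](fy1 y); apply: ge0_subset_integral => //.
- exact: measurable_lray.
- by apply/measurable_EFinP; exact: mfy.
- by move=> t _; rewrite lee_fin.
Qed.

Let fyfin y : \int[U]_x (f (x, y))%:E < +oo. Proof. by rewrite fy1 ltry. Qed.

Let nuy y : {finite_measure set mR -> \bar R} :=
  mdens (mfy y) (fun x => f0 (x, y)) (fyfin y).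

Let nuyT y : nuy y setT = 1%:E. Proof. by rewrite /= /mdens fy1. Qed.

Lemma ccdf_ge0 x y : (0 <= ccdf x y)%R.
Proof. by apply: fine_ge0; apply: integral_ge0 => t _; rewrite lee_fin. Qed.

Lemma ccdf_le1 x y : (ccdf x y <= 1)%R.
Proof. exact: (mcdf_le (nuyT y)). Qed.

Lemma measurable_ccdf : measurable_fun setT (fun z : plane => ccdf z.1 z.2).
Proof.
pose F (p : plane * mR) : \bar R := if ((p.2 : R) <= p.1.1)%R then (f (p.2, p.1.2))%:E else 0.
have mF : measurable_fun setT F.
  apply: measurable_fun_ifT => //.
  - apply: measurable_fun_ler; first exact: measurable_snd.
    exact: (measurableT_comp measurable_fst measurable_fst).
  - apply/measurable_EFinP; apply: (measurableT_comp mf).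
    apply: measurable_fun_pair; first exact: measurable_snd.
    exact: (measurableT_comp measurable_snd measurable_fst).
have E z : (ccdf z.1 z.2)%:E = \int[U]_w F (z, w).
  rewrite ccdfE integral_mkcond; apply: eq_integral => w _.
  rewrite patchE /F/=; case: ifPn => h.
    by rewrite ifT//; rewrite inE in h.
  by rewrite ifN//; apply/negP => h'; move/negP: h; apply; rewrite inE.
apply/measurable_EFinP; rewrite /comp; under eq_fun do rewrite E.
by apply: measurable_int1 => // p; rewrite /F; case: ifP => // _; rewrite lee_fin.
Qed.

Let nuy1 y x : nuy y [set x] = 0.
Proof.
rewrite /= /mdens; apply: null_set_integral => //; last exact: uniform01_set1.
by apply: measurable_funTS; apply/measurable_EFinP; exact: mfy.
Qed.

(** The law of [x] given [y] has distribution function [ccdf _ y], so that this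
    is the probability integral transform. *)
Lemma integral_ccdf_row (psi : mR -> \bar R) y : measurable_fun setT psi ->
  (forall t, 0 <= psi t) ->
  \int[U]_x (psi (ccdf x y) * (f (x, y))%:E) = \int[lam]_(t in `[0%R, 1%R]) psi t.
Proof.
move=> mpsi psi0.
rewrite -(integral_mcdf (nuyT y) (nuy1 y) mpsi psi0).
rewrite (@integral_density _ _ _ U (nuy y) (fun x => f (x, y)))//.
  by apply: (measurableT_comp mpsi); exact: measurable_mcdf (nuyT y).
Qed.

(** The conditional distribution function of the first coordinate, evaluated at a
    random point of the permuton, is uniform because it is so conditionally on
    the second coordinate. *)
Lemma uniform_rv_ccdf : uniform_rv mu (fun z => ccdf z.1 z.2).
Proof.
split; first exact: measurable_ccdf.
  by move=> z; rewrite ccdf_ge0 ccdf_le1.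
move=> psi mpsi psi0.
have mpc : measurable_fun setT (fun z : plane => psi (ccdf z.1 z.2)).
  by apply: (measurableT_comp mpsi); exact: measurable_ccdf.
rewrite (@integral_density _ _ _ u mu f)// integral_u21/=; last 2 first.
- exact: emeasurable_funM.
- by move=> z; rewrite mule_ge0// lee_fin.
under eq_integral do rewrite integral_ccdf_row//.
transitivity (\int[U]_(y in setT) (cst (\int[lam]_(t in `[0%R, 1%R]) psi t) y)) => //.
rewrite integral_cst//.
by rewrite [X in _ * X](_ : _ = 1) ?mule1//; exact: probability_setT.
Qed.

Lemma uniform_rv_fst : uniform_rv mu (fun z => ucdf z.1).
Proof.
split; first exact: (measurableT_comp (@measurable_ucdf R) measurable_fst).
  by move=> z; rewrite ucdf_ge0 ucdf_le1.
move=> psi mpsi psi0; rewrite -integral_ucdf//.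
apply: (integral_fst pmu (psi := fun x => psi (ucdf x))) => //.
by apply: (measurableT_comp mpsi); exact: measurable_ucdf.
Qed.

Lemma uniform_rv_snd : uniform_rv mu (fun z => ucdf z.2).
Proof.
split; first exact: (measurableT_comp (@measurable_ucdf R) measurable_snd).
  by move=> z; rewrite ucdf_ge0 ucdf_le1.
move=> psi mpsi psi0; rewrite -integral_ucdf//.
apply: (integral_snd pmu (psi := fun x => psi (ucdf x))) => //.
by apply: (measurableT_comp mpsi); exact: measurable_ucdf.
Qed.

Lemma integral_quadrant (F : plane -> R) x y : measurable_fun setT F -> (forall z, 0 <= F z)%R ->
  \int[u]_(z in lray x `*` lray y) (F z)%:E =
  \int[U]_(y' in lray y) \int[U]_(x' in lray x) (F (x', y'))%:E.
Proof.
move=> mF F0; rewrite [LHS]integral_mkcond integral_u21; last 2 first.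
- apply/(measurable_restrictT (fun z : plane => (F z)%:E)); first exact: measurable_quadrant.
  by apply: measurable_funTS; exact/measurable_EFinP.
- by move=> z; rewrite patchE; case: ifP => // _; rewrite lee_fin.
rewrite [RHS]integral_mkcond; apply: eq_integral => y' _; rewrite patchE.
case: ifPn => hy.
  rewrite [RHS]integral_mkcond; apply: eq_integral => x' _; rewrite !patchE.
  rewrite inE in hy; case: ifPn => h; case: ifPn => h'//.
    by rewrite inE/= in h; move: h' => /negP; rewrite inE; case; case: h.
  by rewrite inE/= in h'; move: h => /negP; rewrite inE; case; split.
apply: integral0_eq => x' _; rewrite patchE ifN//.
by apply/negP; rewrite inE => -[_ /=] h; move/negP: hy; apply; rewrite inE.
Qed.

Lemma integral_quadrant12 (F : plane -> R) x y : measurable_fun setT F -> (forall z, 0 <= F z)%R ->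
  \int[u]_(z in lray x `*` lray y) (F z)%:E =
  \int[U]_(x' in lray x) \int[U]_(y' in lray y) (F (x', y'))%:E.
Proof.
move=> mF F0; rewrite [LHS]integral_mkcond integral_u12; last 2 first.
- apply/(measurable_restrictT (fun z : plane => (F z)%:E)); first exact: measurable_quadrant.
  by apply: measurable_funTS; exact/measurable_EFinP.
- by move=> z; rewrite patchE; case: ifP => // _; rewrite lee_fin.
rewrite [RHS]integral_mkcond; apply: eq_integral => x' _; rewrite patchE.
case: ifPn => hx.
  rewrite [RHS]integral_mkcond; apply: eq_integral => y' _; rewrite !patchE.
  rewrite inE in hx; case: ifPn => h; case: ifPn => h'//.
    by rewrite inE/= in h; move: h' => /negP; rewrite inE; case; case: h.
  by rewrite inE/= in h'; move: h => /negP; rewrite inE; case; split.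
apply: integral0_eq => y' _; rewrite patchE ifN//.
by apply/negP; rewrite inE => -[/= h _]; move/negP: hx; apply; rewrite inE.
Qed.

Lemma pcdf_integral_ccdf x y :
  (pcdf mu x y)%:E = \int[U]_(y' in lray y) (ccdf x y')%:E.
Proof.
rewrite pcdfE muE; last exact: measurable_quadrant.
by rewrite integral_quadrant//; apply: eq_integral => y' _; rewrite ccdfE.
Qed.

(** On the column [x] the function [pcdf mu x] is the distribution function of
    the measure with density [ccdf x]; the transform is applied to the
    restriction of this measure to [y <= y0]. *)
Lemma integral_pcdf_column (psi : mR -> \bar R) x y0 : measurable_fun setT psi ->
  (forall t, 0 <= psi t) ->
  \int[U]_(y in lray y0) (psi (pcdf mu x y) * (ccdf x y)%:E) =
  \int[lam]_(t in `[0%R, pcdf mu x y0]) psi t.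
Proof.
move=> mpsi psi0.
pose D (y : mR) : R := if ((y : R) <= y0)%R then ccdf x y else 0%R.
have mcx : measurable_fun setT (fun y => ccdf x y).
  exact: (@measurable_fun_pair2 _ _ _ _ _ _ (fun z : plane => ccdf z.1 z.2) x measurable_ccdf).
have mD : measurable_fun setT D.
  by apply: measurable_fun_ifT => //; apply: measurable_fun_ler.
have D0 y : (0 <= D y)%R by rewrite /D; case: ifP => // _; exact: ccdf_ge0.
have DE (y : R) : \int[U]_(y' in lray y) (D y')%:E = (pcdf mu x (Num.min y y0))%:E.
  rewrite pcdf_integral_ccdf [LHS]integral_mkcond [RHS]integral_mkcond.
  apply: eq_integral => y' _; rewrite !patchE /D.
  have -> : (y' \in lray (Num.min y y0)) = (y' \in lray y) && ((y' : R) <= y0)%R.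
    apply/idP/idP; first by rewrite inE /lray/= le_min => /andP[h ->]; rewrite andbT inE.
    by move=> /andP[]; rewrite !inE /lray/= le_min => -> ->.
  by case: (y' \in lray y) => //=; case: ifP.
have Dfull : \int[U]_y (D y)%:E = (pcdf mu x y0)%:E.
  rewrite pcdf_integral_ccdf [RHS]integral_mkcond; apply: eq_integral => y _.
  rewrite patchE /D; case: ifPn => h; first by rewrite ifT// inE.
  by rewrite ifN//; apply/negP; rewrite inE => h'; move/negP: h; apply.
have Dfin : \int[U]_y (D y)%:E < +oo by rewrite Dfull ltry.
pose nu : {finite_measure set mR -> \bar R} := mdens mD D0 Dfin.
have nuT : nu setT = (pcdf mu x y0)%:E by rewrite /= /mdens.
have nu1 t : nu [set t] = 0.
  rewrite /= /mdens; apply: null_set_integral => //; last exact: uniform01_set1.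
  by apply: measurable_funTS; exact/measurable_EFinP.
rewrite -(integral_mcdf nuT nu1 mpsi psi0).
have mnu : measurable_fun setT (mcdf nu) by exact: measurable_mcdf nuT.
rewrite (@integral_density _ _ _ U nu D)//; last exact: (measurableT_comp mpsi).
rewrite [LHS]integral_mkcond; apply: eq_integral => y _; rewrite patchE /D.
case: ifPn => h.
  rewrite inE in h; rewrite ifT//; congr (psi _ * _).
  by rewrite /mcdf /= /mdens DE/= (min_idPl _).
by rewrite ifN ?mule0//; apply/negP => h'; move/negP: h; apply; rewrite inE.
Qed.

End conditional_cdf.

(** * The inversion density of a permuton *)

Section inversions_of_permuton.
Context {R : realType}.
Notation mR := (measurableTypeR R).
Notation plane := (mR * mR)%type.
Notation lam := (@lebesgue_measure R).
Notation U := (@uniform01 R).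
Local Open Scope ereal_scope.
Variable mu : probability plane R.
Hypothesis pmu : permuton mu.

Let mL := @measurable_lray R.

Lemma measurable_h (p : plane) : measurable_fun setT (fun q : plane => (h p q)%:E).
Proof.
apply/measurable_EFinP.
rewrite (_ : h p = fun q => if ((p.1 - q.1) * (p.2 - q.2) < 0)%R then 1%R else 0%R); last first.
  by apply/funext => q; rewrite /h; case: ltP.
apply: measurable_fun_ifT => //; apply: measurable_fun_ltr => //.
by apply: measurable_funM; apply: measurable_funB => //.
Qed.

(** Up to the null lines through [p], a point forms an inversion with [p] if and
    only if it lies in exactly one of the half-planes to the left of [p] and
    below [p]. *)
Lemma inversion_section (p : plane) :
  \int[mu]_q (h p q)%:E = (ucdf p.1 + ucdf p.2 - 2 * pcdf mu p.1 p.2)%:E.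
Proof.
have mT x : measurable (lray x `*` setT : set plane) by exact: measurableX.
have mT' y : measurable (setT `*` lray y : set plane) by exact: measurableX.
have mQ := measurable_quadrant p.1 p.2.
pose A : set plane := (lray p.1 `*` setT) `\` (lray p.1 `*` lray p.2).
pose B : set plane := (setT `*` lray p.2) `\` (lray p.1 `*` lray p.2).
have mA : measurable A by exact: measurableD.
have mB : measurable B by exact: measurableD.
pose N : set plane := ([set p.1] `*` setT) `|` (setT `*` [set p.2]).
have mN : measurable N by apply: measurableU; exact: measurableX.
have N0 : mu N = 0.
  apply/eqP; rewrite -measure_le0; apply: le_trans (measureU2 _ _ _) _.
  - exact: measurableX.
  - exact: measurableX.
  - have h1 : mu ([set p.1] `*` setT) <= 0 by rewrite (permuton_fst pmu)// uniform01_set1.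
    have h2 : mu (setT `*` [set p.2]) <= 0 by rewrite (permuton_snd pmu)// uniform01_set1.
    by rewrite -[leRHS]adde0; exact: leeD h1 h2.
have AB0 : A `&` B = set0.
  apply/seteqP; split => // -[a b] [[[h1 _] h2] [[_ h3] _]].
  by apply: h2; split.
have finQ : mu (lray p.1 `*` lray p.2) \is a fin_num by exact: fin_num_measure.
transitivity (\int[mu]_q (\1_(A `|` B) q)%:E).
  have mh := measurable_h p.
  apply: ae_eq_integral => //.
    by apply/measurable_EFinP; apply: measurable_indic; exact: measurableU.
  exists N; split => // -[a b] /= hq; apply: contrapT => hN; apply: hq => _.
  have ap : a != p.1 by apply/eqP => e; apply: hN; left; split.
  have bp : b != p.2 by apply/eqP => e; apply: hN; right; split.
  rewrite /h indicE /=; congr (_%:R%:E).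
  have [ha|ha|ha] := ltgtP a p.1; last by rewrite ha eqxx in ap.
    have [hb|hb|hb] := ltgtP b p.2; last by rewrite hb eqxx in bp.
      rewrite memNset ?ltNge ?mulr_ge0// ?subr_ge0 ?ltW//.
      by move=> [[_]|[_]]; apply; split; rewrite /lray/= ltW.
    have -> : ((p.1 - a) * (p.2 - b) < 0)%R.
      by rewrite pmulr_rlt0 subr_cp0.
    rewrite mem_set//; left; split; first by split; rewrite /lray/= ?ltW.
    by move=> [_]; rewrite /lray/= leNgt hb.
  have [hb|hb|hb] := ltgtP b p.2; last by rewrite hb eqxx in bp.
    have -> : ((p.1 - a) * (p.2 - b) < 0)%R.
      by rewrite pmulr_llt0 subr_cp0.
    rewrite mem_set//; right; split; first by split; rewrite /lray/= ?ltW.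
    by move=> [+ _]; rewrite /lray/= leNgt ha.
  rewrite memNset ?ltNge ?mulr_le0// ?subr_le0 ?ltW//.
  by move=> [[[+ _] _]|[[_ +] _]]; rewrite /lray/= leNgt ?ha ?hb.
rewrite integral_indic ?setIT//; last exact: measurableU.
rewrite measureU// !measureD//; try exact: fin_num_measure; last 2 first.
- by rewrite -ge0_fin_numE// fin_num_measure.
- by rewrite -ge0_fin_numE// fin_num_measure.
rewrite !setIidr; try by move=> z [].
have E1 : mu (lray p.1 `*` [set: mR]) = (ucdf p.1)%:E by rewrite (permuton_fst pmu)// ucdfE.
have E2 : mu ([set: mR] `*` lray p.2) = (ucdf p.2)%:E by rewrite (permuton_snd pmu)// ucdfE.
have K (a b c : \bar R) (x y z : R) : a = x%:E -> b = y%:E -> c = z%:E ->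
    (a - c) + (b - c) = (x + y - 2 * z)%:E.
  by move=> -> -> ->; rewrite -!EFinB -EFinD; congr EFin; ring.
exact: K E1 E2 (esym (pcdfE mu p.1 p.2)).
Qed.

Lemma Rintegral_id01 : (\int[lam]_(t in `[0%R, 1%R]) (t : R) = 2^-1)%R.
Proof.
have D (t : R) : is_derive t 1%R (fun t : R => (t * t / 2)%R) t.
  have := is_derive_mul (is_derive_mul (is_derive_id t 1%R) (is_derive_id t 1%R)) (is_derive_const 2^-1 t).
  by move=> H; apply: (is_derive_eq H); rewrite mul1r mulr1 mulr0 addr0; lra.
rewrite /Rintegral (FTC2_itv (@ler01 R) _ D) /=; last by move=> t; exact: cvg_id.
by rewrite mulr1 !mul0r subr0 mul1r.
Qed.

Lemma pcdf_norm_le1 x y : (`|pcdf mu x y| <= 1)%R.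
Proof. by rewrite ger0_norm ?pcdf_ge0//; apply: le_trans (pcdf_le_fst pmu x y) (ucdf_le1 x). Qed.

Lemma integrable_pcdf : mu.-integrable setT (EFin \o (fun z => pcdf mu z.1 z.2)).
Proof. by apply: bounded_integrable => [|z]; [exact: measurable_pcdf | exact: pcdf_norm_le1]. Qed.

Lemma integrable_bounded_rv (X : plane -> R) : uniform_rv mu X -> mu.-integrable setT (EFin \o X).
Proof.
by move=> [mX X01 _]; apply: (@bounded_integrable _ _ _ _ X 1) => // z; have /andP[h0 h1] := X01 z; rewrite ger0_norm.
Qed.

Lemma Rintegral_uniform_rv (X : plane -> R) : uniform_rv mu X ->
  (\int[mu]_z X z = 2^-1)%R.
Proof.
move=> uX; rewrite -Rintegral_id01; apply: (@uniform_rv_Rintegral _ _ _ _ _ uX (fun t => t) 1) => //.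
by move=> t /andP[t0 t1]; rewrite ger0_norm.
Qed.

Lemma measurable_hh : measurable_fun setT (fun z : plane * plane => (h z.1 z.2)%:E).
Proof.
apply/measurable_EFinP.
rewrite (_ : (fun z : plane * plane => h z.1 z.2) =
  fun z => if ((z.1.1 - z.2.1) * (z.1.2 - z.2.2) < 0)%R then 1%R else 0%R); last first.
  by apply/funext => q; rewrite /h; case: ltP.
have m11 : measurable_fun setT (fun z : plane * plane => z.1.1 : R).
  exact: (measurableT_comp measurable_fst measurable_fst).
have m12 : measurable_fun setT (fun z : plane * plane => z.1.2 : R).
  exact: (measurableT_comp measurable_snd measurable_fst).
have m21 : measurable_fun setT (fun z : plane * plane => z.2.1 : R).
  exact: (measurableT_comp measurable_fst measurable_snd).
have m22 : measurable_fun setT (fun z : plane * plane => z.2.2 : R).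
  exact: (measurableT_comp measurable_snd measurable_snd).
apply: measurable_fun_ifT => //; apply: measurable_fun_ltr => //.
by apply: measurable_funM; apply: measurable_funB.
Qed.

(** The means of the two uniform marginals contribute [1/2] each. *)
Lemma integral_inversions :
  \int[mu \x mu]_z (h z.1 z.2)%:E = (1 - 2 * (\int[mu]_z pcdf mu z.1 z.2)%R)%R%:E.
Proof.
have h0 (z : plane * plane) : 0 <= (h z.1 z.2)%:E by rewrite lee_fin.
rewrite [LHS](fubini_tonelli1 _ measurable_hh h0) /fubini_F/=.
under eq_integral do rewrite inversion_section.
have u1 := uniform_rv_fst pmu; have u2 := uniform_rv_snd pmu.
have i1 := integrable_bounded_rv u1; have i2 := integrable_bounded_rv u2.
have i12 := integrableD measurableT i1 i2.
have i3 : mu.-integrable setT (EFin \o (fun z => 2 * pcdf mu z.1 z.2)%R).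
  by apply: integrableZl integrable_pcdf.
have e3 := RintegralB measurableT i12 i3.
have e12 := RintegralD measurableT i1 i2.
have eZ := RintegralZl 2%R measurableT integrable_pcdf.
have e1 := Rintegral_uniform_rv u1; have e2 := Rintegral_uniform_rv u2.
have e : (\int[mu]_x (ucdf x.1 + ucdf x.2 - 2 * pcdf mu x.1 x.2) =
    1 - 2 * \int[mu]_z pcdf mu z.1 z.2)%R.
  by rewrite [LHS]e3 e12 eZ e1 e2; congr (_ - _)%R; rewrite [RHS]splitr div1r.
rewrite -e.
rewrite /Rintegral fineK//; apply: integrable_fin_num => //.
by have := integrableB measurableT i12 i3.
Qed.

End inversions_of_permuton.

(** * The variational upper bound *)

Section variational_bound.
Context {R : realType}.
Notation mR := (measurableTypeR R).
Notation plane := (mR * mR)%type.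
Notation lam := (@lebesgue_measure R).
Notation U := (@uniform01 R).
Notation u := (@uniform_square R).
Local Open Scope ereal_scope.
Variables (theta : R) (mu : probability plane R).
Hypothesis pmu : permuton mu.
Variable f : plane -> R.
Hypotheses (mf : measurable_fun setT f) (f0 : forall z, (0 <= f z)%R)
  (muE : forall A, measurable A -> mu A = \int[u]_(z in A) (f z)%:E)
  (fy1 : forall y, \int[U]_x (f (x, y))%:E = 1).

(** With [c] the abscissa and [G] the value of the distribution function. *)
Definition tilt (c G : R) : R := (theta * (c - G) - ln c - ucgf (theta * c))%R.

(** The density that a maximiser with distribution function [pcdf mu] and
    conditional distribution function [ccdf f] must have. It depends on [mu]
    itself, so that [f = gibbs_density] is an equation for the maximiser. *)
Definition gibbs_density (z : plane) : R :=
  (ccdf f z.1 z.2 * expR (tilt (ucdf z.1) (pcdf mu z.1 z.2)))%R.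

Definition gibbs_log_density (z : plane) : R :=
  (ln (ccdf f z.1 z.2) + tilt (ucdf z.1) (pcdf mu z.1 z.2))%R.

(** The part of [gibbs_density] depending on the column alone. *)
Definition column_factor (c : R) : R := expR (theta * c - ln c - ucgf (theta * c)).

Lemma column_factorE (c : R) : (0 < c)%R -> column_factor c = (expR (theta * c) / texp theta c)%R.
Proof.
move=> c0; rewrite /column_factor -addrA -opprD expRD expRN expRD lnK ?posrE//.
by rewrite texp_ucgf.
Qed.

Let mc : measurable_fun setT (fun z : plane => ucdf z.1 : R).
Proof. exact: (measurableT_comp (@measurable_ucdf R) measurable_fst). Qed.

Let mG := @measurable_pcdf R mu.

Let mcg := measurable_ccdf mf f0 fy1.

Lemma measurable_tilt : measurable_fun setT (fun z : plane => tilt (ucdf z.1) (pcdf mu z.1 z.2)).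
Proof.
rewrite /tilt; apply: measurable_funB; first apply: measurable_funB.
- by apply: measurable_funM => //; exact: measurable_funB.
- by apply: measurableT_comp => //; exact: measurable_ln.
- apply: (measurableT_comp (f := fun t : R => ucgf (theta * t)%R)) => //.
  by apply: continuous_measurable_fun; exact: continuous_ucgf_scale.
Qed.

Lemma measurable_gibbs_density : measurable_fun setT gibbs_density.
Proof.
apply: measurable_funM; first exact: mcg.
by apply: measurableT_comp => //; exact: measurable_tilt.
Qed.

Lemma gibbs_density_ge0 z : (0 <= gibbs_density z)%R.
Proof. by rewrite mulr_ge0 ?expR_ge0// ccdf_ge0. Qed.

(** On a column [gibbs_density] is a multiple of
    [ccdf * expR (- theta * pcdf)], the derivative of a function of [pcdf], and
    [integral_pcdf_column] integrates it. *)
Lemma gibbs_density_slice x y0 :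
  \int[U]_(y in lray y0) (gibbs_density (x, y))%:E =
  (column_factor (ucdf x) * texp (- theta) (pcdf mu x y0))%R%:E.
Proof.
pose psi (t : mR) : \bar R := (expR (- theta * t))%:E.
have mpsi : measurable_fun setT psi.
  apply/measurable_EFinP; apply: continuous_measurable_fun => t.
  exact: is_derive_cont (is_derive_cexp (- theta) t).
have psi0 t : 0 <= psi t by rewrite lee_fin expR_ge0.
have mx : measurable_fun setT (fun y : mR => psi (pcdf mu x y) * (ccdf f x y)%:E).
  apply: emeasurable_funM.
    apply: (measurableT_comp mpsi).
    exact: (@measurable_fun_pair2 _ _ _ _ _ _ (fun z : plane => pcdf mu z.1 z.2) x mG).
  apply/measurable_EFinP.
  exact: (@measurable_fun_pair2 _ _ _ _ _ _ (fun z : plane => ccdf f z.1 z.2) x mcg).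
transitivity (\int[U]_(y in lray y0) ((column_factor (ucdf x))%:E * (psi (pcdf mu x y) * (ccdf f x y)%:E))).
  apply: eq_integral => y _; rewrite /gibbs_density /psi /column_factor /tilt/= -!EFinM; congr EFin.
  rewrite mulrA -expRD mulrC; congr (expR _ * _)%R; ring.
rewrite ge0_integralZl//; last 4 first.
- exact: measurable_lray.
- exact: measurable_funTS.
- by move=> y _; rewrite mule_ge0// lee_fin ccdf_ge0.
- by rewrite lee_fin expR_ge0.
rewrite (integral_pcdf_column mf f0 muE fy1 x y0 mpsi psi0).
by rewrite integral_expR ?pcdf_ge0// EFinM.
Qed.

(** Each column has total mass at most [1], because [pcdf mu x 1] is the abscissa
    and [column_factor] was chosen to normalise it. *)
Lemma gibbs_density_total : \int[u]_z (gibbs_density z)%:E <= 1.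
Proof.
rewrite integral_u12; last 2 first.
- by apply/measurable_EFinP; exact: measurable_gibbs_density.
- by move=> z; rewrite lee_fin gibbs_density_ge0.
apply: (@le_trans _ _ (\int[U]_x cst 1 x)); last first.
  by rewrite integral_cst// mul1e; exact: probability_le1.
apply: ge0_le_integral => //.
- by move=> x _; apply: integral_ge0 => y _; rewrite lee_fin gibbs_density_ge0.
- apply: (@measurable_int1 _ _ _ _ _ U (EFin \o gibbs_density)).
    by apply/measurable_EFinP; exact: measurable_gibbs_density.
  by move=> z; rewrite lee_fin gibbs_density_ge0.
move=> x _.
have mx : measurable_fun setT (fun y : mR => (gibbs_density (x, y))%:E).
  apply/measurable_EFinP.
  exact: (@measurable_fun_pair2 _ _ _ _ _ _ gibbs_density x measurable_gibbs_density).
rewrite integral_lray1//; last by move=> y; rewrite lee_fin gibbs_density_ge0.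
rewrite gibbs_density_slice lee_fin (pcdf_ge1_snd pmu)//.
have := ucdf_ge0 x; rewrite le_eqVlt => /predU1P[<-|c0]; first by rewrite texp0 mulr0.
by rewrite column_factorE// mulrAC texpN divff// gt_eqF// texp_gt0.
Qed.

Let ug := uniform_rv_ccdf mf f0 muE fy1.
Let uc := uniform_rv_fst pmu.

Let ig := uniform_rv_integrable_ln ug.
Let ic := uniform_rv_integrable_ln uc.

Let rest (z : plane) : R := (theta * (ucdf z.1 - pcdf mu z.1 z.2))%R.
Let rest2 (z : plane) : R := ucgf (theta * ucdf z.1).

Let cG (z : plane) : (0 <= ucdf z.1 - pcdf mu z.1 z.2 <= 1)%R.
Proof.
rewrite subr_ge0 (pcdf_le_fst pmu)/= lerBlDr.
by rewrite (le_trans (ucdf_le1 _))// lerDl pcdf_ge0.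
Qed.

Let irest : mu.-integrable setT (EFin \o rest).
Proof.
apply: (@bounded_integrable _ _ _ _ rest `|theta|%R).
  by apply: measurable_funM => //; exact: measurable_funB.
move=> z; have /andP[h0 h1] := cG z.
by rewrite /rest normrM (ger0_norm h0) ler_piMr.
Qed.

Let bound_ucgf (t : R) : (0 <= t <= 1)%R -> (`|ucgf (theta * t)| <= `|theta|)%R.
Proof.
move=> /andP[h0 h1]; apply: (le_trans (ucgf_lip0 _)).
by rewrite normrM (ger0_norm h0) ler_piMr.
Qed.

Let irest2 : mu.-integrable setT (EFin \o rest2).
Proof.
apply: (@bounded_integrable _ _ _ _ rest2 `|theta|%R).
  apply: (measurableT_comp (f := fun t : R => ucgf (theta * t)%R)) => //.
  by apply: continuous_measurable_fun; exact: continuous_ucgf_scale.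
by move=> z; apply: bound_ucgf; rewrite ucdf_ge0 ucdf_le1.
Qed.

Let i1 := integrableB measurableT ig ic.
Let i2 := integrableB measurableT irest irest2.

Let gibbs_log_densityE : gibbs_log_density = fun z => ((ln (ccdf f z.1 z.2) - ln (ucdf z.1)) + (rest z - rest2 z))%R.
Proof. by apply/funext => z; rewrite /gibbs_log_density /tilt /rest /rest2; ring. Qed.

Lemma integrable_gibbs_log_density : mu.-integrable setT (EFin \o gibbs_log_density).
Proof.
rewrite gibbs_log_densityE; have := integrableD measurableT i1 i2.
by apply: eq_integrable.
Qed.

Lemma gibbs_density_expR : {ae mu, forall z, gibbs_density z = expR (gibbs_log_density z)}.
Proof.
apply: filterS (uniform_rv_gt0 ug) => z gz.
by rewrite /gibbs_density /gibbs_log_density expRD lnK.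
Qed.

(** The mean logarithms of the uniform random variables [ccdf] and [ucdf] cancel,
    the term in [ucgf] gives [mrate], and the linear term gives the inversion
    density. This exact value, affine in the inversion density, is the reason
    for the choice of [gibbs_density]. *)
Lemma integral_gibbs_log_density :
  \int[mu]_z (gibbs_log_density z)%:E =
  (theta / 2 * (1 - 2 * (\int[mu]_z pcdf mu z.1 z.2)%R) - mrate theta)%R%:E.
Proof.
rewrite -[LHS]fineK; last exact: integrable_fin_num integrable_gibbs_log_density.
congr EFin; rewrite -[LHS]/(\int[mu]_z gibbs_log_density z)%R gibbs_log_densityE.
have e1 := RintegralB measurableT ig ic.
have e2 := RintegralB measurableT irest irest2.
have e12 := RintegralD measurableT i1 i2.
rewrite [LHS]e12 e1 e2 (uniform_rv_Rintegral_ln ug) (uniform_rv_Rintegral_ln uc) subrr add0r.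
have -> : (\int[mu]_x rest2 x = mrate theta)%R.
  apply: (@uniform_rv_Rintegral _ _ _ _ _ uc (fun t => ucgf (theta * t)%R) `|theta|%R).
    by apply: continuous_measurable_fun; exact: continuous_ucgf_scale.
  exact: bound_ucgf.
congr (_ - _)%R; rewrite /rest.
have ip := integrable_pcdf pmu.
have iu := integrable_bounded_rv uc.
have icG := integrableB measurableT iu ip.
have eZ := RintegralZl theta measurableT icG.
have eB := RintegralB measurableT iu ip.
rewrite [LHS]eZ eB (Rintegral_uniform_rv uc) -mulrA; congr (_ * _)%R.
by field.
Qed.

Lemma objective_density : objective theta mu =
  (theta / 2 * (1 - 2 * (\int[mu]_z pcdf mu z.1 z.2)%R))%R%:E - \int[mu]_z lne (f z)%:E.
Proof.
rewrite /objective (KL_density mf f0 muE) (integral_inversions pmu).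
by rewrite -EFinM.
Qed.

Lemma objective_density_le : objective theta mu <= (mrate theta)%:E.
Proof.
rewrite objective_density.
have := gibbs_le mf f0 muE measurable_gibbs_density gibbs_density_ge0
  gibbs_density_total integrable_gibbs_log_density gibbs_density_expR.
rewrite integral_gibbs_log_density; move: (\int[mu]_z lne _) (_ * (1 - _))%R => [r| |] a//=.
  by rewrite !lee_fin; lra.
by rewrite leNye.
Qed.

Lemma objective_density_eq : objective theta mu = (mrate theta)%:E ->
  {ae u, forall z, f z = gibbs_density z}.
Proof.
rewrite objective_density => e.
apply: (gibbs_eq mf f0 muE measurable_gibbs_density gibbs_density_ge0
  gibbs_density_total integrable_gibbs_log_density gibbs_density_expR).
rewrite integral_gibbs_log_density; move: e.
move: (\int[mu]_z lne _) (_ * (1 - _))%R => [r| |] a//=.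
by move=> -[<-]; congr EFin; lra.
Qed.

Lemma objective_density_attained : {ae u, forall z, f z = gibbs_density z} ->
  objective theta mu = (mrate theta)%:E.
Proof.
move=> /(gibbs_attained mf f0 muE integrable_gibbs_log_density gibbs_density_expR).
rewrite objective_density integral_gibbs_log_density => ->.
by rewrite -EFinB; congr EFin; lra.
Qed.

End variational_bound.

(** A measure without a density has infinite divergence. *)
Lemma objective_le {R : realType} theta (mu : probability (measurableTypeR R * measurableTypeR R)%type R) :
  permuton mu -> (objective theta mu <= (mrate theta)%:E)%E.
Proof.
move=> pmu; have [mu_u|nmu_u] := pselect (mu `<< @uniform_square R).
  have [f [mf f0 muE fy1]] := permuton_density pmu mu_u.
  exact: objective_density_le muE fy1.
rewrite /objective /KL asboolF// (integral_inversions pmu) -EFinM.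
by rewrite leNye.
Qed.

(** * Uniqueness of the maximiser *)

Section uniqueness.
Context {R : realType}.
Notation mR := (measurableTypeR R).
Notation plane := (mR * mR)%type.
Notation lam := (@lebesgue_measure R).
Notation U := (@uniform01 R).
Notation u := (@uniform_square R).
Local Open Scope ereal_scope.

Section maximiser.
Variables (theta : R) (mu : probability plane R).
Hypothesis pmu : permuton mu.
Variable f : plane -> R.
Hypotheses (mf : measurable_fun setT f) (f0 : forall z, (0 <= f z)%R)
  (muE : forall A, measurable A -> mu A = \int[u]_(z in A) (f z)%:E)
  (fy1 : forall y, \int[U]_x (f (x, y))%:E = 1).
Hypothesis fphi : {ae u, forall z, f z = gibbs_density theta mu f z}.
Variable y0 : R.

Let N (x : R) : R := pcdf mu x y0.
Let w (t : R) : R := (column_factor theta (ucdf t) * texp (- theta) (N t))%R.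

Let w0 t : (0 <= w t)%R.
Proof.
rewrite mulr_ge0 ?expR_ge0//; have : (0 <= N t)%R by exact: pcdf_ge0.
by rewrite le_eqVlt => /predU1P[<-|/(texp_gt0 (- theta))/ltW//]; rewrite texp0.
Qed.

Let contN : continuous N. Proof. by move=> x; exact: pcdf_cont1. Qed.

Let contT : continuous (fun t => texp (- theta) (N t)).
Proof.
move=> x; apply: (@continuous_comp _ _ _ N (texp (- theta))); first exact: contN.
exact: continuous_texp.
Qed.

Let mw : measurable_fun (setT : set mR) w.
Proof.
apply: measurable_funM; last exact: continuous_measurable_fun.
apply: (measurableT_comp (f := @expR R)) => //.
have mc := @measurable_ucdf R.
apply: measurable_funB; last first.
  apply: (measurableT_comp (f := fun t : R => ucgf (theta * t)%R)) => //.
  by apply: continuous_measurable_fun; exact: continuous_ucgf_scale.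
apply: measurable_funB; first exact: measurable_funM.
by apply: (measurableT_comp (f := @ln R)) => //; exact: measurable_ln.
Qed.

Let pcdf_lintegral (x : R) : (0 <= x <= 1)%R ->
  (N x)%:E = \int[lam]_(t in `[0%R, x]) (w t)%:E.
Proof.
move=> /andP[x0 x1].
have mg : measurable_fun setT (gibbs_density theta mu f) by exact: measurable_gibbs_density.
have mQ := measurable_quadrant x y0.
rewrite /N pcdfE muE//.
have -> : \int[u]_(z in lray x `*` lray y0) (f z)%:E =
    \int[u]_(z in lray x `*` lray y0) (gibbs_density theta mu f z)%:E.
  apply: ge0_ae_eq_integral => //.
  - by apply: measurable_funTS; apply/measurable_EFinP.
  - by apply: measurable_funTS; apply/measurable_EFinP.
  - by move=> z _; rewrite lee_fin.
  - by move=> z _; rewrite lee_fin gibbs_density_ge0.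
  - by apply: filterS fphi => z e _; rewrite e.
rewrite integral_quadrant12//; last by move=> z; exact: gibbs_density_ge0.
under eq_integral do rewrite gibbs_density_slice//.
rewrite integral_mkcond integral_uniform01; last 2 first.
- apply/(measurable_restrictT (fun t : mR => (w t)%:E)); first exact: measurable_lray.
  by apply: measurable_funTS; apply/measurable_EFinP.
- by move=> t; rewrite patchE; case: ifP => // _; rewrite lee_fin w0.
rewrite [LHS]integral_mkcond [RHS]integral_mkcond; apply: eq_integral => t _.
rewrite !patchE.
have -> : (t \in `[0%R, x]%classic) = (t \in `[0%R, 1%R]%classic) && (t \in lray x).
  apply/idP/andP; rewrite !inE /lray/= !in_itv/=.
    by move=> /andP[-> h]; rewrite h (le_trans h x1).
  by move=> [/andP[-> _] ->].
by case: (_ \in `[0%R, 1%R]%classic) => //=; case: ifP.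
Qed.

Let integrable_w : lam.-integrable `[0%R, 1%R] (EFin \o w).
Proof.
apply/integrableP; split; first by apply: measurable_funTS; apply/measurable_EFinP.
under eq_integral do rewrite gee0_abs ?lee_fin ?w0//.
by rewrite -pcdf_lintegral ?ltry// ler01 lexx.
Qed.

Let is_derive_N (x : R) : (0 < x < 1)%R -> is_derive x 1%R N (w x).
Proof.
move=> /andP[x0 x1].
have cw : {for x, continuous (w : R -> R)}.
  apply: cvgM; last exact: contT.
  have cu : {for x, continuous (fun t : R => ucdf t : R)}.
    apply: (lipschitz_continuous (K := 1)) => s t; rewrite mul1r; exact: ucdf_lip.
  have ux : ucdf x = x by rewrite ucdf_id// !ltW.
  apply: (@continuous_comp _ _ _ (fun t : R => ucdf t : R) (column_factor theta)) => //.
  rewrite ux; apply: (@continuous_comp _ _ _ _ expR); last exact: continuous_expR.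
  apply: cvgB; last exact: continuous_ucgf_scale.
  apply: cvgB; last exact: continuous_ln.
  by apply: cvgM; [exact: cvg_cst | exact: cvg_id].
have [dF F'] := continuous_FTC1_closed x1 integrable_w x0 cw.
pose F (x : R) := (\int[lam]_(t in [set` `[0%R, x]]) w t)%R.
have DF : is_derive x 1%R F (w x).
  by rewrite -F' derive1E; exact/derivableP.
apply: near_eq_is_derive DF; near=> t.
have t01 : (0 <= t <= 1)%R.
  apply/andP; split; near: t; [exact: lt_le_nbhsr|exact: lt_le_nbhsl].
by rewrite /F /Rintegral -pcdf_lintegral.
Unshelve. all: by end_near. Qed.

(** Integrating the equation for the density over quadrants shows that
    [N x = pcdf mu x y0] has, for [0 < x < 1], the derivative
    [w x = expR (theta * x) * texp (- theta) (N x) / texp theta x]. Then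
    [texp theta (N x) / texp theta x] has derivative zero, hence equals its
    value at [x = 1], where [N] is given by the marginal. *)
Lemma maximiser_pcdf (x : R) : (0 < x <= 1)%R ->
  (texp theta (pcdf mu x y0) * texp theta 1 = texp theta (ucdf y0) * texp theta x)%R.
Proof.
move=> /andP[x0]; rewrite le_eqVlt => /predU1P[->|x1].
  by rewrite (pcdf_ge1_fst pmu).
pose Q t : R := (texp theta (N t) / texp theta t)%R.
have T0 (t : R) : (0 < t)%R -> texp theta t != 0%R by move=> t0; rewrite gt_eqF// texp_gt0.
have DQ (t : R) : t \in `]x, 1%R[ -> is_derive t 1%R Q 0%R.
  rewrite in_itv/= => /andP[xt t1]; have t0 := lt_trans x0 xt.
  have t01 : (0 < t < 1)%R by rewrite t0.
  have DN := is_derive_N t01.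
  have DT : is_derive t 1%R (fun s => texp theta (N s)) (expR (theta * N t) * w t)%R.
    have D2 := is_derive_texp theta (N t).
    by have := @is_derive1_comp R (texp theta) N t _ _ D2 DN; rewrite mulrC.
  have H := @is_derive_div R _ _ _ _ _ (T0 _ t0) DT (is_derive_texp theta t).
  apply: (is_derive_eq H).
  have ut : ucdf t = t by rewrite ucdf_id// !ltW.
  rewrite /w ut column_factorE// mulrCA texpN -mulrA mulrCA.
  by rewrite divfK ?T0// subrr mul0r.
have cQ : {within `[x, 1%R], continuous Q}.
  apply: continuous_in_subspaceT => t; rewrite inE/= in_itv/= => /andP[xt _].
  have t0 := lt_le_trans x0 xt.
  apply: cvgM.
    apply: (@continuous_comp _ _ _ N (texp theta)); first exact: contN.
    exact: continuous_texp.
  by apply: cvgV; [exact: T0 | exact: continuous_texp].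
have [c _] := MVT x1 DQ cQ.
rewrite mul0r => /eqP; rewrite subr_eq0 /Q => /eqP/(congr1 (fun r => r * texp theta 1 * texp theta x)%R).
rewrite divfK ?T0 ?ltr01// [RHS]mulrAC divfK ?T0// => e.
by rewrite -e {1}/N (pcdf_ge1_fst pmu).
Qed.

End maximiser.

Lemma maximiser_unique (theta : R) (mu nu : probability plane R) :
  permuton mu -> objective theta mu = (mrate theta)%:E ->
  permuton nu -> objective theta nu = (mrate theta)%:E ->
  forall A, measurable A -> nu A = mu A.
Proof.
have key (m : probability plane R) : permuton m -> objective theta m = (mrate theta)%:E ->
    forall x y : R, (0 < x <= 1)%R ->
    (texp theta (pcdf m x y) * texp theta 1 = texp theta (ucdf y) * texp theta x)%R.
  move=> pm om x y x01.
  have [m_u|nm_u] := pselect (m `<< u); last first.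
    by move: om; rewrite /objective /KL asboolF// (integral_inversions pm).
  have [f [mf f0 mE fy1]] := permuton_density pm m_u.
  have fphi := objective_density_eq pm mf f0 mE fy1 om.
  exact: (maximiser_pcdf pm mf f0 mE fy1 fphi).
move=> pmu omu pnu onu; apply: measure_eq_quadrant => x y.
rewrite -!pcdfE; congr EFin.
have [x0|x0] := leP x 0%R.
  have z (m : probability plane R) : permuton m -> pcdf m x y = 0%R.
    move=> pm; apply/eqP; rewrite eq_le pcdf_ge0 andbT.
    by rewrite -(ucdf_le0 x0) (pcdf_le_fst pm).
  by rewrite !z.
have [x1|x1] := leP 1%R x; first by rewrite !pcdf_ge1_fst.
have x01 : (0 < x <= 1)%R by rewrite x0 ltW.
apply: (@texp_inj R theta).
apply: (@mulIf R (texp theta 1)); first by rewrite gt_eqF// texp_gt0.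
by rewrite (key nu pnu onu x y x01) (key mu pmu omu x y x01).
Qed.

End uniqueness.

(** * The Frank copula *)

Section frank.
Context {R : realType}.
Implicit Types theta x y : R.

(** The distribution function [G] of the Frank copula is given by
    [expR (theta * G) = frankW theta x y / texp theta 1]. The mixed derivative
    of [G] is [frank], and its derivative in [y] is [frankH]. *)
Definition frankW theta x y : R := texp theta 1 + theta * texp theta x * texp theta y.

Definition frank theta x y : R :=
  texp theta 1 * expR (theta * (x + y)) / frankW theta x y ^+ 2.

Definition frankH theta x y : R := expR (theta * y) * texp theta x / frankW theta x y.

Lemma frankWC theta x y : frankW theta x y = frankW theta y x.
Proof. by rewrite /frankW mulrAC. Qed.

Lemma frankC theta x y : frank theta x y = frank theta y x.
Proof. by rewrite /frank frankWC addrC. Qed.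

Lemma texp_le theta x y : x <= y -> texp theta x <= texp theta y.
Proof. by rewrite le_eqVlt => /predU1P[->//|/(texp_incr theta)/ltW]. Qed.

(** Only one coordinate needs to lie in [[0, 1]]. So the other one ranges over the
    whole line in the derivatives below, and no one-sided derivatives appear. *)
Lemma frankW_gt0 theta x y : 0 <= y <= 1 -> 0 < frankW theta x y.
Proof.
move=> /andP[y0 y1].
have -> : frankW theta x y = texp theta 1 - texp theta y + expR (theta * x) * texp theta y.
  by rewrite /frankW -texp_expR; ring.
move: y0; rewrite le_eqVlt => /predU1P[<-|y0].
  by rewrite texp0 mulr0 subr0 addr0 texp_gt0.
by rewrite ltr_wpDl ?subr_ge0 ?texp_le// mulr_gt0 ?expR_gt0 ?texp_gt0.
Qed.

Lemma frankW0 theta x : frankW theta x 0 = texp theta 1.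
Proof. by rewrite /frankW texp0 mulr0 addr0. Qed.

Lemma frankW1 theta x : frankW theta x 1 = texp theta 1 * expR (theta * x).
Proof. by rewrite /frankW -texp_expR; ring. Qed.

Lemma frankH0 theta y : frankH theta 0 y = 0.
Proof. by rewrite /frankH texp0 mulr0 mul0r. Qed.

Lemma frankH1 theta y : frankH theta 1 y = 1.
Proof.
by rewrite /frankH frankWC frankW1 [X in X / _]mulrC divff// mulf_neq0 ?gt_eqF ?expR_gt0 ?texp_gt0.
Qed.

Lemma is_derive_frankW theta x y : is_derive y 1 (frankW theta x) (theta * texp theta x * expR (theta * y)).
Proof.
have H := @is_derive_add R _ _ _ _ _ (is_derive_const (texp theta 1) y)
  (@is_derive_mul R _ _ _ _ _ (is_derive_const (theta * texp theta x) y) (is_derive_texp theta y)).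
by apply: (is_derive_eq H); rewrite add0r mul0r add0r.
Qed.

Lemma is_derive_frankH theta x y : 0 <= y <= 1 ->
  is_derive x 1 (frankH theta ^~ y) (frank theta x y).
Proof.
move=> y01; have W0 : frankW theta x y != 0 by rewrite gt_eqF// frankW_gt0.
have dW : is_derive x 1 (frankW theta ^~ y) (theta * texp theta y * expR (theta * x)).
  rewrite (_ : frankW theta ^~ y = frankW theta y); first exact: is_derive_frankW.
  by apply/funext => t; rewrite frankWC.
have H := @is_derive_div R _ (frankW theta ^~ y) x _ _ W0 (@is_derive_mul R _ _ _ _ _
  (is_derive_const (expR (theta * y)) x) (is_derive_texp theta x)) dW.
apply: (is_derive_eq H); rewrite /frank mul0r add0r; congr (_ / _).
rewrite [theta * (x + y)]mulrDr expRD /frankW; ring.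
Qed.

Lemma is_derive_ln_frankW theta x y : 0 <= x <= 1 ->
  is_derive y 1 (fun t => ln (frankW theta x t)) (theta * frankH theta x y).
Proof.
move=> x01; have W0 : 0 < frankW theta x y by rewrite frankWC frankW_gt0.
have H := @is_derive_lnf R _ _ _ W0 (is_derive_frankW theta x y).
by apply: (is_derive_eq H); rewrite /frankH; ring.
Qed.

Lemma continuous_frankH theta x : 0 <= x <= 1 -> continuous (frankH theta x).
Proof.
move=> x01 y; have W0 : frankW theta x y != 0 by rewrite gt_eqF// frankWC frankW_gt0.
apply: cvgM.
  by apply: cvgM; [exact: is_derive_cont (is_derive_cexp theta y) | exact: cvg_cst].
by apply: cvgV => //; exact: is_derive_cont (is_derive_frankW theta x y).
Qed.

Lemma continuous_frank theta y : 0 <= y <= 1 -> continuous (frank theta ^~ y).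
Proof.
move=> y01 x; have W0 : frankW theta x y != 0 by rewrite gt_eqF// frankW_gt0.
have dW : is_derive x 1 (frankW theta ^~ y) (theta * texp theta y * expR (theta * x)).
  rewrite (_ : frankW theta ^~ y = frankW theta y); first exact: is_derive_frankW.
  by apply/funext => t; rewrite frankWC.
apply: cvgM.
  apply: cvgM; first exact: cvg_cst.
  apply: (@continuous_comp _ _ _ (fun x => theta * (x + y)) expR); last exact: continuous_expR.
  by apply: cvgM; [exact: cvg_cst | apply: cvgD; [exact: cvg_id | exact: cvg_cst]].
apply: cvgV; first by rewrite expf_neq0.
by apply: cvgM; exact: is_derive_cont dW.
Qed.

Lemma frank_ge0 theta x y : 0 <= frank theta x y.
Proof. by rewrite divr_ge0 ?sqr_ge0// mulr_ge0 ?expR_ge0// ltW// texp_gt0. Qed.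

Lemma frankH_ge0 theta x y : 0 <= x <= 1 -> 0 <= frankH theta x y.
Proof.
move=> /[dup] x01 /andP[x0 _].
rewrite divr_ge0// ?mulr_ge0 ?expR_ge0//; last by rewrite ltW// frankWC frankW_gt0.
by rewrite -(texp0 theta) texp_le.
Qed.

(** The quantity squared in the denominator of [rho_formula] is
    [- theta * frankW theta x y / 2] divided by
    [expR (theta / 4) * expR (theta * (x + y) / 2)]. *)
Lemma rho_formula_frank theta x y : theta != 0 -> 0 <= y <= 1 ->
  rho_formula x y theta = frank theta x y.
Proof.
move=> t0 y01; have W0 := frankW_gt0 theta x y01.
rewrite /rho_formula /frank /cosh /sinh; move: W0; rewrite /frankW /texp (negbTE t0).
(* all exponentials are monomials in these three, which turns the claim into a rational identity *)
pose a := expR (theta / 4); pose p := expR (theta * x / 2); pose q := expR (theta * y / 2).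
have a0 : a != 0 by rewrite gt_eqF// expR_gt0.
have p0 : p != 0 by rewrite gt_eqF// expR_gt0.
have q0 : q != 0 by rewrite gt_eqF// expR_gt0.
have E1 : expR (theta * 1) = a ^+ 4 by rewrite /a -expRM_natl; congr expR; field.
have E2 : expR (theta * x) = p ^+ 2 by rewrite /p -expRM_natl; congr expR; field.
have E3 : expR (theta * y) = q ^+ 2 by rewrite /q -expRM_natl; congr expR; field.
have E4 : expR (theta * (x + y)) = p ^+ 2 * q ^+ 2 by rewrite mulrDr expRD E2 E3.
have E5 : expR (theta / 2) = a ^+ 2 by rewrite /a -expRM_natl; congr expR; field.
have E6 : expR (- (theta / 2)) = a ^- 2 by rewrite expRN E5.
have E7 : expR (- (theta / 4)) = a^-1 by rewrite expRN.
have E8 : expR (theta * (x - y) / 2) = p / q.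
  by rewrite /p /q -expRN -expRD; congr expR; field.
have E9 : expR (- (theta * (x - y) / 2)) = q / p by rewrite expRN E8 invf_div.
have E10 : expR (theta * (x + y - 1) / 2) = p * q / a ^+ 2.
  by rewrite -E5 /p /q -expRN -!expRD; congr expR; field.
have E11 : expR (- (theta * (x + y - 1) / 2)) = a ^+ 2 / (p * q) by rewrite expRN E10 invf_div.
rewrite E1 E2 E3 E4 E5 E6 E7 E8 E9 E10 E11 -/a.
move: a p q a0 p0 q0 {E1 E2 E3 E4 E5 E6 E7 E8 E9 E10 E11} => a p q a0 p0 q0.
set W := (X in 0 < X) => W0.
have WE : a ^+ 4 + p ^+ 2 * q ^+ 2 - p ^+ 2 - q ^+ 2 = theta * W by rewrite /W; field.
set D := (X in _ / X ^+ 2 = _).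
have -> : D = - (theta * W) / (2 * a * p * q).
  by rewrite -WE /D; field; rewrite a0 p0 q0.
rewrite -/W; clearbody W; field.
by rewrite a0 p0 q0 t0 gt_eqF.
Qed.

(** In the form [x * expR (ucgf (theta * x))] there is no exception at
    [theta = 0]. *)
Lemma continuous_texp_param x : continuous (fun theta : R => texp theta x).
Proof.
move=> t; rewrite (_ : (fun theta => texp theta x) = fun theta => x * expR (ucgf (theta * x))).
  apply: cvgM; first exact: cvg_cst.
  apply: continuous_cvg; first exact: continuous_expR.
  apply: continuous_cvg; first exact: continuous_ucgf.
  by apply: cvgM; [exact: cvg_id | exact: cvg_cst].
by apply/funext => th; rewrite texp_ucgf.
Qed.

Lemma continuous_frank_param x y theta : 0 <= y <= 1 -> {for theta, continuous (fun t => frank t x y)}.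
Proof.
move=> y01; have W0 : frankW theta x y != 0 by rewrite gt_eqF// frankW_gt0.
apply: cvgM.
  apply: cvgM; first exact: continuous_texp_param.
  apply: continuous_cvg; first exact: continuous_expR.
  by apply: cvgM; [exact: cvg_id | exact: cvg_cst].
have cW : frankW t x y @[t --> theta] --> frankW theta x y.
  apply: cvgD; first exact: continuous_texp_param.
  by apply: cvgM; [apply: cvgM; [exact: cvg_id | exact: continuous_texp_param] | exact: continuous_texp_param].
apply: cvgV; first by rewrite expf_neq0.
exact: cvgM.
Qed.

(** At [theta = 0] the limit exists because [frank], which coincides with the
    formula elsewhere, is continuous in the parameter. *)
Lemma rho_frank theta x y : 0 <= y <= 1 -> rho theta x y = frank theta x y.
Proof.
move=> y01; rewrite /rho /ext0; case: eqVneq => [->|t0]; last exact: rho_formula_frank.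
apply: cvg_lim => //.
have C := @continuous_frank_param x y 0 y01.
have C' : frank t x y @[t --> (0 : R)^'] --> frank 0 x y by by apply: cvg_within_filter; exact: C.
apply: cvg_trans C'; apply: near_eq_cvg; near=> t.
rewrite rho_formula_frank//; near: t; exact: nbhs_dnbhs_neq.
Unshelve. all: by end_near. Qed.

End frank.

(** * Existence of the maximiser *)

Section density_probability.
Context {R : realType} d (T : measurableType d) (mu : {sigma_finite_measure set T -> \bar R}).
Local Open Scope ereal_scope.
Variables (f : T -> R) (mf : measurable_fun setT f) (f0 : forall x, (0 <= f x)%R)
  (f1 : \int[mu]_x (f x)%:E = 1).

Let ffin : \int[mu]_x (f x)%:E < +oo. Proof. by rewrite f1 ltry. Qed.

Definition pdens (f1 : \int[mu]_x (f x)%:E = 1) : set T -> \bar R := mdens mf f0 ffin.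

HB.instance Definition _ := Measure.on (pdens f1).

Let pdensT : pdens f1 setT = 1. Proof. by rewrite /pdens /mdens. Qed.

HB.instance Definition _ := Measure_isProbability.Build _ _ _ (pdens f1) pdensT.

Lemma density_probability :
  exists P : probability T R, forall A, P A = \int[mu]_(x in A) (f x)%:E.
Proof. by exists (pdens f1). Qed.

End density_probability.

Section uniform_lray.
Context {R : realType}.
Notation mR := (measurableTypeR R).
Notation plane := (mR * mR)%type.
Notation lam := (@lebesgue_measure R).
Notation U := (@uniform01 R).
Notation u := (@uniform_square R).
Local Open Scope ereal_scope.

(** For [0 <= x] the two domains agree inside [[0, 1]]; for [x < 0] both sides
    are integrals over null sets. *)
Lemma integral_uniform01_lray (psi : mR -> \bar R) (x : R) :
  measurable_fun setT psi -> (forall t, 0 <= psi t) ->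
  \int[U]_(t in lray x) psi (ucdf t) = \int[lam]_(t in `[0%R, ucdf x]) psi t.
Proof.
move=> mpsi psi0.
have mpc : measurable_fun setT (fun t : mR => psi (ucdf t)).
  by apply: (measurableT_comp mpsi); exact: measurable_ucdf.
have [x0|x0] := ltP x 0%R.
  rewrite (ucdf_le0 (ltW x0)) set_itv1 [RHS]null_set_integral//; last 2 first.
  - exact: measurable_funTS.
  - exact: lebesgue_measure_set1.
  apply: null_set_integral; first exact: measurable_lray.
    exact: measurable_funTS.
  by transitivity (ucdf x)%:E; [exact/esym/ucdfE | rewrite ucdf_le0// ltW].
rewrite [LHS]integral_mkcond integral_uniform01; last 2 first.
- apply/(measurable_restrictT (fun t : mR => psi (ucdf t))); first exact: measurable_lray.
  exact: measurable_funTS.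
- by move=> t; rewrite patchE; case: ifP.
rewrite [LHS]integral_mkcond [RHS]integral_mkcond; apply: eq_integral => t _.
rewrite !patchE.
have -> : (t \in `[0%R, ucdf x]%classic) = (t \in `[0%R, 1%R]%classic) && (t \in lray x).
  apply/idP/andP; rewrite !inE /lray/= !in_itv/=.
    move=> /andP[t0 tx]; have t1 := le_trans tx (ucdf_le1 x).
    rewrite t0 t1; split => //; have [//|xt] := leP t x.
    by move: tx; rewrite ucdf_id ?x0 ?(ltW (lt_le_trans xt t1))// leNgt xt.
  move=> [/andP[t0 t1] tx]; rewrite t0/= -(@ucdf_id _ t) ?t0//; exact: ucdf_nd.
case: ifPn => //= t01; case: ifP => // _; rewrite ucdf_id//.
by move: t01; rewrite inE/= in_itv.
Qed.

(** This relates the reference measure of the divergence to the one for which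
    [density_on_square] is stated. *)
Lemma integral_uniform_square (F : plane -> \bar R) (A : set plane) : measurable A ->
  measurable_fun setT F -> (forall z, 0 <= F z) ->
  \int[u]_(z in A) F z = \int[lam \x lam]_(z in A `&` unit_square) F z.
Proof.
move=> mA mF F0.
have mI : measurable (`[0%R, 1%R]%classic : set mR) by exact: measurable_itv.
have mS : measurable (unit_square : set plane) by exact: measurableX.
have mAS : measurable (A `&` unit_square) by exact: measurableI.
have mP : measurable_fun setT (F \_ A).
  by apply/(measurable_restrictT F) => //; exact: measurable_funTS.
have P0 z : 0 <= (F \_ A) z by rewrite patchE; case: ifP.
have mQ : measurable_fun setT (F \_ (A `&` unit_square)).
  by apply/(measurable_restrictT F) => //; exact: measurable_funTS.
have Q0 z : 0 <= (F \_ (A `&` unit_square)) z by rewrite patchE; case: ifP.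
rewrite [LHS]integral_mkcond [RHS]integral_mkcond integral_u12//.
rewrite [RHS](fubini_tonelli1 _ mQ Q0) /fubini_F.
rewrite integral_uniform01; last 2 first.
- exact: measurable_int1.
- by move=> x; exact: integral_ge0.
rewrite integral_mkcond; apply: eq_integral => x _; rewrite patchE.
have [x01|x01] := boolP (x \in `[0%R, 1%R]%classic); last first.
  symmetry; apply: integral0_eq => y _; rewrite patchE ifN//.
  by apply/negP; rewrite inE => -[_ [/= h _]]; move/negP : x01; apply; rewrite inE.
rewrite integral_uniform01//; last first.
  exact: (@measurable_fun_pair2 _ _ _ _ _ _ (F \_ A) x mP).
rewrite [LHS]integral_mkcond; apply: eq_integral => y _; rewrite !patchE.
rewrite inE in x01; case: ifPn => y01.
  rewrite inE in y01; have -> // : ((x, y) \in A `&` unit_square) = ((x, y) \in A).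
  by apply/idP/idP; rewrite !inE; [case | split].
rewrite ifN//; apply/negP; rewrite inE => -[_ [_ /= h]].
by move/negP : y01; apply; rewrite inE.
Qed.

End uniform_lray.

Section frank_permuton.
Context {R : realType}.
Notation mR := (measurableTypeR R).
Notation plane := (mR * mR)%type.
Notation lam := (@lebesgue_measure R).
Notation U := (@uniform01 R).
Notation u := (@uniform_square R).
Local Open Scope ereal_scope.
Variable theta : R.

(** Clamping the coordinates makes the density everywhere nonnegative and its rows
    and columns normalised without exception. *)
Definition frank_density (z : plane) : R := frank theta (ucdf z.1) (ucdf z.2).

Let c01 (x : mR) : (0 <= ucdf x <= 1)%R. Proof. by rewrite ucdf_ge0 ucdf_le1. Qed.

Let mtexp : measurable_fun (setT : set R) (texp theta).
Proof. by apply: continuous_measurable_fun; exact: continuous_texp. Qed.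

Let mc1 : measurable_fun setT (fun z : plane => ucdf z.1 : R).
Proof. exact: (measurableT_comp (@measurable_ucdf R) measurable_fst). Qed.

Let mc2 : measurable_fun setT (fun z : plane => ucdf z.2 : R).
Proof. exact: (measurableT_comp (@measurable_ucdf R) measurable_snd). Qed.

Lemma frank_density_ge0 z : (0 <= frank_density z)%R. Proof. exact: frank_ge0. Qed.

Lemma frank_densityE (z : plane) : frank_density z = (texp theta 1 * expR (theta * (ucdf z.1 + ucdf z.2)) *
  expR (- (2 * ln (frankW theta (ucdf z.1) (ucdf z.2)))))%R.
Proof.
have W0 := frankW_gt0 theta (ucdf z.1) (c01 z.2).
by rewrite /frank_density /frank expRN; congr (_ / _)%R; rewrite expRM_natl lnK.
Qed.

Lemma measurable_frank_density : measurable_fun setT frank_density.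
Proof.
rewrite (_ : frank_density = fun z : plane => texp theta 1 * expR (theta * (ucdf z.1 + ucdf z.2)) *
  expR (- (2 * ln (frankW theta (ucdf z.1) (ucdf z.2)))))%R; last first.
  by apply/funext => z; exact: frank_densityE.
apply: measurable_funM.
  apply: measurable_funM => //; apply: (measurableT_comp (f := @expR R)) => //.
  by apply: measurable_funM => //; exact: measurable_funD.
apply: (measurableT_comp (f := @expR R)) => //; apply: measurableT_comp => //.
apply: measurable_funM => //.
apply: (measurableT_comp (f := @ln R)); first exact: measurable_ln.
apply: measurable_funD => //; apply: measurable_funM; last first.
  exact: (measurableT_comp mtexp).
by apply: measurable_funM => //; exact: (measurableT_comp mtexp).
Qed.

Let mf := measurable_frank_density.

(** [frankH] is the primitive of [frank] in [x] vanishing at [0]; it equals [1] at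
    [x = 1], hence the uniform marginals. *)
Lemma frank_density_column x y :
  \int[U]_(x' in lray x) (frank_density (x', y))%:E = (frankH theta (ucdf x) (ucdf y))%:E.
Proof.
have cf := @continuous_frank R theta _ (c01 y).
rewrite (@integral_uniform01_lray R (fun t => (frank theta t (ucdf y))%:E)); last 2 first.
- by apply/measurable_EFinP; exact: continuous_measurable_fun.
- by move=> t; rewrite lee_fin frank_ge0.
rewrite (FTC2_itv _ cf (fun t => is_derive_frankH theta t (c01 y))) ?ucdf_ge0//.
by rewrite frankH0 subr0.
Qed.

Lemma frank_density_col1 y : \int[U]_x (frank_density (x, y))%:E = 1.
Proof.
rewrite integral_lray1; last 2 first.
- by apply/measurable_EFinP; exact: measurable_fun_pair1.
- by move=> t; rewrite lee_fin frank_density_ge0.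
by rewrite frank_density_column ucdf_ge1// frankH1.
Qed.

Lemma frank_density_row1 x : \int[U]_y (frank_density (x, y))%:E = 1.
Proof.
by rewrite -(frank_density_col1 x); apply: eq_integral => y _; rewrite /frank_density/= frankC.
Qed.

Lemma frank_permuton : exists mu : probability plane R,
  [/\ permuton mu, (forall A, measurable A -> mu A = \int[u]_(z in A) (frank_density z)%:E) &
      density_on_square mu (frank theta)].
Proof.
have mef : measurable_fun setT (fun z : plane => (frank_density z)%:E) by apply/measurable_EFinP.
have ef0 (z : plane) : 0 <= (frank_density z)%:E by rewrite lee_fin frank_density_ge0.
have f1 : \int[u]_z (frank_density z)%:E = 1.
  rewrite integral_u12//; under eq_integral do rewrite frank_density_row1.
  transitivity (\int[U]_(y in setT) (cst 1 y)) => //.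
  by rewrite integral_cst// mul1e; exact: probability_setT.
have [mu muE] := density_probability mf frank_density_ge0 f1.
have mS : measurable (unit_square : set plane) by apply: measurableX; exact: measurable_itv.
have dens A : measurable A ->
    mu A = \int[lam \x lam]_(z in A `&` unit_square) (frank theta z.1 z.2)%:E.
  move=> mA; rewrite muE (integral_uniform_square mA mef ef0); apply: eq_integral => z.
  rewrite inE => -[_ [/= + +]]; rewrite !in_itv/= => z1 z2.
  by rewrite /frank_density !ucdf_id.
exists mu; split => //; split.
- by rewrite dens// -(probability_setT mu) dens// setIid setTI.
- move=> A mA.
  have mA' : measurable (fst @^-1` A : set plane).
    by rewrite -[X in measurable X]setTI; exact: measurable_fst.
  rewrite /pushforward muE integral_mkcond integral_u12; last 2 first.
  + by apply/(measurable_restrictT (fun z : plane => (frank_density z)%:E)) => //; exact: measurable_funTS.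
  + by move=> z; rewrite patchE; case: ifP.
  transitivity (\int[U]_(x in A) (cst 1 x)); last by rewrite integral_cst// mul1e.
  rewrite [RHS]integral_mkcond; apply: eq_integral => x _; rewrite patchE.
  case: ifPn => xA.
    rewrite -[RHS](frank_density_row1 x); apply: eq_integral => y _; by rewrite patchE ifT.
  apply: integral0_eq => y _; by rewrite patchE ifN.
- move=> A mA.
  have mA' : measurable (snd @^-1` A : set plane).
    by rewrite -[X in measurable X]setTI; exact: measurable_snd.
  rewrite /pushforward muE integral_mkcond integral_u21; last 2 first.
  + by apply/(measurable_restrictT (fun z : plane => (frank_density z)%:E)) => //; exact: measurable_funTS.
  + by move=> z; rewrite patchE; case: ifP.
  transitivity (\int[U]_(x in A) (cst 1 x)); last by rewrite integral_cst// mul1e.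
  rewrite [RHS]integral_mkcond; apply: eq_integral => y _; rewrite patchE.
  case: ifPn => yA.
    rewrite -[RHS](frank_density_col1 y); apply: eq_integral => x _; by rewrite patchE ifT.
  apply: integral0_eq => x _; by rewrite patchE ifN.
Qed.

Lemma ccdf_frank_density x y : ccdf frank_density x y = frankH theta (ucdf x) (ucdf y).
Proof. by rewrite /ccdf frank_density_column. Qed.

Section maximal.
Variable mu : probability plane R.
Hypothesis pmu : permuton mu.
Hypothesis muE : forall A, measurable A -> mu A = \int[u]_(z in A) (frank_density z)%:E.

(** The derivative of [ln (frankW x y)] in [y] is [theta * frankH x y]. Working
    with [theta * pcdf], instead of [pcdf], covers [theta = 0]. *)
Lemma expR_pcdf_frank (x y : mR) :
  expR (theta * pcdf mu x y) = (frankW theta (ucdf x) (ucdf y) / texp theta 1)%R.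
Proof.
have cH := @continuous_frankH R theta _ (c01 x).
have H0 t : (0 <= frankH theta (ucdf x) t)%R by exact: frankH_ge0.
have G : (pcdf mu x y)%:E = \int[lam]_(t in `[0%R, ucdf y]) (frankH theta (ucdf x) t)%:E.
  rewrite (pcdf_integral_ccdf mf frank_density_ge0 muE frank_density_col1).
  under eq_integral do rewrite ccdf_frank_density.
  rewrite (@integral_uniform01_lray R (fun t => (frankH theta (ucdf x) t)%:E))//.
  by apply/measurable_EFinP; exact: continuous_measurable_fun.
have G' : (theta * pcdf mu x y = ln (frankW theta (ucdf x) (ucdf y)) - ln (texp theta 1))%R.
  have -> : pcdf mu x y = (\int[lam]_(t in `[0%R, ucdf y]) frankH theta (ucdf x) t)%R.
    by rewrite /Rintegral -G.
  have E := @RintegralZl _ _ _ lam `[0%R, ucdf y]%classic (frankH theta (ucdf x)) theta.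
  rewrite -E//; last exact: continuous_itv_integrable.
  rewrite /Rintegral (FTC2_itv _ _ (fun t => is_derive_ln_frankW theta t (c01 x))) ?ucdf_ge0//.
    by rewrite frankW0.
  by move=> t; apply: cvgM; [exact: cvg_cst | exact: cH].
by rewrite G' expRD expRN !lnK// posrE ?texp_gt0// frankW_gt0.
Qed.

(** The Frank copula solves the equation which characterises the maximisers. The
    exceptional set is the half-plane [x <= 0], where the clamped abscissa
    vanishes. *)
Lemma frank_density_fixed_point : {ae u, forall z, frank_density z = gibbs_density theta mu frank_density z}.
Proof.
exists (lray 0%R `*` setT); split.
- by apply: measurableX => //; exact: measurable_lray.
- transitivity (U (lray (0%R : R)) * U setT).
    by apply: product_measure1E => //; exact: measurable_lray.
  by rewrite uniform01_lray ?lexx ?ler01// mul0e.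
move=> z /= zN; split => //; rewrite /lray/= leNgt; apply/negP => z0; apply: zN.
have c0 : (0 < ucdf z.1)%R.
  have [z1|z1] := leP 1%R z.1; first by rewrite ucdf_ge1.
  by rewrite ucdf_id// !ltW.
have W0 := frankW_gt0 theta (ucdf z.1) (c01 z.2).
have K1 : (0 < texp theta 1)%R by exact: texp_gt0.
have Kc : (0 < texp theta (ucdf z.1))%R by exact: texp_gt0.
rewrite /gibbs_density ccdf_frank_density /tilt.
have -> : (theta * (ucdf z.1 - pcdf mu z.1 z.2) - ln (ucdf z.1) - ucgf (theta * ucdf z.1) =
  (theta * ucdf z.1 - ln (ucdf z.1) - ucgf (theta * ucdf z.1)) - theta * pcdf mu z.1 z.2)%R by ring.
rewrite expRD -/(column_factor theta (ucdf z.1)) column_factorE// expRN expR_pcdf_frank /frank_density /frank /frankH.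
rewrite mulrDr expRD; field.
by rewrite !gt_eqF.
Qed.

Lemma objective_frank : objective theta mu = (mrate theta)%:E.
Proof.
exact: (objective_density_attained pmu mf frank_density_ge0 muE frank_density_col1 frank_density_fixed_point).
Qed.

End maximal.
End frank_permuton.

(** * The supremum and the point where it is attained *)

Section supremum.
Context {R : realType}.
Notation mR := (measurableTypeR R).
Notation plane := (mR * mR)%type.

Lemma maximiser_exists (theta : R) : exists mu : probability plane R,
  [/\ permuton mu, density_on_square mu (rho theta) &
      objective theta mu = (mrate theta)%:E].
Proof.
have [mu [pmu muE dmu]] := frank_permuton theta.
exists mu; split => //; last exact: objective_frank.
move=> A mA; rewrite dmu//; apply: eq_integral => z; rewrite inE => -[_ [_ /=]].
by rewrite in_itv/= => z2; rewrite rho_frank.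
Qed.

Lemma CsupE (theta : R) : Csup theta = (mrate theta)%:E.
Proof.
apply/eqP; rewrite eq_le; apply/andP; split.
  by apply: ge_ereal_sup => _ [mu pmu <-]; exact: objective_le.
have [mu [pmu _ <-]] := maximiser_exists theta.
by apply: ereal_sup_ubound; exists mu.
Qed.

Lemma C_mrate : (C : R -> R) = mrate.
Proof. by apply/funext => theta; rewrite /C CsupE. Qed.

End supremum.

Theorem proposition1p11 (R : realType) :
  (forall theta : R,
    [/\ Csup theta \is a fin_num,
        (Cn n theta - Cn n 0) / n%:R @[n --> \oo] --> C theta,
        exists mu : probability (measurableTypeR R * measurableTypeR R)%type R,
          [/\ permuton mu, density_on_square mu (rho theta),
              objective theta mu = Csup theta &
              forall nu : probability (measurableTypeR R * measurableTypeR R)%type R,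
                permuton nu -> objective theta nu = Csup theta ->
                forall A, measurable A -> nu A = mu A] &
        Csup theta = ext0 C_formula theta]) /\
  (forall theta : R,
    derivable (C : R -> R) theta 1 /\
    (forall n, derivable (@Cn R n : R -> R) theta 1)) /\
  (forall theta0 : R,
    [/\ Pr_mallows n theta0 [set s : 'S_n | unique_root (@ML R n s)] @[n --> \oo] --> (1 : R),
        Pr_mallows n theta0 [set s : 'S_n | unique_root (@LD R n s)] @[n --> \oo] --> (1 : R),
        forall est : (forall n, 'S_n -> R),
          root_estimator (@ML R) est -> consistent_at theta0 est &
        forall est : (forall n, 'S_n -> R),
          root_estimator (@LD R) est -> consistent_at theta0 est]).

Proof.
split; [|split].
- move=> theta; split.
  + by rewrite CsupE.
  + by rewrite C_mrate; exact: cvg_Cn.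
  + have [mu [pmu dmu omu]] := maximiser_exists theta.
    exists mu; split => //; first by rewrite CsupE.
    by move=> nu pnu; rewrite CsupE => onu; exact: maximiser_unique pmu omu pnu onu.
  + by rewrite CsupE ext0_C_formula.
- move=> theta; split; first by rewrite C_mrate; exact: derivable_mrate.
  by move=> n; have [] := is_derive_Cn n theta.
- move=> theta0.
  have [ML1 ML2] := ML_consistent theta0.
  have [LD1 LD2] := LD_consistent theta0 C_mrate.
  by split.
Qed.
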